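(* Let $(M,d)$ be any one of the following six sub-Finsler manifolds: $M=\mathbb{R}^3$ with $X_1=\partial_x-\tfrac{y}{2}\partial_z$, $X_2=\partial_y+\tfrac{x}{2}\partial_z$ (Heisenberg); $M=\mathbb{R}^2$ with $X_1=\partial_x$, $X_2=x\partial_y$ (Grushin); $M=\mathbb{R}^3$ with $X_1=\partial_x+y^2\partial_z$, $X_2=\partial_y$ (Martinet). In each case $d$ is the sub-Finsler distance associated with either the norm $\|\cdot\|_\infty$ or the norm $\|\cdot\|_1$ (see context) on $\mathrm{span}\{X_1,X_2\}$. Let $n=\dim M$. Then for every $r>0$ the sphere $S_r=\{q\in M: d(0,q)=r\}$ centered at the origin is homeomorphic to the Euclidean sphere $S^{n-1}$, is a Euclidean $(n-1)$-rectifiable subset of $\mathbb{R}^n$, and is a semianalytic subset of $\mathbb{R}^n$.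
   Context: For $q\in M$ and $v\in\mathrm{span}\{X_1(q),X_2(q)\}$ set $\|v\|_\infty=\min\{\max(|w_1|,|w_2|): v=w_1X_1(q)+w_2X_2(q)\}$ and $\|v\|_1=\min\{|w_1|+|w_2|: v=w_1X_1(q)+w_2X_2(q)\}$. A curve $\gamma:[0,T]\to M$ is horizontal if it is absolutely continuous and $\dot\gamma(t)\in\mathrm{span}\{X_1(\gamma(t)),X_2(\gamma(t))\}$ for a.e. $t$; its length is $\int_0^T\|\dot\gamma(t)\|\,dt$ for the chosen norm $\|\cdot\|$, and $d(p,q)$ is the infimum of lengths of horizontal curves from $p$ to $q$. *)

(* Defs.v *)
From HB Require Import structures.
From mathcomp Require Import all_boot all_order all_algebra.
From mathcomp Require Import all_classical all_reals all_analysis.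

Set Implicit Arguments.
Unset Strict Implicit.
Unset Printing Implicit Defensive.

Import Order.TTheory GRing.Theory Num.Theory.
Import numFieldNormedType.Exports.

Local Open Scope classical_set_scope.
Local Open Scope ring_scope.

Section SubFinsler.
Variable R : realType.

Definition coord {n} (q : 'rV[R]_n.+1) (k : nat) : R := q ord0 (inord k).
Definition vec2 (a b : R) : 'rV[R]_2 := \row_(i < 2) nth 0 [:: a; b] i.
Definition vec3 (a b c : R) : 'rV[R]_3 := \row_(i < 3) nth 0 [:: a; b; c] i.

Definition enorm {n} (x : 'rV[R]_n) : R := Num.sqrt (\sum_i x ord0 i ^+ 2).

Definition heis_X1 (q : 'rV[R]_3) : 'rV[R]_3 := vec3 1 0 (- coord q 1 / 2).
Definition heis_X2 (q : 'rV[R]_3) : 'rV[R]_3 := vec3 0 1 (coord q 0 / 2).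
Definition grushin_X1 (q : 'rV[R]_2) : 'rV[R]_2 := vec2 1 0.
Definition grushin_X2 (q : 'rV[R]_2) : 'rV[R]_2 := vec2 0 (coord q 0).
Definition martinet_X1 (q : 'rV[R]_3) : 'rV[R]_3 := vec3 1 0 (coord q 1 ^+ 2).
Definition martinet_X2 (q : 'rV[R]_3) : 'rV[R]_3 := vec3 0 1 0.

Inductive normkind := NormInf | Norm1.

Definition combine (b : normkind) (w1 w2 : R) : R :=
  match b with
  | NormInf => Num.max `|w1| `|w2|
  | Norm1 => `|w1| + `|w2|
  end.

(* ||v||_q = min { combine |w1| |w2| : v = w1 X1(q) + w2 X2(q) }
   (as an infimum in \bar R; it is +oo iff v is not in the span). *)
Definition sf_norm {n} (X1 X2 : 'rV[R]_n -> 'rV[R]_n) (b : normkind)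
    (q v : 'rV[R]_n) : \bar R :=
  ereal_inf [set (combine b w.1 w.2)%:E |
             w in [set w : R * R | v = w.1 *: X1 q + w.2 *: X2 q]].

Definition abs_cont_on {n} (T : R) (g : R -> 'rV[R]_n) : Prop :=
  forall eps : R, 0 < eps -> exists2 delta : R, 0 < delta &
    forall (N : nat) (a b : nat -> R),
      (forall k, (k < N)%N ->
         0 <= a k /\ a k <= b k /\ b k <= T /\
         ((k.+1 < N)%N -> b k <= a k.+1)) ->
      \sum_(k < N) (b k - a k) < delta ->
      \sum_(k < N) enorm (g (b k) - g (a k)) < eps.

Definition horizontal {n} (X1 X2 : 'rV[R]_n -> 'rV[R]_n) (T : R)
    (g : R -> 'rV[R]_n) : Prop :=
  0 <= T /\ abs_cont_on T g /\
  {ae (@lebesgue_measure R), forall t, `[0, T]%classic t ->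
     derivable g t 1 /\
     exists w : R * R, derive1 g t = w.1 *: X1 (g t) + w.2 *: X2 (g t)}.

Definition sf_length {n} (X1 X2 : 'rV[R]_n -> 'rV[R]_n) (b : normkind)
    (T : R) (g : R -> 'rV[R]_n) : \bar R :=
  \int[@lebesgue_measure R]_(t in [set t : R | 0 <= t <= T])
    sf_norm X1 X2 b (g t) (derive1 g t).

Definition sf_dist {n} (X1 X2 : 'rV[R]_n -> 'rV[R]_n) (b : normkind)
    (p q : 'rV[R]_n) : \bar R :=
  ereal_inf [set sf_length X1 X2 b c.1 c.2 |
     c in [set c : R * (R -> 'rV[R]_n) |
             horizontal X1 X2 c.1 c.2 /\ c.2 0 = p /\ c.2 c.1 = q]].

Definition sf_sphere {n} (X1 X2 : 'rV[R]_n -> 'rV[R]_n) (b : normkind)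
    (r : R) : set 'rV[R]_n :=
  [set q | sf_dist X1 X2 b 0 q = r%:E].

Definition eucl_unit_sphere (n : nat) : set 'rV[R]_n :=
  [set x | \sum_i x ord0 i ^+ 2 = 1].

Definition homeomorphic {n} (A B : set 'rV[R]_n) : Prop :=
  exists (f g : 'rV[R]_n -> 'rV[R]_n),
    [/\ (forall x, A x -> B (f x)) /\ (forall y, B y -> A (g y)),
        (forall x, A x -> g (f x) = x), (forall y, B y -> f (g y) = y),
        {within A, continuous f} & {within B, continuous g}].

(* Hausdorff measure (Euclidean metric; normalising constant omitted,
   which is irrelevant for null sets).                                *)
Definition ediam {n} (A : set 'rV[R]_n) : \bar R :=
  ereal_sup ([set 0%E] `|` [set (enorm (x.1 - x.2))%:E | x in A `*` A]).

Definition hausdorff_pre {n} (m : nat) (delta : R) (A : set 'rV[R]_n)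
    : \bar R :=
  ereal_inf [set (\sum_(i <oo) (ediam (C i)) ^+ m)%E |
     C in [set C : nat -> set 'rV[R]_n |
             A `<=` \bigcup_i C i /\ forall i, (ediam (C i) <= delta%:E)%E]].

Definition hausdorff {n} (m : nat) (A : set 'rV[R]_n) : \bar R :=
  ereal_sup [set hausdorff_pre m delta A | delta in `]0, +oo[%classic].

Definition elipschitz {m n} (f : 'rV[R]_m -> 'rV[R]_n) : Prop :=
  exists L : R, forall x y, enorm (f x - f y) <= L * enorm (x - y).

Definition rectifiable {n} (m : nat) (E : set 'rV[R]_n) : Prop :=
  exists f : nat -> 'rV[R]_m -> 'rV[R]_n,
    (forall i, elipschitz (f i)) /\
    hausdorff m (E `\` \bigcup_i range (f i)) = 0%E.

Definition monomial {n} (y : 'rV[R]_n) (al : 'rV[nat]_n) : R :=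
  \prod_i y ord0 i ^+ al ord0 i.

Definition mindex_of {n N} (al : {ffun 'I_n -> 'I_N}) : 'rV[nat]_n :=
  \row_i (al i : nat).

Definition pseries_partial {n} (c : 'rV[nat]_n -> R) (a x : 'rV[R]_n)
    (N : nat) : R :=
  \sum_(al : {ffun 'I_n -> 'I_N.+1} | (\sum_i (al i : nat) <= N)%N)
     c (mindex_of al) * monomial (x - a) (mindex_of al).

Definition analytic_at {n} (f : 'rV[R]_n -> R) (a : 'rV[R]_n) : Prop :=
  exists (c : 'rV[nat]_n -> R) (rho : R), 0 < rho /\
    forall x, enorm (x - a) < rho ->
      (\esum_(al in [set: 'rV[nat]_n]) (`|c al * monomial (x - a) al|)%:E
         < +oo)%E /\
      pseries_partial c a x @ \oo --> f x.

Definition analytic_on {n} (U : set 'rV[R]_n) (f : 'rV[R]_n -> R) : Prop :=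
  forall x, U x -> analytic_at f x.

Definition semianalytic {n} (S : set 'rV[R]_n) : Prop :=
  forall a : 'rV[R]_n, exists U : set 'rV[R]_n,
    [/\ open U, U a &
     exists (k p q : nat) (F : 'I_k -> 'I_p -> 'rV[R]_n -> R)
            (G : 'I_k -> 'I_q -> 'rV[R]_n -> R),
       (forall i j, analytic_on U (F i j)) /\
       (forall i j, analytic_on U (G i j)) /\
       S `&` U = U `&` [set x | exists i : 'I_k,
                          (forall j, F i j x = 0) /\ (forall j, 0 < G i j x)]].

Definition sphere_properties {n} (X1 X2 : 'rV[R]_n -> 'rV[R]_n)
    (b : normkind) (r : R) : Prop :=
  let S := sf_sphere X1 X2 b r in
  [/\ homeomorphic S (@eucl_unit_sphere n), rectifiable n.-1 S & semianalytic S].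

End SubFinsler.

(* Main.v *)
Require Import Defs.
From HB Require Import structures.
From mathcomp Require Import all_boot all_order all_algebra.
From mathcomp Require Import all_classical all_reals all_analysis.
From mathcomp Require Import measurable_realfun ring lra.
From mathcomp Require Import ordered_qelim qe_rcf.

Set Implicit Arguments.
Unset Strict Implicit.
Unset Printing Implicit Defensive.

Import Order.TTheory GRing.Theory Num.Theory.
Import numFieldNormedType.Exports.

Local Open Scope classical_set_scope.
Local Open Scope ring_scope.

(** Concatenations of finitely many pieces with constant controls (a, b) reach every point, and
    calibrations (potentials whose derivative along a horizontal curve is at most c times its
    speed) show that any horizontal curve can be replaced by one made of five pieces, with the
    same end point and no longer.  The distance D from the origin is therefore the infimum of the
    costs of piecewise constant controls, and five pieces always suffice.

    Semianalyticity: "D(q) = r" becomes a first-order formula over the real field, hence by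
    quantifier elimination a boolean combination of polynomial conditions.

    Topology: D is homogeneous under anisotropic dilations, bounded below by 1 on the boundary of
    the unit cube and continuous there, so radial projection identifies the sphere of radius r
    with the boundary of the cube, hence with the Euclidean sphere.

    Rectifiability: on a face of the cube D is Lipschitz, because the last coordinate of an end
    point can be corrected by inserting a small piece before and its inverse after a prefix which
    has moved far enough.  This fails only at the points (1, 0, 0) and (-1, 0, 0) of the Martinet
    case; the remaining part of that face is a countable union of boxes with rational corners. *)

(** * Definable sets are semianalytic *)

Section PolynomialFunctions.
Variables (R : realType) (n : nat).
Implicit Types (f g : 'rV[R]_n -> R) (a x : 'rV[R]_n).

(** The speed of a horizontal curve is not known to be measurable, so comparisons with its integral
    pass through the simple functions below it. For the Heisenberg and Martinet structures,
    calibrations bound the last coordinate of the end point from above, and a reflection of the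
    system bounds it from below. Each bound comes with a control word. Along the segment joining the
    two words the other coordinates of the end point are constant, the cost is convex and the last
    coordinate is polynomial, so some word of the segment has exactly the given end point. In the
    Grushin plane rescaling one control is enough. Five is the number of pieces of the Heisenberg
    extremals and of the Martinet extremals for the sup norm; shorter words are padded with zero
    pieces, because a formula has a fixed number of quantifiers. In the Martinet case a word may run
    to (1, 0, 0) along the abnormal line y = 0 without ever leaving it, and then the insertion has
    nothing to act on. A small loop at the end still corrects the last coordinate at small cost, but
    not at linear cost: this gives continuity and no Lipschitz bound. *)

Definition polysum (s : seq (R * 'rV[nat]_n)) a x : R :=
  \sum_(p <- s) p.1 * monomial (x - a) p.2.

(** An expansion is asked around every centre, so that analyticity at [a] is read off directly and
    no polynomial ever has to be recentred. *)
Definition polyfun f := forall a, exists s, forall x, f x = polysum s a x.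

Lemma monomialD (y : 'rV[R]_n) (al be : 'rV[nat]_n) :
  monomial y (al + be) = monomial y al * monomial y be.
Proof.
by rewrite /monomial -big_split /=; apply: eq_bigr => i _; rewrite mxE exprD.
Qed.

Lemma monomial0 (y : 'rV[R]_n) : monomial y 0 = 1.
Proof. by rewrite /monomial big1 // => i _; rewrite mxE expr0. Qed.

Lemma polyfun_cst (c : R) : polyfun (fun=> c).
Proof.
by move=> a; exists [:: (c, 0)] => x; rewrite /polysum big_seq1 monomial0 mulr1.
Qed.

Lemma polyfunD f g : polyfun f -> polyfun g -> polyfun (fun x => f x + g x).
Proof.
move=> Pf Pg a; have [s fE] := Pf a; have [t gE] := Pg a.
by exists (s ++ t) => x; rewrite fE gE /polysum big_cat.
Qed.

Lemma polyfunM f g : polyfun f -> polyfun g -> polyfun (fun x => f x * g x).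
Proof.
move=> Pf Pg a; have [s fE] := Pf a; have [t gE] := Pg a.
exists [seq (p.1 * q.1, p.2 + q.2) | p <- s, q <- t] => x.
rewrite fE gE /polysum big_allpairs_dep mulr_suml; apply: eq_bigr => p _ /=.
by rewrite mulr_sumr; apply: eq_bigr => q _ /=; rewrite monomialD mulrACA.
Qed.

Lemma polyfun_coord (i : 'I_n) : polyfun (fun x => x ord0 i).
Proof.
move=> a; exists [:: (a ord0 i, 0); (1, \row_j (j == i : nat))] => x.
rewrite /polysum !big_cons big_nil /= monomial0 mulr1 mul1r addr0 /monomial.
rewrite (bigD1 i) //= !mxE eqxx expr1 big1 ?mulr1 ?subrKC // => j /negPf ji.
by rewrite !mxE ji expr0.
Qed.

Lemma polyfunN f : polyfun f -> polyfun (fun x => - f x).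
Proof.
move=> Pf a; have [s fE] := polyfunM (polyfun_cst (-1)) Pf a.
by exists s => x; rewrite -fE mulN1r.
Qed.

Lemma polyfunX f k : polyfun f -> polyfun (fun x => f x ^+ k).
Proof.
move=> Pf; elim: k => [|k IH] a.
  by have [s sE] := polyfun_cst 1 a; exists s => x; rewrite -sE expr0.
by have [s sE] := polyfunM Pf IH a; exists s => x; rewrite -sE exprS.
Qed.

Lemma polyfunMn f k : polyfun f -> polyfun (fun x => f x *+ k).
Proof.
move=> Pf a; have [s sE] := polyfunM Pf (polyfun_cst k%:R) a.
by exists s => x; rewrite -sE mulr_natr.
Qed.

(** The list of terms may repeat a multi-index, hence the coefficient [c al] collects all terms with
    index [al]. The family of terms has finite support, and the partial sums are constant once [N]
    reaches the largest degree [M]. *)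
Lemma polyfun_analytic f a : polyfun f -> analytic_at f a.
Proof.
move=> /(_ a)[s fE].
pose c al := \sum_(p <- s | p.2 == al) p.1.
exists c, 1; split=> // x _; split.
  pose A := [set` [seq p.2 | p <- s]].
  have c0 al : ~ A al -> c al = 0.
    move=> nA; rewrite /c big_seq_cond big1 // => p /andP[ps /eqP pal].
    by case: nA; rewrite /A /= -pal; apply: map_f.
  have finA : finite_set A by exact: finite_seq.
  rewrite (_ : (\esum_(al in _) _)%E =
     (\esum_(al in A) (`|c al * monomial (x - a) al|)%:E)%E); last first.
    rewrite [RHS]esum_mkcond; apply: eq_esum => al _.
    case: ifPn => //; rewrite notin_setE => /c0 ->.
    by rewrite mul0r normr0.
  rewrite esum_fset //.
  by rewrite fsbig_finite //= sumEFin ltry.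
pose dg (al : 'rV[nat]_n) := (\sum_i al ord0 i)%N.
pose M := (\max_(p <- s) dg p.2)%N.
apply: cvg_near_cst; near=> N.
have MN : (M <= N)%N by near: N; exists M.
rewrite fE /polysum /pseries_partial /c.
under eq_bigr do rewrite mulr_suml big_mkcond.
rewrite /= exchange_big /= [LHS]big_seq [RHS]big_seq; apply: eq_bigr => p ps.
have pM : (dg p.2 <= N)%N.
  apply: leq_trans MN; rewrite /M.
  by rewrite (big_rem p) //= leq_maxl.
have pi i : (p.2 ord0 i <= N)%N.
  by apply: leq_trans pM; rewrite /dg (bigD1 i) //= leq_addr.
pose al0 : {ffun 'I_n -> 'I_N.+1} := [ffun i => inord (p.2 ord0 i)].
have mal0 : mindex_of al0 = p.2.
  apply/rowP => i; rewrite mxE ffunE inordK ?ltnS //.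
rewrite (bigD1 al0) /=; last first.
  by rewrite (eq_bigr (fun i => p.2 ord0 i)) // => i _; rewrite ffunE inordK ?ltnS.
rewrite mal0 eqxx big1 ?addr0 // => al /andP[_ nal].
rewrite ifF //; apply/negP => /eqP pE; case/eqP: nal; apply/ffunP => i.
by apply/val_inj; rewrite ffunE pE mxE inord_val.
Unshelve. all: by end_near.
Qed.

End PolynomialFunctions.

Section Semialgebraic.
Variables (R : realType) (n : nat).

Definition env (q : 'rV[R]_n) : seq R := [seq q ord0 i | i <- enum 'I_n].

Lemma nth_env q (i : 'I_n) : nth 0 (env q) i = q ord0 i.
Proof.
rewrite (nth_map i) ?size_enum_ord //; congr (q ord0 _).
by apply/val_inj; rewrite /= nth_enum_ord.
Qed.

Lemma polyfun_eval (t : GRing.term R) :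
  GRing.rterm t -> polyfun (fun q => GRing.eval (env q) t).
Proof.
elim: t => //=.
- move=> i _; have [ilt|ige] := ltnP i n.
    move=> a; have [s sE] := polyfun_coord (Ordinal ilt) a.
    by exists s => x; rewrite -sE -nth_env.
  move=> a; have [s sE] := @polyfun_cst R n 0 a; exists s => x.
  by rewrite -sE nth_default // size_map size_enum_ord.
- by move=> c _; exact: polyfun_cst.
- by move=> c _; exact: polyfun_cst.
- by move=> s IHs t IHt /andP[/IHs ? /IHt ?]; exact: polyfunD.
- by move=> s IHs /IHs ?; exact: polyfunN.
- by move=> s IHs k /IHs ?; exact: polyfunMn.
- by move=> s IHs t IHt /andP[/IHs ? /IHt ?]; exact: polyfunM.
- by move=> s IHs k /IHs ?; exact: polyfunX.
Qed.

Local Notation clause := (seq (GRing.term R) * seq (GRing.term R))%type.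

Definition clause_eval (e : seq R) (c : clause) :=
  all (fun t => GRing.eval e t == 0) c.1 && all (fun t => 0 < GRing.eval e t) c.2.

Lemma holds_w_to_oclause e (c : clause) :
  ord.holds e (ord.odnf_to_oform [:: ord.w_to_oclause c]) <-> clause_eval e c.
Proof.
case: c => ps qs; rewrite /clause_eval /=.
have -> : ord.holds e (foldr (fun t => ord.And (ord.Equal t (GRing.NatConst R 0)))
    (ord.Bool true) ps) <-> all (fun t => GRing.eval e t == 0) ps.
  elim: ps => [|p ps IH] //=; rewrite IH.
  by split=> [[/eqP-> ->]//|/andP[/eqP]].
have -> : ord.holds e (foldr (fun t => ord.And (ord.Lt (GRing.NatConst R 0) t))
    (ord.Bool true) qs) <-> all (fun t => 0 < GRing.eval e t) qs.
  elim: qs => [|p qs IH] //=; rewrite IH.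
  by split=> [[-> ->]//|/andP[]].
split=> [[[-> [_ [-> _]]]|]//|/andP[-> ->]].
by left.
Qed.

(** Quantifier elimination over the real closed field [R], then a disjunctive normal form.
    [oclause_to_w] splits negated equations and weak inequalities into further clauses, so that only
    the equations and strict inequalities allowed by [semianalytic] remain. *)
Lemma definable_clauses (f : ord.formula R) : exists L : seq clause,
  all (fun c => all (@GRing.rterm R) (c.1 ++ c.2)) L /\
  forall e, ord.holds e f <-> has (clause_eval e) L.
Proof.
pose g := ord.quantifier_elim (@wproj R) (ord.to_rform f).
have gwf : ord.qf_form g && ord.rformula g.
  exact: (ord.quantifier_elim_wf (@wf_QE_wproj R) (ord.to_rform_rformula f)).
have fg e : ord.holds e f <-> ord.qf_eval e g.
  split=> [/(rcf_satP e)//|H].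
  exact/(rcf_satP e).
pose L := flatten [seq ord.oclause_to_w c | c <- ord.qf_to_odnf g false].
exists L; split=> [|e].
  have /andP[_ rg] := gwf.
  have := ord.qf_to_dnf_rterm false rg.
  rewrite /L; elim: (ord.qf_to_odnf g false) => //= c cs IH /andP[rc /IH rcs].
  rewrite all_cat rcs andbT; have := ord.dnf_rterm_subproof rc.
  elim: (ord.oclause_to_w c) => //= d ds IHd /andP[rd /IHd ->].
  by move: rd; rewrite /ord.dnf_rterm /= andbT all_cat => ->.
rewrite fg -ord.qf_to_dnfP //.
have -> : ord.qf_eval e (ord.odnf_to_oform (ord.qf_to_odnf g false)) <->
   ord.holds e (ord.odnf_to_oform (ord.qf_to_odnf g false)).
  by split=> [/ord.qf_evalP|H]; [apply; exact: ord.dnf_to_form_qf|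
    apply/ord.qf_evalP => //; exact: ord.dnf_to_form_qf].
have holds_cons (c : ord.oclause R) cs : ord.holds e (ord.odnf_to_oform (c :: cs)) <->
    ord.holds e (ord.odnf_to_oform [:: c]) \/ ord.holds e (ord.odnf_to_oform cs).
  by rewrite /=; intuition.
have w_has (ws : seq clause) :
    ord.holds e (ord.odnf_to_oform (map (@ord.w_to_oclause R) ws)) <->
    has (clause_eval e) ws.
  elim: ws => [|w ws IH]; first by [].
  rewrite map_cons holds_cons IH holds_w_to_oclause /=.
  by split=> [[]->|/orP[]]; rewrite ?orbT; [| |left|right].
rewrite /L; elim: (ord.qf_to_odnf g false) => [|c cs IH]; first by [].
rewrite holds_cons IH ord.oclause_neq_leq_elimP ord.oclause_to_wP w_has /=.
by rewrite has_cat; split=> [[]->|/orP[]]; rewrite ?orbT; [| |left|right].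
Qed.

Lemma definable_semianalytic (f : ord.formula R) (S : set 'rV[R]_n) :
  (forall q, S q <-> ord.holds (env q) f) -> semianalytic S.
Proof.
move=> SE a; exists setT; split; [exact: openT|by []|].
have [L [rL LE]] := definable_clauses f.
pose p := (\max_(c <- L) size c.1)%N.
pose q := (\max_(c <- L) size c.2)%N.
pose dc : clause := ([::], [::]).
(* Clauses have different lengths while [semianalytic] asks for common [p] and [q]: the default
   terms pad with the equation 0 = 0 and the inequality 0 < 1. *)
pose F (i : 'I_(size L)) (j : 'I_p) (x : 'rV[R]_n) : R :=
  GRing.eval (env x) (nth (GRing.NatConst R 0) (nth dc L i).1 j).
pose G (i : 'I_(size L)) (j : 'I_q) (x : 'rV[R]_n) : R :=
  GRing.eval (env x) (nth (GRing.NatConst R 1) (nth dc L i).2 j).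
have rLi (i : 'I_(size L)) : all (@GRing.rterm R) (nth dc L i).1 &&
    all (@GRing.rterm R) (nth dc L i).2.
  by rewrite -all_cat; exact: (all_nthP dc rL).
exists (size L), p, q, F, G; split; last split.
- move=> i j x _; apply/polyfun_analytic/polyfun_eval.
  have /andP[r1 _] := rLi i.
  have [jlt|jge] := ltnP j (size (nth dc L i).1); last by rewrite nth_default.
  exact: (all_nthP _ r1).
- move=> i j x _; apply/polyfun_analytic/polyfun_eval.
  have /andP[_ r1] := rLi i.
  have [jlt|jge] := ltnP j (size (nth dc L i).2); last by rewrite nth_default.
  exact: (all_nthP _ r1).
rewrite setIT setTI; apply/seteqP; split=> x.
  move=> /SE/LE/(has_nthP dc)[i iL /andP[/(all_nthP (GRing.NatConst R 0)) A]].
  move=> /(all_nthP (GRing.NatConst R 1)) B.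
  exists (Ordinal iL); split=> j; rewrite /F /G /=.
    have [jlt|jge] := ltnP j (size (nth dc L i).1); last by rewrite nth_default.
    exact/eqP/A.
  have [jlt|jge] := ltnP j (size (nth dc L i).2); first exact: B.
  by rewrite nth_default //= ltr01.
move=> [i [A B]]; apply/SE/LE/(has_nthP dc); exists i => //.
have ip : (size (nth dc L i).1 <= p)%N.
  rewrite /p (big_nth dc) big_mkord.
  by rewrite (bigD1 i) //= leq_maxl.
have iq : (size (nth dc L i).2 <= q)%N.
  rewrite /q (big_nth dc) big_mkord.
  by rewrite (bigD1 i) //= leq_maxl.
apply/andP; split.
  apply/(all_nthP (GRing.NatConst R 0)) => j jlt.
  by have := A (Ordinal (leq_trans jlt ip)); rewrite /F /= => ->.
apply/(all_nthP (GRing.NatConst R 1)) => j jlt.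
exact: (B (Ordinal (leq_trans jlt iq))).
Qed.

End Semialgebraic.

(** * Unit spheres of homogeneous functions *)

Section Norms.
Variables (R : realType).

Lemma enorm_ge0 n (x : 'rV[R]_n) : 0 <= enorm x.
Proof. exact: sqrtr_ge0. Qed.

Lemma enorm_sqr n (x : 'rV[R]_n) : enorm x ^+ 2 = \sum_i x ord0 i ^+ 2.
Proof. by rewrite sqr_sqrtr // sumr_ge0 // => i _; exact: sqr_ge0. Qed.

Lemma coord_le_enorm n (x : 'rV[R]_n) i : `|x ord0 i| <= enorm x.
Proof.
rewrite -(@ler_pXn2r _ 2) ?nnegrE ?enorm_ge0 // enorm_sqr real_normK ?num_real // (bigD1 i) //=.
by rewrite lerDl sumr_ge0 // => j _; exact: sqr_ge0.
Qed.

Lemma sqr_sum_le (I : Type) (s : seq I) (F : I -> R) : (forall i, 0 <= F i) ->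
  \sum_(i <- s) F i ^+ 2 <= (\sum_(i <- s) F i) ^+ 2.
Proof.
move=> F0; elim: s => [|i s IH]; first by rewrite !big_nil expr0n.
have S0 : 0 <= \sum_(j <- s) F j by exact: sumr_ge0.
rewrite !big_cons sqrrD -addrA lerD2l; apply: le_trans IH _.
by rewrite lerDr mulrn_wge0 // mulr_ge0.
Qed.

Lemma enorm_le_sum n (x : 'rV[R]_n) : enorm x <= \sum_i `|x ord0 i|.
Proof.
have S0 : 0 <= \sum_i `|x ord0 i| by exact: sumr_ge0.
rewrite -(@ler_pXn2r _ 2) ?nnegrE ?enorm_ge0 // enorm_sqr.
under eq_bigr do rewrite -real_normK ?num_real //.
exact: sqr_sum_le.
Qed.

Lemma enormZ n (c : R) (x : 'rV[R]_n) : enorm (c *: x) = `|c| * enorm x.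
Proof.
rewrite /enorm; under eq_bigr do rewrite mxE exprMn.
by rewrite -mulr_sumr sqrtrM ?sqr_ge0 // sqrtr_sqr.
Qed.

Lemma enorm_eq0 n (x : 'rV[R]_n) : enorm x = 0 -> x = 0.
Proof.
move=> x0; apply/rowP => i; rewrite mxE; apply/eqP.
by rewrite -normr_le0 -x0 coord_le_enorm.
Qed.

Lemma enorm0 n : enorm (0 : 'rV[R]_n) = 0.
Proof. by rewrite /enorm big1 ?sqrtr0 // => i _; rewrite mxE expr0n. Qed.

Lemma norm_rV_le n (x : 'rV[R]_n) (c : R) : 0 <= c ->
  (`|x| <= c) = [forall i, `|x ord0 i| <= c].
Proof.
move=> c0; rewrite [`|x|]mx_normrE; apply/bigmax_leP/forallP => [[_ H] i|H].
  exact: (H (ord0, i)).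
by split=> // -[i j] _ /=; rewrite ord1.
Qed.

Lemma coord_le_norm n (x : 'rV[R]_n) i : `|x ord0 i| <= `|x|.
Proof. by have := norm_rV_le x (normr_ge0 x); rewrite lexx => /esym/forallP. Qed.

Lemma norm_rV_attained n (x : 'rV[R]_n.+1) : exists i, `|x| = `|x ord0 i|.
Proof.
have [x0|x0] := eqVneq (mx_norm x) 0.
  exists ord0; rewrite [LHS]x0.
  by apply/esym/eqP; rewrite eq_le normr_ge0 andbT -x0; exact: coord_le_norm.
by have [[i j]] := mx_norm_neq0 x0; rewrite /= ord1 => xij; exists j.
Qed.

Lemma cvg_rV n (T : Type) (F : set_system T) (f : T -> 'rV[R]_n) (l : 'rV[R]_n) :
  Filter F -> (forall i, (f x ord0 i) @[x --> F] --> l ord0 i) -> f x @[x --> F] --> l.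
Proof.
move=> FF fl; apply/cvg_ballP => e e0.
have : \forall x \near F, forall i, ball (l ord0 i) e (f x ord0 i).
  by apply: filter_forall => i; move/cvg_ballP: (fl i); apply.
by apply: filterS => x Hx; split=> // i j; rewrite ord1.
Qed.

Lemma cvg_rsum (I T : Type) (s : seq I) (F : set_system T) (f : I -> T -> R) (l : I -> R) :
  Filter F -> (forall i, f i x @[x --> F] --> l i) ->
  (\sum_(i <- s) f i x) @[x --> F] --> \sum_(i <- s) l i.
Proof.
move=> FF fl; elim: s => [|i s IH].
  rewrite big_nil; under eq_fun do rewrite big_nil.
  exact: cvg_cst.
rewrite big_cons; under eq_fun do rewrite big_cons.
by apply: cvgD.
Qed.

Lemma cvg_coord n (T : Type) (F : set_system T) (f : T -> 'rV[R]_n) (l : 'rV[R]_n) i :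
  Filter F -> f x @[x --> F] --> l -> f x ord0 i @[x --> F] --> l ord0 i.
Proof.
by move=> FF fl; apply: (@cvg_comp _ _ _ f (fun y : 'rV[R]_n => y ord0 i)) fl _;
  exact: coord_continuous.
Qed.

Lemma cvg_enorm n (T : Type) (F : set_system T) (f : T -> 'rV[R]_n) (l : 'rV[R]_n) :
  Filter F -> f x @[x --> F] --> l -> enorm (f x) @[x --> F] --> enorm l.
Proof.
move=> FF fl.
apply: (@cvg_comp _ _ _ (fun x => \sum_i f x ord0 i ^+ 2) (@Num.sqrt R)).
  apply: (@cvg_rsum _ _ _ _ _ (fun i => l ord0 i ^+ 2)) => i.
  have fi : f x ord0 i @[x --> F] --> l ord0 i by exact: cvg_coord.
  by under eq_fun do rewrite expr2; rewrite expr2; exact: cvgM.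
exact: sqrt_continuous.
Qed.

Lemma hausdorff_set0 n m : (0 < m)%N -> hausdorff m (@set0 'rV[R]_n) = 0%E.
Proof.
move=> m0; apply/eqP; rewrite eq_le; apply/andP; split.
  apply: ge_ereal_sup => _ [d d0 <-]; apply: ereal_inf_lbound.
  have ed : ediam (@set0 'rV[R]_n) = 0%E.
    rewrite /ediam [X in ereal_sup X](_ : _ = [set 0%E]) ?ereal_sup1 //.
    by apply/seteqP; split=> [x [//|[y [[]]]]|x ->]; left.
  exists (fun=> set0).
    split=> // i; rewrite ed lee_fin.
    by move: d0; rewrite /= in_itv /= => /andP[/ltW].
  by apply: eseries0 => i _ _; apply/eqP; rewrite ed expe_eq0 m0 eqxx.
apply: (@le_trans _ _ (hausdorff_pre m 1 (@set0 'rV[R]_n))); last first.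
  by apply: ereal_sup_ubound; exists 1 => //=; rewrite in_itv /= ltr01.
apply: le_ereal_inf_tmp => _ [C _ <-]; apply: nneseries_ge0 => i _ _.
apply: expe_ge0; apply: ereal_sup_ubound; by left.
Qed.

End Norms.

Lemma clamp_lip (R : realFieldType) (a b c d : R) :
  `|Num.max b (Num.min a c) - Num.max b (Num.min a d)| <= `|c - d|.
Proof.
wlog cd : c d / d <= c => [H|].
  have [/H//|/ltW/H] := leP d c.
  by rewrite distrC => /le_trans; apply; rewrite distrC.
have m_le : Num.min a d <= Num.min a c by rewrite le_min !ge_min lexx cd orbT.
have m_ge : Num.min a c <= Num.min a d + (c - d).
  have [ad|da] := leP a d; first by rewrite ge_min; apply/orP; left; lra.
  by rewrite ge_min; apply/orP; right; lra.
have M_le : Num.max b (Num.min a d) <= Num.max b (Num.min a c).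
  by rewrite ge_max !le_max lexx m_le orbT.
have M_ge : Num.max b (Num.min a c) <= Num.max b (Num.min a d) + (c - d).
  rewrite ge_max; apply/andP; split.
    by rewrite -[leLHS]addr0 lerD ?le_max ?lexx ?subr_ge0.
  by apply: (le_trans m_ge); rewrite lerD2r le_max lexx orbT.
rewrite !ger0_norm ?subr_ge0 //; lra.
Qed.

Section Homogeneous.
Variables (R : realType) (n : nat) (w : 'I_n.+1 -> nat).
Hypothesis w_gt0 : forall i, (0 < w i)%N.
Local Notation V := 'rV[R]_n.+1.
Implicit Types (q u v : V) (t : R).

Definition dil t q : V := \row_i (t ^+ w i * q ord0 i).

Lemma dil1 q : dil 1 q = q.
Proof. by apply/rowP => i; rewrite mxE expr1n mul1r. Qed.

Lemma dilM s t q : dil s (dil t q) = dil (s * t) q.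
Proof. by apply/rowP => i; rewrite !mxE exprMn mulrA. Qed.

(** The homogeneous quasi-norm of the dilations whose unit sphere is the boundary of the cube;
    [dil (gauge q)^-1 q] is the radial projection of [q] to that boundary. *)
Definition gauge q : R := \big[Num.max/0]_i (`|q ord0 i| `^ (w i)%:R^-1).

Lemma gauge_ge0 q : 0 <= gauge q.
Proof. by apply: bigmax_ge_id. Qed.

Lemma rootK i (a : R) : 0 <= a -> (a `^ (w i)%:R^-1) ^+ w i = a.
Proof.
move=> a0; rewrite -powR_mulrn ?powR_ge0 // -powRrM mulVf ?powRr1 //.
by rewrite pnatr_eq0 -lt0n.
Qed.

Lemma root_le i (a t : R) : 0 <= a -> 0 <= t ->
  (a `^ (w i)%:R^-1 <= t) = (a <= t ^+ w i).
Proof.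
by move=> a0 t0; rewrite -(@ler_pXn2r _ (w i)) ?nnegrE ?powR_ge0 // rootK.
Qed.

Lemma gauge_le q t : 0 <= t -> (gauge q <= t) = [forall i, `|q ord0 i| <= t ^+ w i].
Proof.
move=> t0; apply/bigmax_leP/forallP => [[_ H] i|H].
  by rewrite -root_le // H.
by split=> // i _; rewrite root_le.
Qed.

Lemma gauge_lt q t : 0 < t -> (gauge q < t) = [forall i, `|q ord0 i| < t ^+ w i].
Proof.
move=> t0; apply/bigmax_ltP/forallP => [[_ H] i|H].
  by have := H i isT; rewrite -(@ltr_pXn2r _ (w i)) ?nnegrE ?powR_ge0 ?(ltW t0) // rootK.
split=> // i _; rewrite -(@ltr_pXn2r _ (w i)) ?nnegrE ?powR_ge0 ?(ltW t0) //.
by rewrite rootK.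
Qed.

Lemma dil_le1 q t : 0 < t -> (`|dil t^-1 q| <= 1) = (gauge q <= t).
Proof.
move=> t0; rewrite norm_rV_le // gauge_le ?(ltW t0) //; apply: eq_forallb => i.
rewrite mxE normrM ger0_norm ?exprn_ge0 ?invr_ge0 ?(ltW t0) //.
by rewrite exprVn mulrC ler_pdivrMr ?exprn_gt0 // mul1r.
Qed.

Lemma dil_lt1 q t : 0 < t -> (gauge q < t) -> (`|dil t^-1 q| < 1).
Proof.
move=> t0; rewrite gauge_lt // => /forallP H.
have [i ->] := norm_rV_attained (dil t^-1 q).
rewrite mxE normrM ger0_norm ?exprn_ge0 ?invr_ge0 ?(ltW t0) //.
by rewrite exprVn mulrC ltr_pdivrMr ?exprn_gt0 // mul1r.
Qed.

Lemma gauge_gt0 q : q != 0 -> 0 < gauge q.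
Proof.
apply: contra_neqT; rewrite -leNgt gauge_le // => /forallP H; apply/rowP => i.
by have := H i; rewrite mxE expr0n gtn_eqF //= normr_le0 => /eqP.
Qed.

Lemma norm_dil_gauge q : q != 0 -> `|dil (gauge q)^-1 q| = 1.
Proof.
move=> /gauge_gt0 g0; apply/eqP; rewrite eq_le dil_le1 // lexx /= leNgt.
apply/negP => lt1.
have : gauge q < gauge q; last by rewrite ltxx.
rewrite [X in X < _]/gauge; apply/bigmax_ltP; split=> // i _.
rewrite -(@ltr_pXn2r _ (w i)) ?nnegrE ?powR_ge0 ?(ltW g0) // rootK //.
have := le_lt_trans (coord_le_norm _ i) lt1.
rewrite mxE normrM ger0_norm ?exprn_ge0 ?invr_ge0 ?(ltW g0) //.
by rewrite exprVn mulrC ltr_pdivrMr ?exprn_gt0 // mul1r.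
Qed.

Lemma gauge_dil t u : 0 < t -> `|u| = 1 -> gauge (dil t u) = t.
Proof.
move=> t0 u1; apply/eqP; rewrite eq_le -dil_le1 // dilM mulVf ?gt_eqF // dil1 u1 lexx.
rewrite leNgt; apply/negP => /(dil_lt1 t0).
by rewrite dilM mulVf ?gt_eqF // dil1 u1 ltxx.
Qed.

Lemma cvg_gauge (T : Type) (F : set_system T) (f : T -> V) q : Filter F -> q != 0 ->
  f x @[x --> F] --> q -> gauge (f x) @[x --> F] --> gauge q.
Proof.
move=> FF q0 fq; have g0 := gauge_gt0 q0.
have cq i : `|f x ord0 i| @[x --> F] --> `|q ord0 i|.
  by apply: cvg_norm; exact: cvg_coord.
apply/cvgrPdist_lt => e e0.
have up : \forall x \near F, gauge (f x) < gauge q + e.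
  have ge0 : 0 < gauge q + e by rewrite addr_gt0.
  have : gauge q < gauge q + e by rewrite ltrDl.
  rewrite gauge_lt // => /forallP H.
  have : \forall x \near F, forall i, `|f x ord0 i| < (gauge q + e) ^+ w i.
    by apply: filter_forall => i; apply: (cvgr_lt _ (cq i)); exact: H.
  by apply: filterS => x Hx; rewrite gauge_lt //; apply/forallP.
have dn : \forall x \near F, gauge q - e < gauge (f x).
  have [ge|ge] := ltP (gauge q) e.
    near=> x; apply: lt_le_trans (gauge_ge0 _).
    by rewrite subr_lt0.
  have : ~~ (gauge q <= gauge q - e) by rewrite -ltNge ltrBlDr ltrDl.
  rewrite gauge_le ?subr_ge0 // => /forallPn[i]; rewrite -ltNge => qi.
  apply: filterS (cvgr_gt _ (cq i) _ qi) => x xi.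
  rewrite ltNge gauge_le ?subr_ge0 //; apply/forallPn; exists i.
  by rewrite -ltNge.
near=> x; rewrite ltr_distlC; apply/andP; split; near: x => //.
Unshelve. all: by end_near.
Qed.

Lemma cvg_dil (T : Type) (F : set_system T) (s : T -> R) (f : T -> V) t q : Filter F ->
  s x @[x --> F] --> t -> f x @[x --> F] --> q -> dil (s x) (f x) @[x --> F] --> dil t q.
Proof.
move=> FF st fq; apply: cvg_rV => i; under eq_fun do rewrite mxE.
rewrite mxE; apply: cvgM.
  by apply: (@cvg_comp _ _ _ s (fun y => y ^+ w i)) st _; exact: exprn_continuous.
by apply: (@cvg_comp _ _ _ f (fun y : V => y ord0 i)) fq _; exact: coord_continuous.
Qed.

Variable D : V -> R.
Hypothesis D_dil : forall t q, 0 < t -> D (dil t q) = t * D q.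
Hypothesis D_ge1 : forall u, `|u| = 1 -> 1 <= D u.
Hypothesis D_cont : forall u (e : R), `|u| = 1 -> 0 < e -> exists2 d, 0 < d &
  forall u', `|u'| = 1 -> `|u - u'| < d -> `|D u - D u'| < e.

Let D0 : D 0 = 0.
Proof.
have : D (dil 2 0) = 2 * D 0 by rewrite D_dil.
rewrite (_ : dil 2 0 = 0); last by apply/rowP => i; rewrite !mxE mulr0.
by move=> h; lra.
Qed.

Definition radial (r : R) u : V := dil (r / D u) u.

Lemma norm_normalize v : v != 0 -> `| `|v|^-1 *: v | = 1.
Proof. by move=> v0; rewrite normrZ normfV normr_id mulVf // normr_eq0. Qed.

Lemma cvg_normalize (T : Type) (F : set_system T) (f : T -> V) v : Filter F -> v != 0 ->
  f x @[x --> F] --> v -> `|f x|^-1 *: f x @[x --> F] --> `|v|^-1 *: v.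
Proof.
move=> FF v0 fv; apply: cvgZ => //.
by apply: cvgV; [rewrite normr_eq0|apply: cvg_norm].
Qed.

Lemma cvg_radial (T : Type) (F : set_system T) (f : T -> V) r u : Filter F ->
  `|u| = 1 -> (\forall x \near F, `|f x| = 1) ->
  f x @[x --> F] --> u -> radial r (f x) @[x --> F] --> radial r u.
Proof.
move=> FF u1 f1 fu; apply: cvg_dil => //.
apply: cvgM; first exact: cvg_cst.
apply: cvgV; first by rewrite gt_eqF // (lt_le_trans _ (D_ge1 u1)).
apply/cvgrPdist_lt => e e_gt0; have [d d0 H] := D_cont u1 e_gt0.
near=> x; apply: H; first by near: x.
by near: x; move/cvgrPdist_lt : fu; exact.
Unshelve. all: by end_near.
Qed.

(** The map [f] to the Euclidean sphere goes through the cube boundary by means of the gauge alone.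
    Only its inverse [g] involves [D], and only on the cube boundary, which is why continuity and a
    lower bound of [D] are assumed just there. *)
Lemma homogeneous_sphere_homeo (r : R) : 0 < r ->
  homeomorphic [set q | D q = r] (@eucl_unit_sphere R n.+1).
Proof.
move=> r0.
pose nz v : V := `|v|^-1 *: v.
pose f q : V := let u := dil (gauge q)^-1 q in (enorm u)^-1 *: u.
pose g v : V := radial r (nz v).
have S0 q : D q = r -> q != 0.
  by apply: contra_eqN => /eqP ->; rewrite D0 lt_eqF.
have B0 v : eucl_unit_sphere v -> v != 0.
  rewrite /eucl_unit_sphere /= => v1; apply/eqP => v0; move: v1; rewrite v0.
  under eq_bigr do rewrite mxE expr0n.
  by rewrite big1 //= => /eqP; rewrite eq_sym oner_eq0.
have Be v : eucl_unit_sphere v <-> enorm v = 1.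
  rewrite /eucl_unit_sphere /= -enorm_sqr; split=> [/eqP|->]; last by rewrite expr1n.
  by rewrite sqrf_eq1 => /orP[/eqP->//|/eqP v1]; have := enorm_ge0 v; lra.
have e0 u : u != 0 -> 0 < enorm u.
  by move=> u0; rewrite lt_neqAle enorm_ge0 andbT eq_sym; apply: contra_neq u0 => /enorm_eq0.
have u0 u : `|u| = 1 -> u != 0 by move=> u1; rewrite -normr_eq0 u1 oner_eq0.
have nz_pos (c : R) u : 0 < c -> `|u| = 1 -> nz (c *: u) = u.
  by move=> c0 u1; rewrite /nz normrZ u1 mulr1 gtr0_norm // scalerA mulVf ?gt_eqF // scale1r.
exists f, g; split.
- split=> [q /S0 q0|v /B0 v0].
    apply/Be; rewrite /f enormZ ger0_norm ?invr_ge0 ?enorm_ge0 //.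
    by rewrite mulVf // gt_eqF // e0 // u0 // norm_dil_gauge.
  have := D_ge1 (norm_normalize v0); rewrite -/(nz v) => D1.
  have Dgt : 0 < D (nz v) by exact: lt_le_trans D1.
  by rewrite /g /radial /= D_dil ?divr_gt0 // divfK // gt_eqF.
- move=> q Dq; have q0 := S0 q Dq; have u1 := norm_dil_gauge q0.
  rewrite /g /f nz_pos // ?invr_gt0 ?e0 ?u0 //.
  rewrite /radial D_dil ?invr_gt0 ?gauge_gt0 // Dq dilM.
  rewrite (_ : _ / _ / _ = 1) ?dil1 //.
  by have := gauge_gt0 q0 => g0; field; rewrite !gt_eqF.
- move=> v v1; have v0 := B0 v v1; have u1 := norm_normalize v0.
  have Dgt : 0 < D (nz v) by exact: lt_le_trans (D_ge1 u1).
  have t0 : 0 < r / D (nz v) by rewrite divr_gt0.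
  rewrite /f /g /radial gauge_dil // dilM mulVf ?gt_eqF // dil1.
  rewrite /nz enormZ (Be v).1 // mulr1 ger0_norm ?invr_ge0 // invrK scalerA.
  by rewrite divff ?normr_eq0 // scale1r.
- apply: continuous_in_subspaceT => q /set_mem /S0 q0.
  have FF := nbhs_filter q.
  have cu : dil (gauge x)^-1 x @[x --> nbhs q] --> dil (gauge q)^-1 q.
    apply: cvg_dil => //; apply: cvgV; first by rewrite gt_eqF // gauge_gt0.
    exact: cvg_gauge.
  have ce := cvg_enorm FF cu.
  have : f x @[x --> nbhs q] --> f q; last by [].
  apply: cvgZ => //; apply: cvgV => //.
  by rewrite gt_eqF // e0 // u0 // norm_dil_gauge.
- apply: continuous_in_subspaceT => v /set_mem /B0 v0.
  have FF := nbhs_filter v.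
  have idv : (x : V) @[x --> nbhs v] --> v by exact: cvg_id.
  have : g x @[x --> nbhs v] --> g v; last by [].
  apply: cvg_radial; first exact: norm_normalize.
    have v0' : 0 < `|v| by rewrite normr_gt0.
    apply: filterS (cvgr_gt _ (cvg_norm idv) _ v0') => x.
    by rewrite normr_gt0; exact: norm_normalize.
  exact: cvg_normalize.
Qed.


(** * Lipschitz parametrizations of the sphere *)

Definition face (i : 'I_n.+1) (b : bool) (v : 'rV[R]_n) : V :=
  \row_j if unlift i j is Some k then v ord0 k else (-1) ^+ b.

(** A 1-Lipschitz retraction onto a box: it extends a parametrization of a piece of a face to all of
    the parameter space, as [rectifiable] requires. Rational corners keep the boxes countable. *)
Definition clip (lo hi : 'rV[rat]_n) (x : 'rV[R]_n) : 'rV[R]_n :=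
  \row_k Num.max (ratr (lo ord0 k)) (Num.min (ratr (hi ord0 k)) (x ord0 k)).

Definition box (lo hi : 'rV[rat]_n) : set 'rV[R]_n :=
  [set v | forall k, ratr (lo ord0 k) <= v ord0 k <= ratr (hi ord0 k)].

Definition slip (f : 'rV[R]_n -> R) :=
  exists L, 0 <= L /\ forall x y, `|f x - f y| <= L * enorm (x - y).
(** Bounds are carried along because a product of Lipschitz functions is Lipschitz only when the
    factors are bounded. *)
Definition blip f := slip f /\ exists M, forall x, `|f x| <= M.

Lemma blip_cst c : blip (fun=> c).
Proof.
split; last by exists `|c|.
by exists 0; split=> // x y; rewrite subrr normr0 mul0r.
Qed.

Lemma blipM f g : blip f -> blip g -> blip (fun x => f x * g x).
Proof.
move=> [[L [L0 fL]] [M fM]] [[L' [L'0 gL]] [M' gM]].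
have M0 : 0 <= M := le_trans (normr_ge0 _) (fM 0).
have M'0 : 0 <= M' := le_trans (normr_ge0 _) (gM 0).
split; last by exists (M * M') => x; rewrite normrM ler_pM.
exists (M * L' + L * M'); split; first by rewrite addr_ge0 // mulr_ge0.
move=> x y.
have -> : f x * g x - f y * g y = f x * (g x - g y) + (f x - f y) * g y by ring.
apply: le_trans (ler_normD _ _) _; rewrite !normrM mulrDl lerD //.
  by rewrite -mulrA ler_pM.
by rewrite mulrAC ler_pM.
Qed.

Lemma blipX f k : blip f -> blip (fun x => f x ^+ k).
Proof.
move=> fb; elim: k => [|k IH].
  by under eq_fun do rewrite expr0; exact: blip_cst.
by under eq_fun do rewrite exprS; exact: blipM.
Qed.

Lemma blip_inv f : slip f -> (forall x, 1 <= f x) -> blip (fun x => (f x)^-1).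
Proof.
move=> [L [L0 fL]] f1.
have fp x : 0 < f x by exact: lt_le_trans (f1 x).
split.
  exists L; split=> // x y.
  have -> : (f x)^-1 - (f y)^-1 = (f y - f x) * ((f x)^-1 * (f y)^-1).
    by field; rewrite !gt_eqF.
  rewrite normrM distrC -[leRHS]mulr1 ler_pM // normrM -[leRHS]mulr1.
  by rewrite ler_pM // ger0_norm ?invr_ge0 ?(ltW (fp _)) // invf_le1.
by exists 1 => x; rewrite ger0_norm ?invr_ge0 ?(ltW (fp _)) // invf_le1.
Qed.

Lemma clip_box lo hi x : (exists v : 'rV[R]_n, box lo hi v) -> box lo hi (clip lo hi x).
Proof.
move=> [v bv] k; have /andP[h1 h2] := bv k; have lh := le_trans h1 h2.
by rewrite mxE le_max lexx /= ge_max lh ge_min lexx.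
Qed.

Lemma clip_id lo hi (v : 'rV[R]_n) : box lo hi v -> clip lo hi v = v.
Proof.
move=> bv; apply/rowP => k; have /andP[h1 h2] := bv k.
by rewrite mxE min_r // max_r.
Qed.

Lemma clip_coord_lip lo hi x y k :
  `|clip lo hi x ord0 k - clip lo hi y ord0 k| <= `|x ord0 k - y ord0 k|.
Proof.
by rewrite !mxE; exact: clamp_lip.
Qed.

Lemma clip_lip lo hi x y : `|clip lo hi x - clip lo hi y| <= enorm (x - y).
Proof.
rewrite norm_rV_le ?enorm_ge0 //; apply/forallP => k; rewrite !mxE.
have := clip_coord_lip lo hi x y k; rewrite !mxE => /le_trans; apply.
by have := coord_le_enorm (x - y) k; rewrite !mxE.
Qed.

Lemma elipschitz_coord (f : 'rV[R]_n -> V) :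
  (forall i, slip (fun x => f x ord0 i)) -> elipschitz f.
Proof.
move=> /choice[L HL]; exists (\sum_i L i) => x y.
apply: le_trans (enorm_le_sum _) _; rewrite mulr_suml; apply: ler_sum => i _.
by rewrite !mxE; apply: (HL i).2.
Qed.

Lemma norm_face i b (v : 'rV[R]_n) : (forall k, `|v ord0 k| <= 1) -> `|face i b v| = 1.
Proof.
move=> v1; apply/eqP; rewrite eq_le; apply/andP; split.
  rewrite norm_rV_le //; apply/forallP => j; rewrite mxE.
  by case: unlift => [k|]; [exact: v1|rewrite normrX normrN1 expr1n].
by apply: le_trans (coord_le_norm _ i); rewrite mxE unlift_none normrX normrN1 expr1n.
Qed.

Hypothesis D_lip : forall i b (v : 'rV[R]_n), (forall k, `|v ord0 k| <= 1) ->
  exists lo hi, [/\ box lo hi v, (forall v' : 'rV[R]_n, box lo hi v' -> forall k, `|v' ord0 k| <= 1) &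
    exists L : R, forall v1 v2 : 'rV[R]_n, box lo hi v1 -> box lo hi v2 ->
      `|D (face i b v1) - D (face i b v2)| <= L * `|v1 - v2| ].

Lemma slip_face_clip i b lo hi j : (exists v : 'rV[R]_n, box lo hi v) ->
  (forall v' : 'rV[R]_n, box lo hi v' -> forall k, `|v' ord0 k| <= 1) ->
  blip (fun x => face i b (clip lo hi x) ord0 j).
Proof.
move=> bv b1; rewrite /face; under eq_fun do rewrite mxE.
case: unlift => [k|]; last exact: blip_cst.
split; last by exists 1 => x; apply: b1; exact: clip_box.
exists 1; split=> // x y; rewrite mul1r; apply: le_trans (clip_coord_lip _ _ _ _ _) _.
by have := coord_le_enorm (x - y) k; rewrite !mxE.
Qed.

Lemma homogeneous_sphere_rectifiable (r : R) : (0 < n)%N -> 0 < r ->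
  rectifiable n [set q | D q = r].
Proof.
move=> n0 r0.
pose idx := (('I_n.+1 * bool) * ('rV[rat]_n * 'rV[rat]_n))%type.
pose F (z : idx) x := radial r (face z.1.1 z.1.2 (clip z.2.1 z.2.2 x)).
(* The enumeration runs over all faces and rational boxes; an index whose map is not Lipschitz
   receives a constant map. The good indices already cover the whole sphere, so the set left over is
   empty. *)
pose f k : 'rV[R]_n -> V := if unpickle k is Some z then
   if `[< elipschitz (F z) >] then F z else fun=> 0 else fun=> 0.
have lip0 : elipschitz (fun _ : 'rV[R]_n => 0 : V).
  by exists 0 => x y; rewrite subrr enorm0 mul0r.
exists f; split.
  move=> k; rewrite /f; case: (unpickle k : option idx) => [z|//].
  by case: asboolP.
suff -> : [set q | D q = r] `\` \bigcup_i range (f i) = set0.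
  exact: hausdorff_set0.
apply/seteqP; split=> // q [/= Dq]; apply.
have q0 : q != 0 by apply: contra_eqN Dq => /eqP ->; rewrite D0 lt_eqF.
have u1 := norm_dil_gauge q0; set u := dil (gauge q)^-1 q in u1.
have [i ui] := norm_rV_attained u.
pose b := u ord0 i < 0.
pose v : 'rV[R]_n := \row_k u ord0 (lift i k).
have v1 k : `|v ord0 k| <= 1 by rewrite mxE -u1; exact: coord_le_norm.
have uE : u = face i b v.
  apply/rowP => j; rewrite [RHS]mxE; case: (unliftP i j) => [k ->|->]; first by rewrite [RHS]mxE.
  move: ui; rewrite u1 /b; case: (ltP (u ord0 i) 0) => [lt|ge].
    by rewrite ltr0_norm // expr1 => ->; rewrite opprK.
  by rewrite ger0_norm.
have [lo [hi [bv b1 [L HL]]]] := D_lip i b v1.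
have bb x : box lo hi (clip lo hi x) by apply: clip_box; exists v.
have lipF : elipschitz (F ((i, b), (lo, hi))).
  apply: elipschitz_coord => j.
  have [//] : blip (fun x => F ((i, b), (lo, hi)) x ord0 j).
  rewrite /F /radial /dil /=; under eq_fun do rewrite mxE.
  apply: blipM; last by apply: slip_face_clip => //; exists v.
  apply: blipX; apply: blipM; first exact: blip_cst.
  apply: blip_inv; last by move=> x; apply/D_ge1/norm_face/b1/bb.
  exists `|L|; split=> // x y; apply: le_trans (HL _ _ (bb x) (bb y)) _.
  apply: (le_trans (ler_wpM2r _ (ler_norm L))) => //.
  by apply: ler_wpM2l => //; exact: clip_lip.
exists (pickle (((i, b), (lo, hi)) : idx)) => //; exists v => //.
rewrite /f pickleK; case: asboolP => // _; rewrite /F /= clip_id // -uE.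
rewrite /radial /u D_dil ?invr_gt0 ?gauge_gt0 // Dq dilM.
rewrite (_ : _ / _ / _ = 1) ?dil1 //.
by have := gauge_gt0 q0 => g0; field; rewrite !gt_eqF.
Qed.

End Homogeneous.

(** * Absolutely continuous functions and calibrations *)

Section AbsolutelyContinuous.
Variable R : realType.
Implicit Types (T t s : R) (f g h : R -> R).

Definition ordered_in T N (a b : nat -> R) := forall k, (k < N)%N ->
  0 <= a k /\ a k <= b k /\ b k <= T /\ ((k.+1 < N)%N -> b k <= a k.+1).

Definition ac T h := forall eps : R, 0 < eps -> exists2 delta : R, 0 < delta &
  forall N a b, ordered_in T N a b -> \sum_(k < N) (b k - a k) < delta ->
    \sum_(k < N) `|h (b k) - h (a k)| < eps.

Lemma ac_coord n T (g : R -> 'rV[R]_n) i : abs_cont_on T g -> ac T (fun t => g t ord0 i).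
Proof.
move=> acg e e0; have [d d0 H] := acg e e0; exists d => // N a b ab lt.
apply: le_lt_trans (H N a b ab lt); apply: ler_sum => k _.
by have := coord_le_enorm (g (b k) - g (a k)) i; rewrite !mxE.
Qed.

Lemma ac_dom2 T h1 h2 f (L : R) : 0 <= L -> ac T h1 -> ac T h2 ->
  (forall s t, 0 <= s <= T -> 0 <= t <= T ->
     `|f s - f t| <= L * (`|h1 s - h1 t| + `|h2 s - h2 t|)) -> ac T f.
Proof.
move=> L0 ac1 ac2 fL e e0; pose M := L + 1.
have M0 : 0 < M by rewrite ltr_wpDl.
have e'0 : 0 < e / (2 * M) by rewrite divr_gt0 // mulr_gt0.
have [d1 d10 H1] := ac1 _ e'0; have [d2 d20 H2] := ac2 _ e'0.
exists (Num.min d1 d2) => [|N a b ab]; first by rewrite lt_min d10.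
rewrite lt_min => /andP[/(H1 _ _ _ ab) A1 /(H2 _ _ _ ab) A2].
have : L * (\sum_(k < N) `|h1 (b k) - h1 (a k)| + \sum_(k < N) `|h2 (b k) - h2 (a k)|) < e.
  set S := _ + _.
  have S0 : 0 <= S by rewrite addr_ge0 // sumr_ge0.
  have SE : S < e / M.
    apply: lt_le_trans (ltrD A1 A2) _.
    by rewrite [leLHS](_ : _ = e / M) //; field; rewrite gt_eqF.
  apply: (@le_lt_trans _ _ (M * S)); first by rewrite ler_wpM2r // lerDl.
  by rewrite mulrC -ltr_pdivlMr.
apply: le_lt_trans; rewrite -big_split /= mulr_sumr; apply: ler_sum => k _.
have [a0 [lab [bT _]]] := ab k (ltn_ord k).
by apply: fL; rewrite ?a0 ?bT ?(le_trans a0 lab) ?(le_trans lab bT).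
Qed.

Lemma ac_dom T h f (L : R) : 0 <= L -> ac T h ->
  (forall s t, 0 <= s <= T -> 0 <= t <= T -> `|f s - f t| <= L * `|h s - h t|) -> ac T f.
Proof.
move=> L0 ach fL; apply: (ac_dom2 L0 ach ach) => s t sT tT.
by apply: (le_trans (fL s t sT tT)); rewrite ler_wpM2l // lerDl.
Qed.

Lemma acD T f g : ac T f -> ac T g -> ac T (fun t => f t + g t).
Proof.
move=> acf acg; apply: (ac_dom2 ler01 acf acg) => s t _ _; rewrite mul1r.
by rewrite opprD addrACA ler_normD.
Qed.

Lemma acZ T c f : ac T f -> ac T (fun t => c * f t).
Proof.
move=> acf; apply: (ac_dom (normr_ge0 c) acf) => s t _ _.
by rewrite -mulrBr normrM.
Qed.

Lemma acN T f : ac T f -> ac T (fun t => - f t).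
Proof.
by move=> acf; apply: (ac_dom ler01 acf) => s t _ _; rewrite mul1r -opprD normrN.
Qed.

(** A nondecreasing 1-Lipschitz [p] sends ordered intervals to ordered intervals of no larger total
    length. The applications are the truncations [min t t1] and [max t t1] in [glue]. *)
Lemma ac_repar T f (p : R -> R) : ac T f -> (forall s t, s <= t -> p s <= p t <= p s + (t - s)) ->
  (forall t, 0 <= t <= T -> 0 <= p t <= T) -> ac T (fun t => f (p t)).
Proof.
move=> acf pm pT e e0; have [d d0 H] := acf e e0; exists d => // N a b ab lt.
apply: (H N (p \o a) (p \o b)) => [k kN|].
  have [a0 [lab [bT abk]]] := ab k kN => /=.
  have /andP[-> _] : 0 <= p (a k) <= T by apply: pT; rewrite a0 (le_trans lab).
  have /andP[_ ->] : 0 <= p (b k) <= T by apply: pT; rewrite bT (le_trans a0).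
  have /andP[-> _] := pm _ _ lab; do 3!split=> //.
  by move=> /abk /pm /andP[].
apply: le_lt_trans lt; apply: ler_sum => k _ /=.
have [a0 [lab [bT abk]]] := ab k (ltn_ord k).
by have /andP[_] := pm _ _ lab; lra.
Qed.

Lemma ac_continuous T f : ac T f -> {within `[0, T], continuous f}.
Proof.
move=> acf; apply/subspace_continuousP => t; rewrite /= in_itv /= => /andP[t0 tT].
apply/cvgrPdist_lt => e e0; have [d d0 H] := acf e e0.
have : \forall s \near t, `|t - s| < d.
  by apply/nbhs_ballP; exists d.
rewrite near_withinE; apply: filterS => s; rewrite /= in_itv /= => sd /andP[s0 sT].
have K (u v : R) : 0 <= u -> u <= v -> v <= T -> v - u < d -> `|f v - f u| < e.
  move=> u0 uv vT vu; have := H 1%N (fun=> u) (fun=> v); rewrite !big_ord_recl !big_ord0 !addr0.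
  by apply => // k; rewrite ltnS leqn0 => /eqP ->.
have [st|/ltW ts] := leP s t; first by apply: K => //; rewrite ger0_norm ?subr_ge0 in sd.
by rewrite distrC; apply: K => //; rewrite distrC ger0_norm ?subr_ge0 in sd.
Qed.

Lemma ac_max T f : 0 <= T -> ac T f ->
  exists2 c, 0 <= c <= T & forall t, 0 <= t <= T -> f t <= f c.
Proof.
move=> T0 /ac_continuous cf; have [c + H] := EVT_max T0 cf.
by rewrite in_itv => cT; exists c => // t tT; apply: H; rewrite in_itv.
Qed.

Lemma ac_bounded T f : 0 <= T -> ac T f -> exists2 M, 0 <= M & forall t, 0 <= t <= T -> `|f t| <= M.
Proof.
move=> T0 acf; have [c _ Hc] := ac_max T0 acf; have [d _ Hd] := ac_max T0 (acN acf).
exists (`|f c| + `|f d|) => [|t tT]; first by rewrite addr_ge0.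
have := Hc t tT; have := Hd t tT; have := ler_norm (f c); have := ler_norm (- f d).
rewrite normrN ler_norml; have := normr_ge0 (f c); have := normr_ge0 (f d).
by move=> *; apply/andP; split; lra.
Qed.

Lemma acM T f g : 0 <= T -> ac T f -> ac T g -> ac T (fun t => f t * g t).
Proof.
move=> T0 acf acg; have [M M0 HM] := ac_bounded T0 acf; have [K K0 HK] := ac_bounded T0 acg.
apply: (ac_dom2 (addr_ge0 M0 K0) acf acg) => s t sT tT.
have -> : f s * g s - f t * g t = f s * (g s - g t) + (f s - f t) * g t by ring.
apply: le_trans (ler_normD _ _) _; rewrite !normrM.
have := HM s sT; have := HK t tT; have := normr_ge0 (f s - f t); have := normr_ge0 (g s - g t).
move: `|f s - f t| `|g s - g t| `|g t| `|f s| => x y u v; nra.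
Qed.

End AbsolutelyContinuous.

(** * Growth of absolutely continuous functions from almost everywhere derivatives *)

Section Monotonicity.
Variable R : realType.
Implicit Types (T t s : R) (f g h : R -> R).
Local Notation mu := (@lebesgue_measure R).

Definition slope_le0 k t := forall e : R, 0 < e -> exists2 d : R, 0 < d &
  forall s, `|s - t| < d -> (t <= s -> k s - k t <= e * (s - t)) /\
                            (s <= t -> k t - k s <= e * (t - s)).

(** A continuation argument along [[0, T]]. The null set [Z] is covered by an open [U] so small that
    absolute continuity bounds by [e] the variation of [h] over disjoint intervals of that total
    length; away from [Z] the slope condition allows growth [e] per unit of time. Inside [U] the
    monotonicity of [F] ensures that [h - F] gains no more than [h] does. *)
Lemma ac_slope_le0 T h (F : R -> R) (Z : set R) : 0 <= T -> ac T h ->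
  (forall s t, 0 <= s -> s <= t -> t <= T -> F s <= F t) ->
  measurable Z -> mu Z = 0%E ->
  (forall t, 0 <= t <= T -> ~ Z t -> slope_le0 (fun t => h t - F t) t) ->
  h T - h 0 <= F T - F 0.
Proof.
move=> T0 ach ndF mZ Z0 sl; apply/ler_addgt0Pr => e0 e0_gt0.
pose e := e0 / (T + 1).
have e_gt0 : 0 < e by rewrite divr_gt0 // ltr_wpDl.
have [d d_gt0 Hd] := ach e e_gt0.
have [U [oU ZU mUZ]] : exists U : set R, [/\ open U, Z `<=` U & (mu (U `\` Z) < d%:E)%E].
  apply: lebesgue_regularity_outer => //.
  exact: (eq_ind_r (fun x => (x < +oo)%E) (ltry 0%R) Z0).
have mU : measurable U by exact: open_measurable.
have muU : (mu U < d%:E)%E.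
  apply: le_lt_trans mUZ; rewrite -[leRHS]addr0 -[X in (_ <= _ + X)%E]Z0.
  rewrite -measureU //; last 2 first.
  - exact: measurableD.
  - by apply/seteqP; split=> // x [[_ nZ] /nZ].
  by rewrite setUC setDUK.
pose k t := h t - F t.
(* [S s] charges the growth of [k] up to time [s] partly to [e * s] and partly to finitely many
   intervals whose total length fits into [U] before [s]. *)
pose S s := exists N (a b : nat -> R), [/\ ordered_in s N a b,
  ((\sum_(i < N) (b i - a i))%:E <= mu (U `&` `[0%R, s[%classic))%E &
  k s - k 0 <= e * s + \sum_(i < N) `|h (b i) - h (a i)|].
have ordW N a b s s' : s <= s' -> ordered_in s N a b -> ordered_in s' N a b.
  move=> ss' H i iN; have [a0 [lab [bT abk]]] := H i iN.
  by do 3!split=> //; exact: le_trans ss'.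
have mUI s : measurable (U `&` `[0, s[%classic) by exact: measurableI.
have stepP s s' : S s -> s <= s' -> k s' - k s <= e * (s' - s) -> S s'.
  move=> [N [a [b [ab lenab ks]]]] ss' kss'; exists N, a, b; split.
  - exact: ordW ab.
  - apply: le_trans lenab _; apply: le_measure; rewrite ?inE; [exact: mUI|exact: mUI|].
    apply: setIS => x; rewrite /= !in_itv /= => /andP[-> /lt_le_trans]; exact.
  - rewrite mulrBr in kss'; lra.
have stepU s s' : 0 <= s -> S s -> s <= s' -> s' <= T -> `[s, s'[ `<=` U -> S s'.
  move=> s0 [N [a [b [ab lenab ks]]]] ss' s'T sU.
  pose a' i := if i == N then s else a i.
  pose b' i := if i == N then s' else b i.
  have neqN (i : 'I_N) : (i : nat) == N = false by rewrite ltn_eqF.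
  exists N.+1, a', b'; split.
  - move=> i; rewrite ltnS leq_eqVlt /a' /b' => /predU1P[->|iN].
      by rewrite eqxx; split=> //; split=> //; split=> //; rewrite ltnn.
    rewrite (ltn_eqF iN); have [a0 [lab [bT abk]]] := ab i iN.
    split=> //; split=> //; split; first exact: le_trans ss'.
    rewrite ltnS => _; case: eqP => // /eqP iN'; apply: abk.
    by rewrite ltn_neqAle iN'.
  - rewrite big_ord_recr /= /a' /b' eqxx.
    under eq_bigr do rewrite neqN.
    apply: (@le_trans _ _ (mu (U `&` `[0%R, s[%classic) + mu `[s, s'[%classic)%E).
      rewrite EFinD leeD // lebesgue_measure_itv /= lte_fin.
      by case: ltP => // s's; rewrite lee_fin subr_le0.
    have disj : U `&` `[0, s[%classic `&` `[s, s'[%classic = set0.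
      apply/seteqP; split=> // x [[_]] /=; rewrite !in_itv /= => /andP[_ +] /andP[+ _].
      by move=> xs /(lt_le_trans xs); rewrite ltxx.
    rewrite -measureU //; try exact: mUI.
    apply: le_measure; rewrite ?inE; [by apply: measurableU => //; exact: mUI|exact: mUI|].
    move=> x [[Ux]|xs]; rewrite /= !in_itv /=.
      by move=> /andP[-> xs]; split=> //; exact: lt_le_trans ss'.
    split; first exact: sU.
    by move: xs; rewrite /= in_itv /= => /andP[/(le_trans s0) -> ->].
  - rewrite big_ord_recr /= /a' /b' eqxx.
    under eq_bigr do rewrite neqN.
    have : h s' - h s <= `|h s' - h s| by exact: ler_norm.
    have := ndF s s' s0 ss' s'T; have : 0 <= e * (s' - s) by rewrite mulr_ge0 ?subr_ge0 // ltW.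
    rewrite mulrBr; rewrite /k in ks *; lra.
have S0 : S 0.
  exists 0%N, (fun=> 0), (fun=> 0); split=> //; rewrite big_ord0 //.
  by rewrite mulr0 subrr addr0.
pose A := [set s | 0 <= s <= T /\ S s].
have A0 : A 0 by split; rewrite ?lexx.
have hsA : has_sup A by split; [exists 0|exists T => s [/andP[]]].
pose m := sup A.
have m0 : 0 <= m by apply: sup_upper_bound.
have mT : m <= T by apply: ge_sup; [exists 0|move=> s [/andP[]]].
(* The supremum [m] of the good times can be crossed in either case: if [m] lies in [U], a
   neighbourhood in [U] provides one more interval; otherwise [m] is outside [Z] and the slope
   condition holds on both sides of it. *)
have advance : exists2 eta, 0 < eta & forall s s', 0 <= s -> S s -> m - eta < s -> s <= m ->
    m <= s' -> s' < m + eta -> s' <= T -> S s'.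
  have [Um|nUm] := pselect (U m).
    have := open_nbhs_nbhs (conj oU Um) => /nbhs_ballP[eta eta0 Hb].
    exists eta => // s s' s0 Ss ms sm ms' s'm s'T.
    apply: (stepU s) => //; first exact: le_trans ms'.
    move=> x; rewrite /= in_itv /= => /andP[sx xs']; apply: Hb.
    by rewrite /= /ball /= ltr_distlC; apply/andP; split; lra.
  have nZm : ~ Z m by move=> /ZU.
  have [|eta eta0 He] := sl m _ nZm e e_gt0; first by rewrite m0.
  exists eta => // s s' s0 Ss ms sm ms' s'm s'T.
  apply: (stepP m) => //; last first.
    by apply: (He s' _).1 => //; rewrite ltr_distlC; apply/andP; split; lra.
  apply: (stepP s) => //; apply: (He s _).2 => //.
  by rewrite ltr_distlC; apply/andP; split; lra.
have [eta eta0 adv] := advance.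
have [s [/andP[s0 sT] Ss] sm] := sup_adherent eta0 hsA.
have sm' : s <= m by apply: sup_upper_bound => //; split; rewrite ?s0.
have mE : m = T.
  apply/eqP; rewrite eq_le mT /= leNgt; apply/negP => mltT.
  pose s' := Num.min T (m + eta / 2).
  have s'm : m < s' by rewrite lt_min mltT ltrDl divr_gt0.
  have Ss' : S s'.
    apply: (adv s) => //; [exact: ltW| |by rewrite ge_min lexx].
    by rewrite /s' gt_min; apply/orP; right; lra.
  have : s' <= m.
    apply: sup_upper_bound => //; split=> //; apply/andP; split; last by rewrite ge_min lexx.
    exact: le_trans (ltW s'm).
  by rewrite leNgt s'm.
have [N [a [b [ab lenab kT]]]] : S T.
  by apply: (adv s) => //; rewrite -?mE //; lra.
have : \sum_(i < N) `|h (b i) - h (a i)| < e.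
  apply: Hd => //; rewrite -lte_fin; apply: le_lt_trans muU; apply: le_trans lenab _.
  by apply: le_measure; rewrite ?inE; [exact: mUI|exact: mU|exact: subIsetl].
have eE : e * T + e = e0 by rewrite /e; field; rewrite gt_eqF // ltr_wpDl.
rewrite /k in kT; lra.
Qed.


Lemma derive_le0_slope (k : R -> R) t : derivable k t 1 -> derive1 k t <= 0 -> slope_le0 k t.
Proof.
move=> dk k0 e e0.
have : h^-1 *: (k (h *: 1 + t) - k t) @[h --> 0^'] --> derive1 k t.
  by rewrite derive1E; exact: dk.
move=> /cvgrPdist_lt/(_ _ e0) [d /= d0 H]; exists d => // s std.
have K : s != t -> (k s - k t) / (s - t) < e.
  move=> st; have := H (s - t); rewrite /= sub0r normrN => /(_ std).
  rewrite subr_eq0 => /(_ st); rewrite scaler1 subrK ltr_distlC => /andP[_].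
  by rewrite mulrC => h; apply: (lt_le_trans h); rewrite gerDr.
split=> [ts|st].
  have [->|nst] := eqVneq s t; first by rewrite !subrr mulr0.
  have := K nst; rewrite ltr_pdivrMr; first by move/ltW.
  by rewrite subr_gt0 lt_neqAle eq_sym nst.
have [->|nst] := eqVneq s t; first by rewrite !subrr mulr0.
have := K nst; rewrite -[k s - k t]opprB -[s - t]opprB invrN mulrNN ltr_pdivrMr; first by move/ltW.
by rewrite subr_gt0 lt_neqAle nst.
Qed.

(** The integral of a nonnegative function is a supremum over the simple functions below it, hence
    monotone without any measurability. This is what makes the speed of a horizontal curve
    manageable. *)
Lemma le_lower_integral (D : set R) (f N : R -> \bar R) :
  (forall t, D t -> 0 <= f t)%E -> (forall t, D t -> f t <= N t)%E ->
  (\int[mu]_(t in D) f t <= \int[mu]_(t in D) N t)%E.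
Proof.
move=> f0 fN; have N0 t : D t -> (0 <= N t)%E by move=> Dt; exact: le_trans (f0 t Dt) (fN t Dt).
rewrite !ge0_integralE //; apply: ereal_sup_le => _ [h hf <-]; exists h => // x.
apply: le_trans (hf x) _; rewrite /patch; case: ifPn => // /set_mem; exact: fN.
Qed.

Lemma ac_clip_continuous T h : 0 <= T -> ac T h ->
  continuous (fun t => h (Num.max 0 (Num.min T t))).
Proof.
move=> T0 ach t; apply/cvgrPdist_lt => e e0; have [d d0 H] := ach e e0.
have : \forall s \near t, `|t - s| < d by apply/nbhs_ballP; exists d.
apply: filterS => s sd.
have cT u : 0 <= Num.max 0 (Num.min T u) <= T.
  by rewrite le_max lexx /= ge_max T0 ge_min lexx.
have := clamp_lip T 0 t s; move: (cT t) (cT s).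
move: (Num.max 0 (Num.min T t)) (Num.max 0 (Num.min T s)) => u v /andP[u0 uT] /andP[v0 vT] uv.
have {uv} := le_lt_trans uv sd.
have K (a b : R) : 0 <= a -> a <= b -> b <= T -> b - a < d -> `|h b - h a| < e.
  move=> a0 ab bT ba; have := H 1%N (fun=> a) (fun=> b); rewrite !big_ord_recl !big_ord0 !addr0.
  by apply => // k; rewrite ltnS leqn0 => /eqP ->.
have [vu|/ltW uv] := leP v u; first by rewrite ger0_norm ?subr_ge0 //; exact: K.
by rewrite distrC ger0_norm ?subr_ge0 // distrC; exact: K.
Qed.

(** The positive part of the derivative is replaced by a measurable function [f <= N], a limsup of
    difference quotients. By Lebesgue differentiation its primitive [F] has derivative [f] almost
    everywhere, and [ac_slope_le0] compares [h] with [F]. *)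
Theorem ac_le_integral T h (N : R -> \bar R) (l : R) : 0 <= T -> ac T h ->
  (forall t, 0 <= N t)%E ->
  {ae mu, forall t, 0 <= t <= T -> derivable h t 1 /\ ((derive1 h t)%:E <= N t)%E} ->
  (\int[mu]_(t in [set t | (0 <= t <= T)%R]) N t <= l%:E)%E ->
  h T - h 0 <= l.
Proof.
move=> T0 ach N0 [Z [mZ Z0 ZP]] intN.
(* Constant extension of [h] outside [[0, T]], so that the difference quotients are defined and
   continuous on the whole line. *)
pose ht t := h (Num.max 0 (Num.min T t)).
have cht : continuous ht by exact: ac_clip_continuous.
pose dq (n : nat) t : R := n.+1%:R * (ht (t + n.+1%:R^-1) - ht t).
have mdq n : measurable_fun setT (fun t => (dq n t)%:E).
  apply/measurable_EFinP; apply: continuous_measurable_fun => t.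
  apply: cvgM; first exact: cvg_cst.
  apply: cvgB; last exact: cht.
  apply: (@continuous_comp _ _ _ (fun t => t + n.+1%:R^-1) ht); last exact: cht.
  by apply: cvgD; [exact: cvg_id|exact: cvg_cst].
pose E := `]0, T[%classic `\` Z.
have mE : measurable E by apply: measurableD.
(* Cutting off at 0 makes [F] nondecreasing, and the indicator of [E] makes [f] vanish wherever
   [derive1 h] is not controlled by [N]. *)
pose f t : R := fine (maxe (limn_esup (fun n => (dq n t)%:E)) 0) * \1_E t.
have mf : measurable_fun setT f.
  apply: measurable_funM; last exact: measurable_indic.
  apply: measurableT_comp => //; apply: measurable_maxe => //.
  exact: measurable_fun_limn_esup.
have Ed t : E t -> derivable h t 1 /\ ((derive1 h t)%:E <= N t)%E.
  move=> [/=]; rewrite in_itv /= => /andP[t0 tT] nZ.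
  have : ~ ~ (0 <= t <= T -> derivable h t 1 /\ ((derive1 h t)%:E <= N t)%E).
    by move=> /ZP.
  by move=> /contrapT; apply; rewrite !ltW.
have fE t : E t -> f t = Num.max (derive1 h t) 0.
  move=> Et; have [dh _] := Ed t Et.
  have [] := Et; rewrite /= in_itv /= => /andP[t0 tT] nZ.
  rewrite /f indicE mem_set // mulr1.
  suff -> : limn_esup (fun n => (dq n t)%:E) = (derive1 h t)%:E by rewrite -EFin_max.
  suff cv : (dq n t)%:E @[n --> \oo] --> (derive1 h t)%:E.
    by rewrite is_cvg_limn_esupE; [apply/cvg_lim|apply/cvg_ex; eexists; exact: cv].
  apply: cvg_EFin; first by near=> n.
  have : x^-1 *: (h (x *: 1 + t) - h t) @[x --> 0^'] --> derive1 h t.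
    by rewrite derive1E; exact: dh.
  move=> /cvgrPdist_lt cvh; apply/cvgrPdist_lt => e e0.
  have [d /= d0 H] := cvh e e0.
  near=> n.
  have n0 : 0 < n.+1%:R^-1 :> R by rewrite invr_gt0.
  have nd : n.+1%:R^-1 < d by near: n; exact: near_infty_natSinv_lt (PosNum d0).
  have nT : n.+1%:R^-1 < T - t.
    by near: n; have Tt : 0 < T - t by [rewrite subr_gt0]; exact: near_infty_natSinv_lt (PosNum Tt).
  have := H n.+1%:R^-1; rewrite /= sub0r normrN gtr0_norm // => /(_ nd).
  rewrite gt_eqF // => /(_ isT); rewrite invrK scaler1 [n.+1%:R^-1 + t]addrC.
  rewrite /dq /= /ht [Num.min T t]min_r ?(ltW tT) // [Num.max 0 t]max_r ?(ltW t0) //.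
  have -> : Num.max 0 (Num.min T (t + n.+1%:R^-1)) = t + n.+1%:R^-1.
    move: n0 nT; set x := n.+1%:R^-1 => n0 nT.
    by rewrite min_r; [rewrite max_r //|]; lra.
  by [].
have f0 t : 0 <= f t.
  rewrite /f mulr_ge0 // ?indicE //.
  by apply: fine_ge0; rewrite le_max lexx orbT.
have fN t : ((f t)%:E <= N t)%E.
  have [Et|nE] := pselect (E t); last by rewrite /f indicE memNset // mulr0.
  rewrite fE // EFin_max ge_max; apply/andP; split=> //; by case: (Ed t Et).
have mI : measurable [set t : R | 0 <= t <= T].
  have -> : [set t : R | 0 <= t <= T] = `[0, T]%classic.
    by apply/seteqP; split => t; rewrite /= in_itv.
  exact: measurable_itv.
have intf : (\int[mu]_t (f t)%:E <= l%:E)%E.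
  apply: le_trans intN.
  have -> : (\int[mu]_t (f t)%:E = \int[mu]_(t in [set t | (0 <= t <= T)%R]) (f t)%:E)%E.
    rewrite [RHS]integral_mkcond; apply: eq_integral => t _; rewrite patchE.
    case: ifPn => //; rewrite notin_setE /= => nt; rewrite /f indicE memNset ?mulr0 //.
    by move=> [/=]; rewrite in_itv /= => /andP[t0 tT]; case: nt; rewrite !ltW.
  by apply: le_lower_integral => t _; rewrite ?lee_fin.
have If : mu.-integrable setT (EFin \o f).
  apply/integrableP; split; first exact/measurable_EFinP.
  under eq_integral do rewrite /= ger0_norm //.
  exact: le_lt_trans intf (ltry _).
have Ify y : mu.-integrable `]-oo, y] (EFin \o f) by exact: integrableS If.
pose F x := (\int[mu]_(t in `]-oo, x]) f t)%R.
have [Z2 [mZ2 Z20 ZP2]] := FTC1Ny Ify (open_integrable_locally openT If).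
have Z3 : (mu [set 0%R; T] = 0)%E.
  by apply: countable_lebesgue_measure0; exact: finite_set_countable.
have mZ3 : measurable [set 0; T] by exact: measurableU.
have mZZ : measurable (Z `|` Z2) by exact: measurableU.
have Fm s t : s <= t -> F s <= F t.
  move=> st; apply: fine_le.
  - exact: integrable_fin_num.
  - exact: integrable_fin_num.
  apply: ge0_subset_integral => //.
  - by apply/measurable_EFinP; apply: measurable_funTS; exact: mf.
  - by move=> x _; rewrite lee_fin.
  - by move=> x /=; rewrite !in_itv /= => /le_trans; exact.
have FTl : F T - F 0 <= l.
  have : 0 <= F 0 by apply: Rintegral_ge0.
  suff : F T <= l by lra.
  rewrite -lee_fin /F /Rintegral fineK; last exact: integrable_fin_num.
  apply: le_trans intf; apply: ge0_subset_integral => //.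
    exact/measurable_EFinP.
  by move=> x _; rewrite lee_fin.
apply: le_trans FTl.
(* The exceptional times are those where [h] is not controlled, those where [F] does not have
   derivative [f], and the two end points, which [E] omits. *)
apply: (@ac_slope_le0 _ _ _ (Z `|` Z2 `|` [set 0; T])) => //.
- by move=> s t _ + _; exact: Fm.
- exact: measurableU.
- apply/negligibleP; first exact: measurableU.
  by apply: negligibleU; [apply: negligibleU|]; exact/negligibleP.
move=> t /andP[t0 tT] /not_orP[/not_orP[nZ nZ2] nZ3].
have Et : E t.
  split=> //=; rewrite in_itv /= !lt_neqAle t0 tT !andbT.
  by apply/andP; split; apply/eqP => te; apply: nZ3; [left|right].
have [dF F't] : derivable F t 1 /\ derive1 F t = f t.
  by apply: contrapT => h0; apply: nZ2; apply: ZP2.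
have [dh _] := Ed t Et.
apply: derive_le0_slope; first exact: derivableB.
rewrite derive1E deriveB // -!derive1E F't fE //.
by rewrite subr_le0 le_max lexx.
Unshelve. all: by end_near.
Qed.

End Monotonicity.

Section AlmostEverywhere.
Variable R : realType.
Local Notation mu := (@lebesgue_measure R).

Lemma ae_impl (P Q : R -> Prop) : {ae mu, forall t, P t} -> (forall t, P t -> Q t) ->
  {ae mu, forall t, Q t}.
Proof.
by move=> aeP PQ; apply: filterS PQ aeP; exact: (ae_filter_ringOfSetsType mu).
Qed.

Lemma ae_and (P Q : R -> Prop) : {ae mu, forall t, P t} -> {ae mu, forall t, Q t} ->
  {ae mu, forall t, P t /\ Q t}.
Proof.
by move=> aeP aeQ; apply: filterI aeP aeQ; exact: (ae_filter_ringOfSetsType mu).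
Qed.

End AlmostEverywhere.

(** * Calibrations that switch at prescribed times *)

Section Calibration.
Variables (R : realType) (N : R -> \bar R) (T l : R).
Hypothesis T0 : 0 <= T.
Hypothesis N0 : forall t, (0 <= N t)%E.
Local Notation mu := (@lebesgue_measure R).
Hypothesis intN : (\int[mu]_(t in [set t | (0 <= t <= T)%R]) N t <= l%:E)%E.

Definition calib (c a b : R) (h : R -> R) := ac T h /\
  {ae mu, forall t, a <= t <= b -> exists d, is_derive t 1 h d /\ (d%:E <= c%:E * N t)%E}.

Lemma calib1 c h : 0 <= c -> calib c 0 T h -> h T - h 0 <= c * l.
Proof.
(* The constant [c = 0] cannot be normalized to 1. In that case [0 * N t = 0] even where [N t] is
   infinite, so the derivative is at most 0. *)
rewrite le_eqVlt => /predU1P[<-|c0] [ach aeh].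
  rewrite mul0r; apply: (@ac_le_integral _ _ _ (fun=> 0%E)) => //; last by rewrite integral0.
  apply: (ae_impl aeh) => t H tT; have [d [hd dN]] := H tT.
  split; first exact: ex_derive.
  by rewrite derive1E derive_val; move: dN; rewrite mul0e.
suff : c^-1 * h T - c^-1 * h 0 <= l by rewrite -mulrBr mulrC ler_pdivrMr // mulrC.
apply: (@ac_le_integral _ _ (fun t => c^-1 * h t) N) => //; first exact: acZ.
apply: (ae_impl aeh) => t H tT; have [d [hd dN]] := H tT.
have hd' : is_derive t 1 (fun t => c^-1 * h t) (c^-1 * d) by exact: is_deriveZ.
split; first exact: ex_derive.
rewrite derive1E derive_val EFinM.
by rewrite -lee_pdivlMl ?invr_gt0 // invrK.
Qed.

(* Joins two calibrations at [t1] without requiring h1 t1 = h2 t1. *)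
Definition glue (h1 h2 : R -> R) (t1 t : R) : R := h1 (Num.min t t1) + h2 (Num.max t t1).

(** [glue] follows the increments of [h1] before [t1] and those of [h2] after it. It may fail to be
    differentiable at [t1], which is a single point and therefore negligible. *)
Lemma calib_glue c a t1 b h1 h2 : 0 <= t1 <= T -> calib c a t1 h1 -> calib c t1 b h2 ->
  calib c a b (glue h1 h2 t1).
Proof.
move=> /andP[t10 t1T] [ac1 ae1] [ac2 ae2]; split.
  apply: acD.
    apply: (ac_repar ac1) => [s t st|t /andP[t0 tT]].
      by rewrite /Num.min; case: (ltP s t1); case: (ltP t t1) => *; apply/andP; split; lra.
    by rewrite le_min t0 t10 /= ge_min tT.
  apply: (ac_repar ac2) => [s t st|t /andP[t0 tT]].
    by rewrite /Num.max; case: (ltP s t1); case: (ltP t t1) => *; apply/andP; split; lra.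
  by rewrite le_max t0 /= ge_max tT.
have aet1 : {ae mu, forall t, t != t1}.
  exists [set t1]; split; [by []|exact: lebesgue_measure_set1|].
  by move=> t /= /negP; rewrite negbK => /eqP.
apply: (ae_impl (ae_and (ae_and ae1 ae2) aet1)) => t [[H1 H2] tt1] /andP[at_ tb].
have [lt|gt|/eqP] := ltgtP t t1; last by rewrite (negPf tt1).
  have [d [hd dN]] : exists d, is_derive t 1 h1 d /\ (d%:E <= c%:E * N t)%E.
    by apply: H1; rewrite at_ ltW.
  exists d; split => //.
  apply: (@near_eq_is_derive _ _ _ (fun t => h1 t + h2 t1)).
    by near=> s; rewrite /glue min_l ?max_r //; apply: ltW; near: s; exact: lt_nbhsl.
  by rewrite -[d]addr0; apply: is_deriveD.
have [d [hd dN]] : exists d, is_derive t 1 h2 d /\ (d%:E <= c%:E * N t)%E.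
  by apply: H2; rewrite tb ltW.
exists d; split => //.
apply: (@near_eq_is_derive _ _ _ (fun t => h1 t1 + h2 t)).
  by near=> s; rewrite /glue min_r ?max_l //; apply: ltW; near: s; exact: lt_nbhsr.
by rewrite -[d]add0r; apply: is_deriveD.
Unshelve. all: by end_near.
Qed.

Lemma calib2 c t1 h1 h2 : 0 <= c -> 0 <= t1 <= T -> calib c 0 t1 h1 -> calib c t1 T h2 ->
  (h1 t1 - h1 0) + (h2 T - h2 t1) <= c * l.
Proof.
move=> c0 t1T C1 C2; have := calib1 c0 (calib_glue t1T C1 C2); rewrite /glue.
move: t1T => /andP[t10 t1T].
by rewrite (min_r t1T) (max_l t1T) (min_l t10) (max_r t10); lra.
Qed.

Lemma calib3 c t1 t2 h1 h2 h3 : 0 <= c -> 0 <= t1 -> t1 <= t2 -> t2 <= T ->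
  calib c 0 t1 h1 -> calib c t1 t2 h2 -> calib c t2 T h3 ->
  (h1 t1 - h1 0) + (h2 t2 - h2 t1) + (h3 T - h3 t2) <= c * l.
Proof.
move=> c0 t10 t12 t2T C1 C2 C3.
have t1T : 0 <= t1 <= T by rewrite t10 (le_trans t12).
have t2T' : 0 <= t2 <= T by rewrite t2T (le_trans t10).
have := calib2 c0 t2T' (calib_glue t1T C1 C2) C3; rewrite /glue.
by rewrite (min_r t12) (max_l t12) (min_l t10) (max_r t10); lra.
Qed.

End Calibration.

(** * Piecewise constant controls *)

Section VectorDerivative.
Variables (R : realType).

Lemma is_derive1P (V : normedModType R) (g : R -> V) (t : R) (v : V) :
  is_derive t 1 g v <-> h^-1 *: (g (h *: 1 + t) - g t) @[h --> 0^'] --> v.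
Proof.
split=> [[dg <-]|H]; first exact: dg.
split; first by apply/cvg_ex; exists v.
by apply/cvg_lim => //; exact: norm_hausdorff.
Qed.

Lemma is_derive_coordP n (g : R -> 'rV[R]_n) (t : R) (v : 'rV[R]_n) :
  is_derive t 1 g v <-> forall i, is_derive t 1 (fun s => g s ord0 i) (v ord0 i).
Proof.
have E i : (fun h : R => h^-1 *: (g (h *: 1 + t) ord0 i - g t ord0 i)) =
    (fun h => (h^-1 *: (g (h *: 1 + t) - g t)) ord0 i).
  by apply/funext => h; rewrite !mxE.
split=> [/is_derive1P H i|H].
  by apply/is_derive1P; rewrite E; exact: cvg_coord.
apply/is_derive1P; apply: cvg_rV => i.
by rewrite -E; apply/is_derive1P.
Qed.

End VectorDerivative.

Section Pieces.
Import HBNNSimple.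
Variables (R : realType) (n : nat).
Local Notation V := 'rV[R]_n.+1.
Variables (X1 X2 : V -> V) (nk : normkind) (step : V -> R * R -> V).
Implicit Types (q : V) (s : seq (R * R)).

Local Notation mu := (@lebesgue_measure R).

Lemma combine_ge0 a b : 0 <= @combine R nk a b.
Proof. by case: nk => /=; rewrite ?addr_ge0 // le_max normr_ge0. Qed.

Lemma combine_eq0 a b : @combine R nk a b = 0 -> a = 0 /\ b = 0.
Proof.
case: nk => /= H; split; apply/eqP; rewrite -normr_le0 -H.
- by rewrite le_max lexx.
- by rewrite le_max lexx orbT.
- by rewrite lerDl.
- by rewrite lerDr.
Qed.

Lemma combineZ (c a b : R) : 0 <= c -> combine nk (c * a) (c * b) = c * combine nk a b.
Proof.
by case: nk => c0 /=; rewrite !normrM (ger0_norm c0) ?mulrDr // maxr_pMr.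
Qed.

Lemma sf_norm_ge0 q v : (0 <= sf_norm X1 X2 nk q v)%E.
Proof.
by apply: le_ereal_inf_tmp => _ [w _ <-]; rewrite lee_fin combine_ge0.
Qed.

Definition piece_cost s : R := \sum_(p <- s) combine nk p.1 p.2.
Definition piece_end s : V := foldl step 0 s.

Lemma cost_ge0 s : 0 <= piece_cost s.
Proof. by apply: sumr_ge0 => p _; exact: combine_ge0. Qed.

Lemma cost_cat s1 s2 : piece_cost (s1 ++ s2) = piece_cost s1 + piece_cost s2.
Proof. by rewrite /piece_cost big_cat. Qed.

Lemma cost_cons p s : piece_cost (p :: s) = combine nk p.1 p.2 + piece_cost s.
Proof. by rewrite /piece_cost big_cons. Qed.

Hypothesis step0 : forall q, step q (0, 0) = q.
Hypothesis step_flow : forall q (a b t : R),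
  is_derive t 1 (fun t => step q (t * a, t * b))
    (a *: X1 (step q (t * a, t * b)) + b *: X2 (step q (t * a, t * b))).
Hypothesis step_lip : forall q (a b r : R), exists L : R, forall s t : R, 0 <= s <= r -> 0 <= t <= r ->
  enorm (step q (s * a, s * b) - step q (t * a, t * b)) <= L * `|s - t|.

(** Speed at most 1 makes the duration [T] a bound for the length. The Lipschitz constant provides
    absolute continuity, and the finite set [E] contains the corners. *)
Definition polygonal (T : R) q := 0 <= T /\ exists g : R -> V, [/\ g 0 = 0, g T = q,
  exists2 L : R, 0 <= L & forall s t : R, 0 <= s <= T -> 0 <= t <= T ->
    enorm (g s - g t) <= L * `|s - t| &
  exists2 E : set R, finite_set E & forall t, 0 < t < T -> ~ E t ->
    exists w : R * R, is_derive t 1 g (w.1 *: X1 (g t) + w.2 *: X2 (g t)) /\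
      combine nk w.1 w.2 <= 1].

Lemma polygonal0 : polygonal 0 0.
Proof.
split=> //; exists (fun=> 0); split=> //.
  by exists 0 => // s t _ _; rewrite subrr enorm0 mul0r.
exists set0 => // t /andP[t0 /(lt_trans t0)]; by rewrite ltxx.
Qed.

(** The crude factor, the dimension, comes from comparing with the sum of the coordinates; it only
    enlarges a Lipschitz constant. *)
Lemma enorm_triangle m (x y z : 'rV[R]_m) (K : R) : K = m%:R ->
  enorm (x - z) <= K * (enorm (x - y) + enorm (y - z)).
Proof.
move=> ->; apply: le_trans (enorm_le_sum _) _.
have -> : m%:R * (enorm (x - y) + enorm (y - z)) =
    \sum_(i < m) (enorm (x - y) + enorm (y - z)).
  by rewrite sumr_const card_ord mulr_natl.
apply: ler_sum => i _.
have -> : (x - z) ord0 i = (x - y) ord0 i + (y - z) ord0 i by rewrite !mxE; ring.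
by apply: le_trans (ler_normD _ _) _; rewrite lerD ?coord_le_enorm.
Qed.

Lemma polygonal_step T q p : polygonal T q -> polygonal (T + combine nk p.1 p.2) (step q p).
Proof.
case: p => a b [T0 [g [g0 gT [L L0 gL] [E finE gE]]]] /=.
(* A piece of cost 0 has both controls equal to 0 and does not move; it is treated apart because its
   speed cannot be normalized. *)
have [c0|cn0] := eqVneq (combine nk a b) 0.
  have [-> ->] := combine_eq0 c0; rewrite step0.
  have -> : combine nk 0 0 = 0 :> R.
    by case: nk => /=; rewrite normr0 ?addr0 ?maxxx.
  by rewrite addr0; split=> //; exists g; split=> //; [exists L|exists E].
set c := combine nk a b; have c0 : 0 < c by rewrite lt_neqAle eq_sym cn0 combine_ge0.
split; first by rewrite addr_ge0 // ltW.
(* Dividing by the cost gives unit speed, so that the new piece lasts exactly [c]. *)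
pose a' := c^-1 * a; pose b' := c^-1 * b.
pose f t := step q ((t - T) * a', (t - T) * b').
pose G t := if t <= T then g t else f t.
have fT : f T = q by rewrite /f subrr !mul0r step0.
have Gge t : T <= t -> G t = f t.
  rewrite /G le_eqVlt => /predU1P[<-|Tt]; first by rewrite lexx gT fT.
  by rewrite leNgt Tt.
have [L' HL'] := step_lip q a' b' c.
have fL (s t : R) : T <= s <= T + c -> T <= t <= T + c -> enorm (f s - f t) <= `|L'| * `|s - t|.
  move=> /andP[s1 s2] /andP[t1 t2]; rewrite /f.
  have := HL' (s - T) (t - T); rewrite opprB addrA subrK => H.
  apply: le_trans (H _ _) _; [apply/andP; split; lra|apply/andP; split; lra|].
  by rewrite ler_wpM2r // ler_norm.
pose M := n.+1%:R * (L + `|L'|) + L + `|L'|.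
have M0 : 0 <= M by rewrite !addr_ge0 // mulr_ge0 // addr_ge0.
have n1 : 1 <= n.+1%:R :> R by rewrite ler1n.
have LM : L <= M by rewrite /M -addrA addrCA lerDl addr_ge0 // mulr_ge0 // addr_ge0.
have L'M : `|L'| <= M by rewrite /M lerDr addr_ge0 // mulr_ge0 // addr_ge0.
have cross (s t : R) : 0 <= s <= T -> T <= t <= T + c -> enorm (G s - G t) <= M * `|s - t|.
  move=> /andP[s0 sT] /andP[Tt tc].
  have Gs : G s = g s by rewrite /G sT.
  rewrite Gs Gge //; apply: le_trans (enorm_triangle _ (g T) _ erefl) _.
  have h1 : enorm (g s - g T) <= L * (t - s).
    apply: le_trans (gL _ _ _ _) _; rewrite ?s0 ?sT ?T0 ?lexx //.
    by rewrite ler_wpM2l // ler0_norm; lra.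
  have h2 : enorm (g T - f t) <= `|L'| * (t - s).
    rewrite gT -fT; apply: le_trans (fL _ _ _ _) _; rewrite ?lexx ?Tt ?tc ?lerDl ?(ltW c0) //.
    by rewrite ler_wpM2l // ler0_norm; lra.
  rewrite ler0_norm ?opprB; last by lra.
  have ts : 0 <= t - s by lra.
  apply: le_trans (_ : n.+1%:R * ((L + `|L'|) * (t - s)) <= _).
    by rewrite ler_wpM2l // mulrDl lerD.
  by rewrite mulrA ler_wpM2r // /M -addrA lerDl addr_ge0.
exists G; split.
- by rewrite /G T0.
- rewrite Gge; last by rewrite lerDl ltW.
  rewrite /f /a' /b' addrAC subrr add0r !mulrA !mulfV //.
  by rewrite !mul1r.
- exists M => // s t /andP[s0 sT] /andP[t0 tT].
  have [sl|/ltW sg] := leP s T; have [tl|/ltW tg] := leP t T.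
  + rewrite /G sl tl; apply: le_trans (gL _ _ _ _) _; rewrite ?s0 ?t0 //.
    by rewrite ler_wpM2r.
  + by apply: cross; rewrite ?s0 ?tg.
  + rewrite -[enorm _]mul1r -[1](normrN1 R) -enormZ scaleN1r opprB distrC.
    by apply: cross; rewrite ?t0 ?sg.
  + rewrite !Gge //; apply: le_trans (fL _ _ _ _) _; rewrite ?sg ?tg //.
    by rewrite ler_wpM2r.
exists (E `|` [set T]); first by rewrite finite_setU; split.
move=> t /andP[t0 tTc] /not_orP[nE /= /eqP ntT].
have [tT|Tt|/eqP] := ltgtP t T; last by rewrite (negPf ntT).
  have tI : 0 < t < T by rewrite t0.
  have [w [gw wc]] := gE t tI nE.
  exists w; split=> //; rewrite (_ : G t = g t); last by rewrite /G (ltW tT).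
  apply: near_eq_is_derive gw; near=> s; rewrite /G ltW //.
  by near: s; exact: lt_nbhsl.
exists (a', b'); split=> /=; last first.
  by rewrite combineZ ?invr_ge0 ?(ltW c0) // -/c mulVf // gt_eqF.
rewrite Gge ?(ltW Tt) //.
apply: (@near_eq_is_derive _ _ _ f).
  by near=> s; rewrite Gge // ltW //; near: s; exact: lt_nbhsr.
rewrite /f.
have hs := step_flow q a' b' (t - T).
apply/is_derive1P; move/is_derive1P : hs.
by under eq_fun do rewrite addrA.
Unshelve. all: by end_near.
Qed.

Lemma polygonal_endp s : polygonal (piece_cost s) (piece_end s).
Proof.
elim/last_ind: s => [|s p IH]; first by rewrite /piece_cost big_nil; exact: polygonal0.
rewrite /piece_end -cats1 cost_cat foldl_cat /= /piece_cost big_seq1.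
exact: polygonal_step.
Qed.

Lemma polygonal_dist T q : polygonal T q -> (sf_dist X1 X2 nk 0 q <= T%:E)%E.
Proof.
move=> [T0 [g [g0 gT [L L0 gL] [E finE gE]]]].
have mI : measurable [set t : R | 0 <= t <= T].
  have -> : [set t : R | 0 <= t <= T] = `[0, T]%classic.
    by apply/seteqP; split => t; rewrite /= in_itv.
  exact: measurable_itv.
pose E' := E `|` [set 0] `|` [set T].
have finE' : finite_set E' by rewrite !finite_setU; do !split.
have E'0 : (mu E' = 0)%E by apply: countable_lebesgue_measure0; exact: finite_set_countable.
have mE' : measurable E'.
  apply: closed_measurable; move: finE'; apply: accessible_finite_set_closed.1.
  exact/hausdorff_accessible/Rhausdorff.
have good t : 0 <= t <= T -> ~ E' t -> exists w : R * R,
    is_derive t 1 g (w.1 *: X1 (g t) + w.2 *: X2 (g t)) /\ combine nk w.1 w.2 <= 1.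
  move=> /andP[t0 tT] /not_orP[/not_orP[nE /= /eqP nt0] /= /eqP ntT].
  by apply: gE => //; rewrite !lt_neqAle t0 tT eq_sym nt0 ntT.
apply: ge_ereal_inf; exists (sf_length X1 X2 nk T g).
  exists (T, g) => //=; split=> //; split=> //; split.
    move=> e e0; exists (e / (L + 1)) => [|N a b ab lt]; first by rewrite divr_gt0 // ltr_wpDl.
    apply: le_lt_trans (_ : L * \sum_(k < N) (b k - a k) < e).
      rewrite mulr_sumr; apply: ler_sum => k _.
      have [a0 [lab [bT _]]] := ab k (ltn_ord k).
      rewrite -[b k - a k]ger0_norm ?subr_ge0 //.
      by apply: gL; rewrite ?a0 ?bT ?(le_trans a0 lab) ?(le_trans lab bT).
    apply: le_lt_trans (_ : (L + 1) * \sum_(k < N) (b k - a k) < e).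
      rewrite ler_wpM2r ?lerDl // sumr_ge0 // => k _.
      by have [_ [lab _]] := ab k (ltn_ord k); rewrite subr_ge0.
    by rewrite mulrC -ltr_pdivlMr // ltr_wpDl.
  exists E'; split=> // t /= H; apply: contrapT => nE'; apply: H => /=.
  rewrite in_itv /= => tT; have [w [dg _]] := good t tT nE'.
  split; first exact: ex_derive.
  by exists w; rewrite derive1E derive_val.
(* The bound is proved for each simple function below the speed: such a function is at most 1
   outside the finite set [E'], and its integral is therefore at most [T]. *)
rewrite /sf_length ge0_integralE; last by move=> t _; exact: sf_norm_ge0.
apply: ge_ereal_sup => _ [h hf <-].
have IE : [set t : R | 0 <= t <= T] = `[0, T]%classic.
  by apply/seteqP; split => t; rewrite /= in_itv.
have muI : (mu [set t : R | (0 <= t <= T)%R] = T%:E)%E.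
  rewrite IE lebesgue_measure_itv /= lte_fin.
  case: ltP => [_|T0']; first by rewrite -EFinB subr0.
  by congr (_%:E); apply/eqP; rewrite eq_le T0 T0'.
have -> : T%:E = (\int[mu]_(t in [set t | (0 <= t <= T)%R]) (cst 1%E) t)%E.
  by rewrite integral_cst // mul1e; exact: esym muI.
rewrite -integralT_nnsfun [leRHS]integral_mkcond.
apply: ae_ge0_le_integral => //.
- by move=> x _; rewrite lee_fin; exact: fun_ge0.
- by apply/measurable_EFinP; exact: measurable_funPT.
- by move=> x _; rewrite patchE; case: ifP.
- apply/(measurable_restrictT _ mI); exact: measurable_cst.
exists E'; split=> // t /= H; apply: contrapT => nE'; apply: H => _.
apply: le_trans (hf t) _; rewrite !patchE; case: ifPn => // /set_mem /= tT.
have [w [dg wc]] := good t tT nE'.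
apply: ge_ereal_inf; exists (combine nk w.1 w.2)%:E; last by rewrite lee_fin.
by exists w => //=; rewrite derive1E derive_val.
Qed.

End Pieces.

(** * The distance as an infimum over piecewise constant controls *)

Section PolygonalDistance.
Variables (R : realType) (n : nat).
Local Notation V := 'rV[R]_n.+1.
Variables (X1 X2 : V -> V) (nk : normkind) (step : V -> R * R -> V).
Implicit Types (q : V) (s : seq (R * R)).
Local Notation cost := (@piece_cost R nk).
Local Notation endp := (@piece_end R n step).

Hypothesis endp_dist : forall s, (sf_dist X1 X2 nk 0 (endp s) <= (cost s)%:E)%E.
Hypothesis steer : forall T g (l : R), horizontal X1 X2 T g -> g 0 = 0 ->
  (sf_length X1 X2 nk T g <= l%:E)%E ->
  exists s, [/\ size s = 5%N, endp s = g T & cost s <= l].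
Hypothesis reach : forall q, exists s, endp s = q.

Definition pdist q : R := inf [set cost s | s in [set s | endp s = q]].

Lemma has_inf_pdist q : has_inf [set cost s | s in [set s | endp s = q]].
Proof.
split; first by have [s sq] := reach q; exists (cost s); exists s.
by exists 0 => _ [s _ <-]; exact: cost_ge0.
Qed.

Lemma pdist_le s : pdist (endp s) <= cost s.
Proof. by apply: ge_inf; [case: (has_inf_pdist (endp s))|exists s]. Qed.

Lemma pdist_lt q r : pdist q < r -> exists2 s, endp s = q & cost s < r.
Proof.
by move=> /(inf_lt (has_inf_pdist q).1)[_ [s sq <-] sr]; exists s.
Qed.

Lemma sf_dist_pdist q : sf_dist X1 X2 nk 0 q = (pdist q)%:E.
Proof.
apply/eqP; rewrite eq_le; apply/andP; split.
  apply/lee_addgt0Pr => e e0; have [|s sq se] := @pdist_lt q (pdist q + e).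
    by rewrite ltrDl.
  by rewrite -sq; apply: le_trans (endp_dist s) _; rewrite sq -EFinD lee_fin ltW.
apply: le_ereal_inf_tmp => _ [[T g] /= [hg [g0 gT]] <-].
have l0 : (0 <= sf_length X1 X2 nk T g)%E.
  by apply: integral_ge0 => t _; exact: sf_norm_ge0.
case E : (sf_length X1 X2 nk T g) l0 => [l| |] // _; last by rewrite leey.
have [|s [_ sT sl]] := steer hg g0 (l := l); first by rewrite E.
by rewrite lee_fin -gT -sT; apply: le_trans (pdist_le s) sl.
Qed.

Lemma pdist_lt5 q r : pdist q < r -> exists s, [/\ size s = 5%N, endp s = q & cost s <= r].
Proof.
rewrite -lte_fin -sf_dist_pdist => /ereal_inf_lt[_ [[T g] /= [hg [g0 gT]] <-] lr].
by rewrite -gT; apply: (steer hg g0); exact: ltW.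
Qed.

Lemma sf_sphere_pdist r : sf_sphere X1 X2 nk r = [set q | pdist q = r].
Proof.
by apply/seteqP; split=> q; rewrite /sf_sphere /= sf_dist_pdist; [case|move=> ->].
Qed.

(** The infimum is not shown to be attained, so the level [r] is described by the levels above and
    below it. The description quantifies over finitely many reals and is thus first-order. *)
Lemma pdist_le5 q r : pdist q = r <->
  (forall r', r < r' -> exists s, [/\ size s = 5%N, endp s = q & cost s <= r']) /\
  (forall r', r' < r -> ~ exists s, [/\ size s = 5%N, endp s = q & cost s <= r']).
Proof.
split=> [<-|[H1 H2]].
  split=> r' rr'; first exact: pdist_lt5.
  by move=> [s [_ sq sr]]; have := pdist_le s; rewrite sq leNgt (le_lt_trans sr rr').
apply/eqP; rewrite eq_le; apply/andP; split.
  apply/ler_addgt0Pr => e e0; have [|s [_ sq sr]] := H1 (r + e); first by rewrite ltrDl.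
  by rewrite -sq; apply: le_trans (pdist_le s) sr.
rewrite leNgt; apply/negP => lt.
apply: (H2 ((pdist q + r) / 2)); first by lra.
by apply: pdist_lt5; lra.
Qed.

Lemma nth_setE (e : seq R) i x j : nth 0 (set_nth 0 e i x) j = if j == i then x else nth 0 e j.
Proof. by rewrite nth_set_nth. Qed.

Section Definability.
Variables (dec : (nat -> R) -> V) (stepF : nat -> ord.formula R) (zeroF : nat -> ord.formula R).
Definition window (e : seq R) (o k : nat) : R := nth 0 e (o + k).
Hypothesis dec_ext : forall f g : nat -> R, (forall k, (k < 3)%N -> f k = g k) -> dec f = dec g.
Hypothesis dec_surj : forall q, exists f, dec f = q.
Hypothesis dec_env : forall q, dec (window (env q) 0) = q.
Hypothesis stepFP : forall e o, ord.holds e (stepF o) <->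
  dec (window e o) = step (dec (window e (o + 6))) (window e o 4, window e o 5).
Hypothesis zeroFP : forall e o, ord.holds e (zeroF o) <-> dec (window e o) = 0.

Local Open Scope oterm_scope.

(* A configuration occupies six variables from [o] on: the end point in [o], [o+1], [o+2], the
   available length in [o+3], and the last piece (a, b) in [o+4], [o+5]; the configuration before
   that piece starts at [o+6]. *)
Definition costF (o : nat) : ord.formula R :=
  let a := GRing.Var R (o + 4) in let b := GRing.Var R (o + 5) in
  let m := GRing.Add (GRing.Var R (o + 3)) (GRing.Opp (GRing.Var R (o + 9))) in
  match nk with
  | NormInf => ord.And (ord.And (ord.Le a m) (ord.Le (GRing.Opp a) m))
                       (ord.And (ord.Le b m) (ord.Le (GRing.Opp b) m))
  | Norm1 => ord.And (ord.And (ord.Le (GRing.Add a b) m) (ord.Le (GRing.Add a (GRing.Opp b)) m))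
       (ord.And (ord.Le (GRing.Add (GRing.Opp a) b) m)
                (ord.Le (GRing.Add (GRing.Opp a) (GRing.Opp b)) m))
  end.

Local Close Scope oterm_scope.

Lemma costFP e o : ord.holds e (costF o) <->
  combine nk (window e o 4) (window e o 5) <= window e o 3 - window e o 9.
Proof.
rewrite /costF /combine; case: nk => /=; rewrite /window.
  by rewrite ge_max !ler_norml; split=> [[[]]|/andP[/andP[]]] => *; [apply/andP; split; apply/andP; split|split; split]; lra.
set a := nth _ _ _; set b := nth _ _ _.
have := ler_norm a; have := ler_norm b; have := ler_norm (- a); have := ler_norm (- b).
rewrite !normrN => *; split=> [[[? ?] [? ?]]|?]; last by split; split; lra.
by have [a0|a0] := ler0P a; have [b0|b0] := ler0P b; lra.
Qed.

Fixpoint reachF (k o : nat) : ord.formula R :=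
  if k is k'.+1 then
    ord.Exists (o + 4) (ord.Exists (o + 5) (ord.Exists (o + 6) (ord.Exists (o + 7)
      (ord.Exists (o + 8) (ord.Exists (o + 9)
        (ord.And (stepF o) (ord.And (costF o) (reachF k' (o + 6)))))))))
  else ord.And (zeroF o) (ord.Le (GRing.NatConst R 0) (GRing.Var R (o + 3))).

Lemma reachFP k e o : ord.holds e (reachF k o) <->
  exists s, [/\ size s = k, endp s = dec (window e o) & cost s <= window e o 3].
Proof.
elim: k e o => [|k IH] e o.
  rewrite /= zeroFP; split=> [[z0 r0]|[s [/size0nil -> <-]]].
    by exists [::]; split=> //; rewrite /piece_cost big_nil.
  by rewrite /piece_cost big_nil.
split.
  move=> /= [a [b [x [y [z [r [/stepFP E1 [/costFP E2 /IH[s [sk sq sr]]]]]]]]]].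
  move: E1 E2 sq sr; set e' := set_nth _ _ _ _ => E1 E2 sq sr.
  have ee' j : (j < 4)%N -> window e' o j = window e o j.
    move=> j4; rewrite /window /e' !nth_setE !eqn_add2l.
    by case: j j4 => [|[|[|[|]]]].
  exists (rcons s (window e' o 4, window e' o 5)); split.
  - by rewrite size_rcons sk.
  - rewrite /piece_end foldl_rcons -/(endp s) sq -E1; apply: dec_ext => j j3.
    by apply: ee'; exact: ltnW.
  - rewrite -cats1 cost_cat /piece_cost big_seq1 /= -(ee' 3%N) //.
    apply: le_trans (lerD sr E2) _; rewrite /window -addnA; lra.
move=> [s [sk sq sr]].
case/lastP: s sk sq sr => // s [a b]; rewrite size_rcons => -[sk] sq sr.
have [f fE] := dec_surj (endp s).
(* The variable at [o + 9] is a budget for the shorter word; its exact cost is the witness. *)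
rewrite /=; exists a, b, (f 0%N), (f 1%N), (f 2%N), (cost s).
set e' := set_nth _ _ _ _.
have ee' j : (j < 4)%N -> window e' o j = window e o j.
  move=> j4; rewrite /window /e' !nth_setE !eqn_add2l.
  by case: j j4 => [|[|[|[|]]]].
have e4 : window e' o 4 = a by rewrite /window /e' !nth_setE !eqn_add2l.
have e5 : window e' o 5 = b by rewrite /window /e' !nth_setE !eqn_add2l.
have e9 : window e' o 9 = cost s by rewrite /window /e' !nth_setE !eqn_add2l.
have e6 : dec (window e' (o + 6)) = endp s.
  rewrite -fE; apply: dec_ext => j j3.
  rewrite /window /e' -addnA !nth_setE !eqn_add2l.
  by case: j j3 => [|[|[|]]].
split; last split.
- apply/stepFP; rewrite e4 e5 e6 (dec_ext (g := window e o)).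
    by rewrite -sq /piece_end foldl_rcons.
  by move=> j j3; apply: ee'; exact: ltnW.
- apply/costFP; rewrite e4 e5 e9 ee' //.
  by move: sr; rewrite -cats1 cost_cat /piece_cost big_seq1 /=; lra.
- apply/IH; exists s; split=> //.
  by move: e9; rewrite /window -addnA => ->.
Qed.

Lemma pdist_semianalytic r : semianalytic [set q | pdist q = r].
Proof.
(* Variable 3 is the length slot of the configuration at offset 0, so quantifying over it ranges
   over the levels [r']. *)
pose F := ord.And
  (ord.Forall 3 (ord.Implies (ord.Lt (GRing.Const r) (GRing.Var R 3)) (reachF 5 0)))
  (ord.Forall 3 (ord.Implies (ord.Lt (GRing.Var R 3) (GRing.Const r)) (ord.Not (reachF 5 0)))).
apply: (@definable_semianalytic _ _ F) => q.
have E (r' : R) : ord.holds (set_nth 0 (env q) 3 r') (reachF 5 0) <->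
    exists s, [/\ size s = 5%N, endp s = q & cost s <= r'].
  rewrite reachFP (dec_ext (g := window (env q) 0)) ?dec_env; last first.
    by move=> k k3; rewrite /window nth_set_nth /= (ltn_eqF k3).
  by rewrite /window nth_set_nth /=.
rewrite [_ q]pdist_le5 /F [ord.holds _ _]/=.
split=> -[H1 H2]; split=> r'; have := H1 r'; have := H2 r'; rewrite nth_set_nth /= => h2 h1 rr'.
- by apply/E/h1.
- by move=> /E; exact: h2.
- by apply/E/h1.
- by move=> /E; exact: h2.
Qed.

End Definability.

(** * Homogeneity, continuity and Lipschitz bounds of the distance *)

Section Regularity.
Variable w : 'I_n.+1 -> nat.
Hypothesis w_gt0 : forall i, (0 < w i)%N.
Hypothesis step_dil : forall t q a b, step (dil w t q) (t * a, t * b) = dil w t (step q (a, b)).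
Hypothesis cost_ge1 : forall s, `|endp s| = 1 -> 1 <= cost s.
Variable K : R.
Hypothesis cube_reach : forall q, `|q| <= 1 -> exists s, endp s = q /\ cost s <= K.

Lemma endp_dil t s : endp [seq (t * p.1, t * p.2) | p <- s] = dil w t (endp s).
Proof.
rewrite /piece_end; have {1}-> : (0 : V) = dil w t 0 by apply/rowP => i; rewrite !mxE mulr0.
by elim: s (0 : V) => [//|[a b] s IH] q /=; rewrite step_dil IH.
Qed.

Lemma cost_dil t s : 0 <= t -> cost [seq (t * p.1, t * p.2) | p <- s] = t * cost s.
Proof.
move=> t0; rewrite /piece_cost big_map mulr_sumr; apply: eq_bigr => p _.
by rewrite /= combineZ.
Qed.

(** Dilating a word gives one inequality for every factor; the other is the same inequality for the
    inverse factor. *)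
Lemma pdist_dil t q : 0 < t -> pdist (dil w t q) = t * pdist q.
Proof.
have H u q' : 0 < u -> pdist (dil w u q') <= u * pdist q'.
  move=> u0; apply/ler_addgt0Pr => e e0; have [|s sq se] := @pdist_lt q' (pdist q' + e / u).
    by rewrite ltrDl divr_gt0.
  rewrite -sq -endp_dil; apply: le_trans (pdist_le _) _; rewrite cost_dil ?(ltW u0) // sq.
  have -> : u * pdist q' + e = u * (pdist q' + e / u) by field; rewrite gt_eqF.
  by rewrite ler_pM2l // ltW.
move=> t0; apply/eqP; rewrite eq_le H //=.
have := H t^-1 (dil w t q); rewrite invr_gt0 dilM mulVf ?gt_eqF // dil1 => /(_ t0).
by rewrite -ler_pdivrMl ?invr_gt0 // invrK.
Qed.

Lemma pdist_ge1 q : `|q| = 1 -> 1 <= pdist q.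
Proof.
move=> q1; apply: lb_le_inf; first by case: (has_inf_pdist q).
by move=> _ [s sq <-]; apply: cost_ge1; rewrite sq.
Qed.

Lemma pdist_ltK q : `|q| <= 1 -> pdist q <= K.
Proof. by move=> /cube_reach[s [<- sK]]; apply: le_trans (pdist_le s) sK. Qed.

Hypothesis cube_continuous : forall e : R, 0 < e -> exists2 d : R, 0 < d &
  forall s q', `|endp s| = 1 -> `|q'| = 1 -> cost s <= K + 1 -> `|endp s - q'| < d ->
  exists s', endp s' = q' /\ cost s' <= cost s + e.

Lemma pdist_continuous u (e : R) : `|u| = 1 -> 0 < e -> exists2 d, 0 < d &
  forall u', `|u'| = 1 -> `|u - u'| < d -> `|pdist u - pdist u'| < e.
Proof.
move=> u1 e0; have e20 : 0 < e / 2 by rewrite divr_gt0.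
have [d d0 H] := cube_continuous e20.
have A q q' : `|q| = 1 -> `|q'| = 1 -> `|q - q'| < d -> pdist q' < pdist q + e.
  move=> q1 q'1 qd; apply: (@le_lt_trans _ _ (pdist q + e / 2)); last by rewrite ltrD2l; lra.
  (* The minimum with 1 keeps the nearly optimal word within cost [K + 1], where [cube_continuous]
     applies. *)
  apply/ler_addgt0Pr => h h0; pose h' := Num.min h 1.
  have h'0 : 0 < h' by rewrite lt_min h0 ltr01.
  have [|s sq se] := @pdist_lt q (pdist q + h'); first by rewrite ltrDl.
  have [s' [<- s'e]] : exists s', endp s' = q' /\ cost s' <= cost s + e / 2.
    apply: H; rewrite ?sq //.
    have hh : h' <= 1 by rewrite /h' ge_min lexx orbT.
    by have := @pdist_ltK q; rewrite q1 lexx => /(_ isT); lra.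
  have hh : h' <= h by rewrite /h' ge_min lexx.
  by have := pdist_le s'; lra.
exists d => // u' u'1 uu'; rewrite ltr_distl; apply/andP; split.
  by have := A u u' u1 u'1 uu'; lra.
by have := A u' u u'1 u1; rewrite distrC => /(_ uu').
Qed.

(** A Lipschitz estimate on the level of words: a word ending in [Q] is modified to end at another
    point of [Q]. The bound [K + 1] leaves room for words that are only nearly optimal. *)
Definition lipset (Q : set V) := exists2 C : R, 0 <= C &
  forall s q', Q (endp s) -> Q q' -> cost s <= K + 1 ->
  exists s', endp s' = q' /\ cost s' <= cost s + C * `|endp s - q'|.

Lemma pdist_lip (Q : set V) : (forall q, Q q -> `|q| <= 1) -> lipset Q ->
  exists2 C : R, 0 <= C & forall q q', Q q -> Q q' -> `|pdist q - pdist q'| <= C * `|q - q'|.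
Proof.
move=> Q1 [C C0 H]; exists C => //.
have A q q' : Q q -> Q q' -> pdist q' <= pdist q + C * `|q - q'|.
  move=> Qq Qq'; apply/ler_addgt0Pr => h h0; pose h' := Num.min h 1.
  have h'0 : 0 < h' by rewrite lt_min h0 ltr01.
  have [|s sq se] := @pdist_lt q (pdist q + h'); first by rewrite ltrDl.
  have [s' [s'q s'e]] : exists s', endp s' = q' /\ cost s' <= cost s + C * `|endp s - q'|.
    apply: H; rewrite ?sq //.
    have hh : h' <= 1 by rewrite /h' ge_min lexx orbT.
    by have := pdist_ltK (Q1 q Qq); lra.
  have hh : h' <= h by rewrite /h' ge_min lexx.
  by have := pdist_le s'; move: s'e; rewrite sq s'q; lra.
move=> q q' Qq Qq'; rewrite ler_distl; apply/andP; split.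
  by have := A q q' Qq Qq'; lra.
by have := A q' q Qq' Qq; rewrite distrC.
Qed.

Hypothesis box_lip : forall (i : 'I_n.+1) b (v : 'rV[R]_n), (forall k, `|v ord0 k| <= 1) ->
  exists lo hi, [/\ box lo hi v, (forall v' : 'rV[R]_n, box lo hi v' -> forall k, `|v' ord0 k| <= 1) &
    lipset (face i b @` box lo hi)].

Lemma pdist_box_lip (i : 'I_n.+1) b (v : 'rV[R]_n) : (forall k, `|v ord0 k| <= 1) ->
  exists lo hi, [/\ box lo hi v, (forall v' : 'rV[R]_n, box lo hi v' -> forall k, `|v' ord0 k| <= 1) &
    exists L : R, forall v1 v2 : 'rV[R]_n, box lo hi v1 -> box lo hi v2 ->
      `|pdist (face i b v1) - pdist (face i b v2)| <= L * `|v1 - v2| ].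
Proof.
move=> v1; have [lo [hi [bv b1 /pdist_lip lip]]] := box_lip i b v1.
exists lo, hi; split=> //; have [|C C0 H] := lip.
  by move=> _ [v' bv' <-]; rewrite norm_face //; exact: b1.
exists C => u u' bu bu'; apply: le_trans (H _ _ _ _) _; [by exists u|by exists u'|].
rewrite ler_wpM2l // norm_rV_le //; apply/forallP => j; rewrite !mxE.
case: unlift => [k|]; last by rewrite subrr normr0.
by have := coord_le_norm (u - u') k; rewrite !mxE.
Qed.

Lemma pdist_sphere_homeo r : 0 < r ->
  homeomorphic [set q | pdist q = r] (@eucl_unit_sphere R n.+1).
Proof.
move=> r0; apply: (homogeneous_sphere_homeo w_gt0) => //.
- exact: pdist_dil.
- exact: pdist_ge1.
- exact: pdist_continuous.
Qed.

Lemma pdist_sphere_rectifiable r : (0 < n)%N -> 0 < r -> rectifiable n [set q | pdist q = r].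
Proof.
move=> n0 r0; apply: (homogeneous_sphere_rectifiable w_gt0) => //.
- exact: pdist_dil.
- exact: pdist_ge1.
- exact: pdist_box_lip.
Qed.

End Regularity.
End PolygonalDistance.

(* [vector.coord] of mathcomp shadows [Defs.coord]. *)
Local Notation coord := Defs.coord.

(** * Coordinates and polynomial flows in dimensions two and three *)

Section Coordinates.
Variable R : realType.

Lemma coord_vec2 (a b : R) k : (k < 2)%N -> coord (vec2 a b) k = nth 0 [:: a; b] k.
Proof. by move=> k2; rewrite /coord mxE inordK. Qed.

Lemma coord_vec3 (a b c : R) k : (k < 3)%N -> coord (vec3 a b c) k = nth 0 [:: a; b; c] k.
Proof. by move=> k3; rewrite /coord mxE inordK. Qed.

Lemma ord2P (P : 'I_2 -> Prop) : P (inord 0) -> P (inord 1) -> forall i, P i.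
Proof.
move=> P0 P1 [[|[|//]] ltk].
  by rewrite (_ : Ordinal _ = inord 0) //; apply: val_inj; rewrite /= inordK.
by rewrite (_ : Ordinal _ = inord 1) //; apply: val_inj; rewrite /= inordK.
Qed.

Lemma ord3P (P : 'I_3 -> Prop) : P (inord 0) -> P (inord 1) -> P (inord 2) -> forall i, P i.
Proof.
move=> P0 P1 P2 [[|[|[|//]]] ltk].
- by rewrite (_ : Ordinal _ = inord 0) //; apply: val_inj; rewrite /= inordK.
- by rewrite (_ : Ordinal _ = inord 1) //; apply: val_inj; rewrite /= inordK.
- by rewrite (_ : Ordinal _ = inord 2) //; apply: val_inj; rewrite /= inordK.
Qed.

Lemma vec2_eta (q : 'rV[R]_2) : q = vec2 (coord q 0) (coord q 1).
Proof. by apply/rowP; apply: ord2P; rewrite mxE inordK. Qed.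

Lemma vec3_eta (q : 'rV[R]_3) : q = vec3 (coord q 0) (coord q 1) (coord q 2).
Proof. by apply/rowP; apply: ord3P; rewrite mxE inordK. Qed.

Lemma vec2_inj (a b a' b' : R) : vec2 a b = vec2 a' b' -> a = a' /\ b = b'.
Proof.
move=> E; split.
  by have := congr1 (fun q => coord q 0) E; rewrite !coord_vec2.
by have := congr1 (fun q => coord q 1) E; rewrite !coord_vec2.
Qed.

Lemma vec3_inj (a b c a' b' c' : R) : vec3 a b c = vec3 a' b' c' -> [/\ a = a', b = b' & c = c'].
Proof.
move=> E; split.
- by have := congr1 (fun q => coord q 0) E; rewrite !coord_vec3.
- by have := congr1 (fun q => coord q 1) E; rewrite !coord_vec3.
- by have := congr1 (fun q => coord q 2) E; rewrite !coord_vec3.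
Qed.

Lemma vec2D (a b a' b' : R) : vec2 a b + vec2 a' b' = vec2 (a + a') (b + b').
Proof. by apply/rowP; apply: ord2P; rewrite !mxE inordK. Qed.

Lemma vec3D (a b c a' b' c' : R) : vec3 a b c + vec3 a' b' c' = vec3 (a + a') (b + b') (c + c').
Proof. by apply/rowP; apply: ord3P; rewrite !mxE inordK. Qed.

Lemma vec2Z (k a b : R) : k *: vec2 a b = vec2 (k * a) (k * b).
Proof. by apply/rowP; apply: ord2P; rewrite !mxE inordK. Qed.

Lemma vec3Z (k a b c : R) : k *: vec3 a b c = vec3 (k * a) (k * b) (k * c).
Proof. by apply/rowP; apply: ord3P; rewrite !mxE inordK. Qed.

Lemma vec2_0 : vec2 0 0 = 0 :> 'rV[R]_2.
Proof. by apply/rowP; apply: ord2P; rewrite !mxE inordK. Qed.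

Lemma vec3_0 : vec3 0 0 0 = 0 :> 'rV[R]_3.
Proof. by apply/rowP; apply: ord3P; rewrite !mxE inordK. Qed.

Lemma vec2_norm_le (a b c : R) : 0 <= c -> (`|vec2 a b| <= c) = (`|a| <= c) && (`|b| <= c).
Proof.
move=> c0; rewrite norm_rV_le //; apply/forallP/andP => [H|[ha hb]].
  by have := H (inord 0); have := H (inord 1); rewrite !mxE !inordK.
by apply: ord2P; rewrite mxE inordK.
Qed.

Lemma vec3_norm_le (a b c d : R) : 0 <= d ->
  (`|vec3 a b c| <= d) = [&& `|a| <= d, `|b| <= d & `|c| <= d].
Proof.
move=> d0; rewrite norm_rV_le //; apply/forallP/and3P => [H|[ha hb hc]].
  by have := H (inord 0); have := H (inord 1); have := H (inord 2); rewrite !mxE !inordK.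
by apply: ord3P; rewrite mxE inordK.
Qed.

Lemma vec2_norm1 (a b : R) : `|vec2 a b| = 1 -> `|a| = 1 \/ `|b| = 1.
Proof.
move=> H; have [i] := norm_rV_attained (vec2 a b); rewrite H.
by move: i; apply: ord2P; rewrite mxE inordK //=; [left|right].
Qed.

Lemma vec3_norm1 (a b c : R) : `|vec3 a b c| = 1 -> [\/ `|a| = 1, `|b| = 1 | `|c| = 1].
Proof.
move=> H; have [i] := norm_rV_attained (vec3 a b c); rewrite H.
by move: i; apply: ord3P; rewrite mxE inordK //=;
  [constructor 1|constructor 2|constructor 3].
Qed.

(** With constant controls every coordinate of the three flows is a polynomial in time of degree at
    most 3, the degree that occurs in the Martinet case; one family serves all of them. *)
Definition cubic (c0 c1 c2 c3 t : R) := c0 + c1 * t + c2 * t ^+ 2 + c3 * t ^+ 3.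

Lemma is_derive_cubic c0 c1 c2 c3 (t : R) :
  is_derive t 1 (cubic c0 c1 c2 c3) (c1 + 2 * c2 * t + 3 * c3 * t ^+ 2).
Proof.
pose p : {poly R} := c0%:P + c1%:P * 'X + c2%:P * 'X^2 + c3%:P * 'X^3.
have -> : cubic c0 c1 c2 c3 = horner p.
  by apply/funext => s; rewrite /cubic /p !hornerE /=; ring.
have -> : c1 + 2 * c2 * t + 3 * c3 * t ^+ 2 = (poly.deriv p).[t].
  by rewrite /p !poly.derivE !hornerE /=; ring.
exact: is_derive_poly.
Qed.

Lemma cubic_lip c0 c1 c2 c3 (r : R) : exists2 L, 0 <= L & forall s t, 0 <= s <= r -> 0 <= t <= r ->
  `|cubic c0 c1 c2 c3 s - cubic c0 c1 c2 c3 t| <= L * `|s - t|.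
Proof.
exists (`|c1| + `|c2| * (2 * `|r|) + `|c3| * (3 * `|r| ^+ 2)).
  by rewrite !addr_ge0 // mulr_ge0 // mulr_ge0 // exprn_ge0.
move=> s t /andP[s0 sr] /andP[t0 tr].
have -> : cubic c0 c1 c2 c3 s - cubic c0 c1 c2 c3 t =
    (c1 + c2 * (s + t) + c3 * (s ^+ 2 + s * t + t ^+ 2)) * (s - t) by rewrite /cubic; ring.
rewrite normrM ler_wpM2r //.
have r0 : 0 <= r by lra.
apply: le_trans (ler_normD _ _) _; apply: lerD.
  apply: le_trans (ler_normD _ _) _; rewrite lerD2l normrM ler_wpM2l //.
  by rewrite !ger0_norm //; lra.
rewrite normrM ler_wpM2l // (ger0_norm r0) ger0_norm; nra.
Qed.

Lemma enorm_cubic_lip n (f : R -> 'rV[R]_n) (c0 c1 c2 c3 : 'I_n -> R) (r : R) :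
  (forall t i, f t ord0 i = cubic (c0 i) (c1 i) (c2 i) (c3 i) t) ->
  exists L : R, forall s t : R, 0 <= s <= r -> 0 <= t <= r -> enorm (f s - f t) <= L * `|s - t|.
Proof.
move=> fE.
have /choice[L HL] : forall i, exists L, forall s t, 0 <= s <= r -> 0 <= t <= r ->
    `|f s ord0 i - f t ord0 i| <= L * `|s - t|.
  move=> i; have [L _ H] := cubic_lip (c0 i) (c1 i) (c2 i) (c3 i) r.
  by exists L => s t sr tr; rewrite !fE; exact: H.
exists (\sum_i L i) => s t sr tr; apply: le_trans (enorm_le_sum _) _.
by rewrite mulr_suml; apply: ler_sum => i _; rewrite !mxE; exact: HL.
Qed.

End Coordinates.

Section Interpolation.
Variable R : realType.

(** Used on a segment between two control words, where the last coordinate of the end point is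
    polynomial in the parameter. *)
Lemma poly_interp (p : {poly R}) (v : R) : p.[0] <= v <= p.[1] ->
  exists2 t, 0 <= t <= 1 & p.[t] = v.
Proof.
move=> /andP[p0 p1]; have [|t t01] := @poly_ivt R (p - v%:P) 0 1 ler01.
  by rewrite !hornerE; apply/andP; split; lra.
by rewrite /root !hornerE subr_eq0 => /eqP pv; exists t.
Qed.

Lemma norm_convex (t a b : R) : 0 <= t <= 1 -> `|a + t * (b - a)| <= `|a| + t * (`|b| - `|a|).
Proof.
move=> /andP[t0 t1].
have -> : a + t * (b - a) = (1 - t) * a + t * b by ring.
apply: le_trans (ler_normD _ _) _; rewrite !normrM (ger0_norm t0) ger0_norm; lra.
Qed.

Lemma combine_convex nk (t a b a' b' : R) : 0 <= t <= 1 ->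
  combine nk (a + t * (a' - a)) (b + t * (b' - b)) <=
  combine nk a b + t * (combine nk a' b' - combine nk a b).
Proof.
move=> t01; have ha := norm_convex a a' t01; have hb := norm_convex b b' t01.
case: nk => /=; last by lra.
have /andP[t0 t1] := t01.
have ma : `|a| <= Num.max `|a| `|b| by rewrite le_max lexx.
have mb : `|b| <= Num.max `|a| `|b| by rewrite le_max lexx orbT.
have ma' : `|a'| <= Num.max `|a'| `|b'| by rewrite le_max lexx.
have mb' : `|b'| <= Num.max `|a'| `|b'| by rewrite le_max lexx orbT.
move: (Num.max _ _) (Num.max _ _) ma mb ma' mb' => m m' *.
rewrite ge_max; apply/andP; split.
  by apply: le_trans ha _; nra.
by apply: le_trans hb _; nra.
Qed.

End Interpolation.

(** * Horizontal curves as scalar control systems *)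

Section Potentials.
Variable R : realType.
Local Notation mu := (@lebesgue_measure R).

Lemma combine_l0 nk (a : R) : combine nk a 0 = `|a|.
Proof. by case: nk => /=; rewrite normr0 ?addr0 // max_l. Qed.

Lemma combine_0r nk (a : R) : combine nk 0 a = `|a|.
Proof. by case: nk => /=; rewrite normr0 ?add0r // max_r. Qed.

Lemma norm_combine_l nk (a b : R) : `|a| <= combine nk a b.
Proof. by case: nk => /=; rewrite ?le_max ?lexx // lerDl. Qed.

Lemma norm_combine_r nk (a b : R) : `|b| <= combine nk a b.
Proof. by case: nk => /=; rewrite ?le_max ?lexx ?orbT // lerDr. Qed.

Lemma is_derive_lin3 (f1 f2 f3 : R -> R) (k1 k2 k3 t d1 d2 d3 : R) :
  is_derive t 1 f1 d1 -> is_derive t 1 f2 d2 -> is_derive t 1 f3 d3 ->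
  is_derive t 1 (fun s => k1 * f1 s + k2 * f2 s + k3 * f3 s) (k1 * d1 + k2 * d2 + k3 * d3).
Proof. by move=> h1 h2 h3; apply: is_deriveD. Qed.

Lemma is_derive_mul (f g : R -> R) (t df dg : R) :
  is_derive t 1 f df -> is_derive t 1 g dg ->
  is_derive t 1 (fun s => f s * g s) (f t * dg + g t * df).
Proof. by move=> hf hg; exact: is_deriveM. Qed.

Lemma is_derive_vec3 (f1 f2 f3 : R -> R) (t d1 d2 d3 : R) :
  is_derive t 1 f1 d1 -> is_derive t 1 f2 d2 -> is_derive t 1 f3 d3 ->
  is_derive t 1 (fun s => vec3 (f1 s) (f2 s) (f3 s)) (vec3 d1 d2 d3).
Proof.
move=> h1 h2 h3; apply/is_derive_coordP; apply: ord3P; rewrite mxE inordK //=.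
- by under eq_fun do rewrite mxE inordK //=.
- by under eq_fun do rewrite mxE inordK //=.
- by under eq_fun do rewrite mxE inordK //=.
Qed.

Lemma is_derive_vec2 (f1 f2 : R -> R) (t d1 d2 : R) :
  is_derive t 1 f1 d1 -> is_derive t 1 f2 d2 ->
  is_derive t 1 (fun s => vec2 (f1 s) (f2 s)) (vec2 d1 d2).
Proof.
move=> h1 h2; apply/is_derive_coordP; apply: ord2P; rewrite mxE inordK //=.
- by under eq_fun do rewrite mxE inordK //=.
- by under eq_fun do rewrite mxE inordK //=.
Qed.

(** A horizontal curve seen as three scalar functions, tied by the relation [sys] between their
    derivatives and a speed [e] dominated by [N]. Linear and nonlinear changes of coordinates act on
    this form without changing [N]. *)
Definition driven (N : R -> \bar R) T (u v h : R -> R) (sys : R -> R -> R -> R -> R -> Prop) :=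
  [/\ ac T u, ac T v, ac T h & {ae mu, forall t, 0 <= t <= T ->
    exists du dv dh e, [/\ is_derive t 1 u du, is_derive t 1 v dv, is_derive t 1 h dh,
      sys t du dv dh e & (e%:E <= N t)%E]}].

Lemma calib_lin N T u v h sys c k1 k2 k3 a b : driven N T u v h sys -> 0 <= c -> 0 <= a -> b <= T ->
  (forall t du dv dh e, a <= t <= b -> sys t du dv dh e -> k1 * du + k2 * dv + k3 * dh <= c * e) ->
  calib N T c a b (fun t => k1 * u t + k2 * v t + k3 * h t).
Proof.
move=> [acu acv ach aeS] c0 a0 bT H; split.
  by apply: acD; [apply: acD|]; exact: acZ.
apply: (ae_impl aeS) => t S /andP[at_ tb].
have [|du [dv [dh [e [hu hv hh he eN]]]]] := S.
  by rewrite (le_trans a0 at_) (le_trans tb bT).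
exists (k1 * du + k2 * dv + k3 * dh); split; first exact: is_derive_lin3.
apply: le_trans (lee_wpmul2l _ eN); rewrite ?lee_fin //.
by apply: H he; rewrite at_.
Qed.

Lemma sf_norm_ge n (X1 X2 : 'rV[R]_n -> 'rV[R]_n) nk q v c :
  (forall w1 w2, v = w1 *: X1 q + w2 *: X2 q -> c <= combine nk w1 w2) ->
  (c%:E <= sf_norm X1 X2 nk q v)%E.
Proof.
by move=> H; apply: le_ereal_inf_tmp => _ [[w1 w2] /= /H cw <-]; rewrite lee_fin.
Qed.

Lemma horizontal_driven3 (f k : 'rV[R]_3 -> R) nk T g :
  let X1 := fun q => vec3 1 0 (f q) in let X2 := fun q => vec3 0 1 (k q) in
  horizontal X1 X2 T g ->
  driven (fun t => sf_norm X1 X2 nk (g t) (derive1 g t)) T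
    (fun t => coord (g t) 0) (fun t => coord (g t) 1) (fun t => coord (g t) 2)
    (fun t dx dy dz e => dz = dx * f (g t) + dy * k (g t) /\ e = combine nk dx dy).
Proof.
move=> X1 X2 [T0 [acg aeg]]; split; [exact: ac_coord|exact: ac_coord|exact: ac_coord|].
apply: (ae_impl aeg) => t H tT; have [|dg [[w1 w2] /= gE]] := H.
  by rewrite /= in_itv.
have E u1 u2 : u1 *: X1 (g t) + u2 *: X2 (g t) = vec3 u1 u2 (u1 * f (g t) + u2 * k (g t)).
  by rewrite /X1 /X2 !vec3Z vec3D !mulr1 !mulr0 addr0 add0r.
rewrite E in gE.
have D : is_derive t 1 g (derive1 g t) by rewrite derive1E; exact: derivableP.
move/is_derive_coordP in D.
exists w1, w2, (w1 * f (g t) + w2 * k (g t)), (combine nk w1 w2); split => //.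
- by have := D (inord 0); rewrite gE mxE inordK.
- by have := D (inord 1); rewrite gE mxE inordK.
- by have := D (inord 2); rewrite gE mxE inordK.
- by apply: sf_norm_ge => u1 u2; rewrite gE E => /vec3_inj[-> ->].
Qed.

Lemma horizontal_driven2 (f : 'rV[R]_2 -> R) nk T g :
  let X1 := fun q => vec2 1 0 in let X2 := fun q => vec2 0 (f q) in
  horizontal X1 X2 T g ->
  driven (fun t => sf_norm X1 X2 nk (g t) (derive1 g t)) T
    (fun t => coord (g t) 0) (fun=> 0) (fun t => coord (g t) 1)
    (fun t dx _ dz e => exists2 w, dz = f (g t) * w & e = combine nk dx w).
Proof.
move=> X1 X2 [T0 [acg aeg]]; split; [exact: ac_coord| |exact: ac_coord|].
  by move=> e e0; exists 1 => // M a b _ _; rewrite big1 // => i _; rewrite subrr normr0.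
apply: (ae_impl aeg) => t H tT; have [|dg [[w1 w2] /= gE]] := H.
  by rewrite /= in_itv.
have E u1 u2 : u1 *: X1 (g t) + u2 *: X2 (g t) = vec2 u1 (u2 * f (g t)).
  by rewrite /X1 /X2 !vec2Z vec2D !mulr1 !mulr0 addr0 add0r.
rewrite E in gE.
have D : is_derive t 1 g (derive1 g t) by rewrite derive1E; exact: derivableP.
move/is_derive_coordP in D.
(* On the line where the second field vanishes its control is not determined by the velocity; the
   choice 0 has the smallest cost. *)
pose w := if f (g t) == 0 then 0 else w2.
have wE : w2 * f (g t) = w * f (g t).
  by rewrite /w; case: eqP => // ->; rewrite !mulr0.
exists w1, 0, (f (g t) * w), (combine nk w1 w); split => //.
- by have := D (inord 0); rewrite gE mxE inordK.
- exact: is_derive_cst.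
- by have := D (inord 1); rewrite gE mxE inordK //= wE mulrC.
- by exists w.
- apply: sf_norm_ge => u1 u2; rewrite gE E => /vec2_inj[-> ].
  rewrite /w; case: eqP => [_|/eqP f0 /(mulIf f0)-> //].
  by move=> _; rewrite combine_l0 norm_combine_l.
Qed.

End Potentials.

(** * Prefixes that leave the degenerate set, and corrections *)

Section Prefixes.
Variables (R : realType) (n : nat).
Local Notation V := 'rV[R]_n.+1.
Variables (nk : normkind) (step : V -> R * R -> V).
Local Notation cost := (@piece_cost R nk).
Local Notation endp := (@piece_end R n step).

Lemma endp_rcons s p : endp (rcons s p) = step (endp s) p.
Proof. by rewrite /piece_end foldl_rcons. Qed.

Lemma endp_cat s1 s2 : endp (s1 ++ s2) = foldl step (endp s1) s2.
Proof. by rewrite /piece_end foldl_cat. Qed.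

Lemma cost_rcons s p : cost (rcons s p) = cost s + combine nk p.1 p.2.
Proof. by rewrite -cats1 cost_cat /piece_cost big_cons big_nil addr0. Qed.

Lemma cost_nil : cost [::] = 0.
Proof. by rewrite /piece_cost big_nil. Qed.

Section Growth.
Variable phi : V -> R.
Hypothesis phi0 : phi 0 = 0.
Hypothesis phi_step : forall q a b, phi (step q (a, b)) <= phi q + combine nk a b.

Lemma phi_le_cost s : phi (endp s) <= cost s.
Proof.
elim/last_ind: s => [|s [a b] IH]; first by rewrite /piece_end /= phi0 cost_ge0.
by rewrite endp_rcons cost_rcons; apply: le_trans (phi_step _ _ _) _; rewrite lerD2r.
Qed.

Variables (ht : V -> R) (k : nat).
Hypothesis ht0 : ht 0 = 0.
Hypothesis ht_step : forall c q a b, 0 <= c -> phi q <= c -> phi (step q (a, b)) <= c ->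
  `|ht (step q (a, b)) - ht q| <= c ^+ k * combine nk a b.

(** As long as [phi <= c], the height [ht] changes by at most [c ^+ k] per unit of cost. A cheap
    word that ends high must therefore have a prefix with [phi > c], and there the height can be
    corrected at a cost linear in the correction. *)
Lemma large_prefix c s : 0 <= c ->
  (exists s1 s2, s = s1 ++ s2 /\ c < phi (endp s1)) \/
  (phi (endp s) <= c /\ `|ht (endp s)| <= c ^+ k * cost s).
Proof.
move=> c0; elim/last_ind: s => [|s [a b] [[s1 [s2 [-> cs]]]|[ps hs]]].
- by right; rewrite /piece_end /= phi0 ht0 normr0 mulr_ge0 ?exprn_ge0 ?cost_ge0.
- by left; exists s1, (rcons s2 (a, b)); rewrite rcons_cat.
have [ps'|ps'] := lerP (phi (endp (rcons s (a, b)))) c; last first.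
  by left; exists (rcons s (a, b)), [::]; rewrite cats0.
right; split => //; rewrite cost_rcons mulrDr.
move: ps'; rewrite endp_rcons => ps'; have := ht_step c0 ps ps'.
have := ler_normD (ht (endp s)) (ht (step (endp s) (a, b)) - ht (endp s)).
by rewrite addrC subrK /=; lra.
Qed.

Lemma ht_le_cost s : `|ht (endp s)| <= cost s ^+ k.+1.
Proof.
(* The threshold is the full cost, which no prefix can exceed by [phi_le_cost]. *)
have [[s1 [s2 [-> cs]]]|[_]] := large_prefix s (cost_ge0 nk s); last by rewrite exprSr.
have := lt_le_trans cs (phi_le_cost s1); rewrite cost_cat.
by have := cost_ge0 nk s2; lra.
Qed.

End Growth.

Variable K : R.

Lemma lipset_sub (P Q : set V) : P `<=` Q -> lipset nk step K Q -> lipset nk step K P.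
Proof.
by move=> PQ [C C0 H]; exists C => // s q' /PQ Qs /PQ Qq'; exact: H.
Qed.

Lemma lipset_cube_continuous : lipset nk step K [set q | `|q| = 1] ->
  forall e : R, 0 < e -> exists2 d : R, 0 < d &
  forall s q', `|endp s| = 1 -> `|q'| = 1 -> cost s <= K + 1 -> `|endp s - q'| < d ->
  exists s', endp s' = q' /\ cost s' <= cost s + e.
Proof.
move=> [C C0 H] e e0; have C1 : 0 < C + 1 by lra.
exists (e / (C + 1)) => [|s q' s1 q1 sK sq]; first by rewrite divr_gt0.
have [s' [s'q s'e]] := H s q' s1 q1 sK; exists s'; split => //.
apply: le_trans s'e _; rewrite lerD2l.
apply: (@le_trans _ _ ((C + 1) * `|endp s - q'|)); first by rewrite ler_wpM2r //; lra.
by rewrite mulrC -ler_pdivlMr // ltW.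
Qed.

Lemma unit_boxP m (v : 'rV[R]_m) :
  box (const_mx (-1)) (const_mx 1) v <-> forall k, `|v ord0 k| <= 1.
Proof.
have e1 : ratr 1 = 1 :> R by exact: rmorph1.
have e2 : ratr (-1) = -1 :> R by exact: rmorphN1.
by split=> H k; have := H k; rewrite !mxE ler_norml e1 e2.
Qed.

Lemma lipset_box (i : 'I_n.+1) b (v : 'rV[R]_n) :
  lipset nk step K [set q | `|q| = 1] -> (forall k, `|v ord0 k| <= 1) ->
  exists lo hi, [/\ box lo hi v, (forall v' : 'rV[R]_n, box lo hi v' -> forall k, `|v' ord0 k| <= 1) &
    lipset nk step K (face i b @` box lo hi)].
Proof.
move=> L v1; exists (const_mx (-1)), (const_mx 1).
split; [exact/unit_boxP|by move=> v' /unit_boxP|].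
by apply: lipset_sub L => _ [v' /unit_boxP v'1 <-]; exact: norm_face.
Qed.

End Prefixes.

Section Environments.
Variable R : realType.

Lemma dec3_env (q : 'rV[R]_3) :
  vec3 (window (env q) 0 0) (window (env q) 0 1) (window (env q) 0 2) = q.
Proof.
by rewrite [RHS]vec3_eta /window /Defs.coord -!nth_env !inordK.
Qed.

Lemma dec2_env (q : 'rV[R]_2) : vec2 (window (env q) 0 0) (window (env q) 0 1) = q.
Proof.
by rewrite [RHS]vec2_eta /window /Defs.coord -!nth_env !inordK.
Qed.

End Environments.

Lemma segment_poly (R : realType) :
  exists f : R -> R -> {poly R}, forall x y t, (f x y).[t] = x + t * (y - x).
Proof.
by exists (fun x y => x%:P + 'X * (y - x)%:P) => x y t; rewrite hornerD hornerM hornerX !hornerC.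
Qed.

(** * The Heisenberg group *)

Section HeisenbergPlanar.
Variables (R : realType).
Local Notation mu := (@lebesgue_measure R).

Lemma norm1_dual (c a b x y : R) : `|a| <= c -> `|b| <= c -> a * x + b * y <= c * (`|x| + `|y|).
Proof.
move=> ac bc; rewrite mulrDr; apply: lerD; apply: le_trans (ler_norm _) _;
  by rewrite normrM ler_wpM2r.
Qed.

Definition symplectic (u : R -> R) (t du dv dh e : R) := dh = u t * dv /\ e = `|du| + `|dv|.

(** Since [dh = u dv], the function [k3 h + k2 v] changes at rate [(k2 + k3 u) dv], so by duality of
    the two norms a term [c u] of either sign may be added. Taking the signs [- sg], [sg], [- sg] on
    the three intervals counts the oscillation of [u] between [s1] and [s2]. *)
Lemma symplectic_oscillation (N : R -> \bar R) T l u v h (c k2 k3 sg s1 s2 : R) :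
  0 <= T -> (forall t, 0 <= N t)%E -> (\int[mu]_(t in [set t | (0 <= t <= T)%R]) N t <= l%:E)%E ->
  driven N T u v h (symplectic u) -> u 0 = 0 -> v 0 = 0 -> h 0 = 0 ->
  (forall t, 0 <= t <= T -> `|k2 + k3 * u t| <= c) -> `|sg| = 1 -> 0 <= s1 -> s1 <= s2 -> s2 <= T ->
  k3 * h T + k2 * v T + sg * c * (2 * u s2 - 2 * u s1 - u T) <= c * l.
Proof.
move=> T0 N0 intN D u0 v0 h0 kc sg1 s10 s12 s2T.
have c0 : 0 <= c by apply: le_trans (normr_ge0 _) (kc 0 _); rewrite lexx T0.
have C sg' a b : `|sg'| = 1 -> 0 <= a -> b <= T ->
    calib N T c a b (fun t => (sg' * c) * u t + k2 * v t + k3 * h t).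
  move=> sg'1 a0 bT; apply: (calib_lin D) => // t du dv dh _ /andP[at_ tb] [-> ->].
  have -> : sg' * c * du + k2 * dv + k3 * (u t * dv) = (sg' * c) * du + (k2 + k3 * u t) * dv by ring.
  apply: norm1_dual; first by rewrite normrM sg'1 mul1r ger0_norm.
  by apply: kc; rewrite (le_trans a0 at_) (le_trans tb bT).
have sgN : `|- sg| = 1 by rewrite normrN.
have := calib3 T0 N0 intN c0 s10 s12 s2T (C (- sg) 0 s1 sgN _ _) (C sg s1 s2 sg1 _ _)
   (C (- sg) s2 T sgN _ _).
rewrite !lexx s10 s2T (le_trans s12 s2T) (le_trans s10 s12) /= u0 v0 h0 => /(_ isT isT isT isT isT isT).
by lra.
Qed.

(* With be = - min u and al = max u the calibrated potentials are
   h - (al - be) / 2 v +- (al + be) / 2 u, the sign changing at the two extrema of u; the optimal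
   curve moves in u between the extrema and in v at the extrema. *)
Lemma symplectic_upper (N : R -> \bar R) T l u v h :
  0 <= T -> (forall t, 0 <= N t)%E -> (\int[mu]_(t in [set t | (0 <= t <= T)%R]) N t <= l%:E)%E ->
  driven N T u v h (symplectic u) -> u 0 = 0 -> v 0 = 0 -> h 0 = 0 ->
  exists m1 n1 m2 n2 m3, [/\ m1 + m2 + m3 = u T, n1 + n2 = v T,
    `|m1| + `|n1| + `|m2| + `|n2| + `|m3| <= l & h T <= m1 * n1 + (m1 + m2) * n2].
Proof.
move=> T0 N0 intN D u0 v0 h0; have [acu _ _ _] := D.
have [t2 /andP[t20 t2T] H2] := ac_max T0 acu; have [t1 /andP[t10 t1T] H1] := ac_max T0 (acN acu).
have T00 : 0 <= (0 : R) <= T by rewrite lexx.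
have TTT : 0 <= T <= T by rewrite lexx T0.
have := H2 0 T00; have := H1 0 T00; have := H2 T TTT; have := H1 T TTT; rewrite u0 oppr0.
set al := u t2; set be := - u t1 => uTb uTa be0 al0.
have kc t : 0 <= t <= T -> `|- ((al - be) / 2) + 1 * u t| <= (al + be) / 2.
  by move=> tT; have := H2 t tT; have := H1 t tT; rewrite -/al -/be ler_norml => *; apply/andP; split; lra.
have k1 k t : `|k| = 1 -> 0 <= t <= T -> `|k + 0 * u t| <= 1 by rewrite mul0r addr0 => ->.
have M := symplectic_oscillation T0 N0 intN D u0 v0 h0.
have n1 : `|1| = 1 :> R by rewrite normr1.
have nN1 : `|-1| = 1 :> R by rewrite normrN normr1.
have [t12|t21] := leP t1 t2.
  have := M _ _ _ _ _ _ kc n1 t10 t12 t2T.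
  have := M _ _ _ _ _ _ (fun t => k1 _ t n1) n1 t10 t12 t2T.
  have := M _ _ _ _ _ _ (fun t => k1 _ t nN1) n1 t10 t12 t2T.
  have -> : u t1 = - be by rewrite opprK.
  (* [b] is the length left for [v] once [u] has gone from 0 through [- be] and [al] to [u T]; [b1]
     and [b2] say that [|v T| <= b]. The two moves in [v] use up [b], the first with negative sign
     because [u = - be] there. *)
  rewrite -/al => b1 b2 hb; pose b := l - 2 * (al + be) + u T.
  exists (- be), (- ((b - v T) / 2)), (al + be), ((b + v T) / 2), (u T - al); split.
  - by ring.
  - by field.
  - rewrite (normrN be) (normrN ((b - v T) / 2)) (ger0_norm be0) (ger0_norm (addr_ge0 al0 be0)) (distrC (u T)).
    by rewrite !ger0_norm /b; lra.
  - apply: (@le_trans _ _ ((al - be) / 2 * v T + (al + be) / 2 * b)); last first.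
      by rewrite le_eqVlt; apply/orP; left; apply/eqP; field.
    by rewrite /b; lra.
have := M _ _ _ _ _ _ kc nN1 t20 (ltW t21) t1T.
have := M _ _ _ _ _ _ (fun t => k1 _ t n1) nN1 t20 (ltW t21) t1T.
have := M _ _ _ _ _ _ (fun t => k1 _ t nN1) nN1 t20 (ltW t21) t1T.
have -> : u t1 = - be by rewrite opprK.
rewrite -/al => b1 b2 hb; pose b := l - 2 * (al + be) - u T.
exists al, ((b + v T) / 2), (- (al + be)), (- ((b - v T) / 2)), (u T + be); split.
- by ring.
- by field.
- rewrite (normrN (al + be)) (normrN ((b - v T) / 2)) (ger0_norm al0) (ger0_norm (addr_ge0 al0 be0)).
  by rewrite !ger0_norm /b; lra.
- apply: (@le_trans _ _ ((al - be) / 2 * v T + (al + be) / 2 * b)); last first.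
    by rewrite le_eqVlt; apply/orP; left; apply/eqP; field.
  by rewrite /b; lra.
Qed.

Lemma driven_imp (N : R -> \bar R) T u v h sys sys' : driven N T u v h sys ->
  (forall t du dv dh e, 0 <= t <= T -> sys t du dv dh e -> sys' t du dv dh e) ->
  driven N T u v h sys'.
Proof.
move=> [acu acv ach aeS] H; split => //; apply: (ae_impl aeS) => t S tT.
have [du [dv [dh [e [? ? ? ? ?]]]]] := S tT.
by exists du, dv, dh, e; split => //; exact: H.
Qed.

Lemma driven_lin (N : R -> \bar R) T u v h (a b c : R) sys : driven N T u v h sys ->
  driven N T (fun t => a * u t) (fun t => b * v t) (fun t => c * h t)
    (fun t du dv dh e => exists du' dv' dh', [/\ du = a * du', dv = b * dv', dh = c * dh' &
       sys t du' dv' dh' e]).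
Proof.
move=> [acu acv ach aeS]; split; [exact: acZ|exact: acZ|exact: acZ|].
apply: (ae_impl aeS) => t S tT; have [du [dv [dh [e [? ? ? ? ?]]]]] := S tT.
exists (a * du), (b * dv), (c * dh), e; split => //; try exact: is_deriveZ.
by exists du, dv, dh.
Qed.

(** The reflection [(u, v, h)] to [(- u, v, - h)] preserves the system and turns the upper bound
    into a lower one. On the segment between the two words the end values of [u] and [v] are
    constant, the cost stays at most [l], and [h] takes the required value. *)
Lemma symplectic_steer (N : R -> \bar R) T l u v h :
  0 <= T -> (forall t, 0 <= N t)%E -> (\int[mu]_(t in [set t | (0 <= t <= T)%R]) N t <= l%:E)%E ->
  driven N T u v h (symplectic u) -> u 0 = 0 -> v 0 = 0 -> h 0 = 0 ->
  exists m1 n1 m2 n2 m3, [/\ m1 + m2 + m3 = u T, n1 + n2 = v T,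
    `|m1| + `|n1| + `|m2| + `|n2| + `|m3| <= l & h T = m1 * n1 + (m1 + m2) * n2].
Proof.
move=> T0 N0 intN D u0 v0 h0.
have [a1 [b1 [a2 [b2 [a3 [aE bE abl hab]]]]]] := symplectic_upper T0 N0 intN D u0 v0 h0.
have D' : driven N T (fun t => -1 * u t) (fun t => 1 * v t) (fun t => -1 * h t)
    (symplectic (fun t => -1 * u t)).
  apply: (driven_imp (driven_lin (-1) 1 (-1) D)) => t _ _ _ e _ [du [dv [dh [-> -> -> [-> ->]]]]].
  by split; [ring|rewrite mulN1r normrN mul1r].
have [|||c1 [d1 [c2 [d2 [c3 [cE dE cdl hcd]]]]]] := symplectic_upper T0 N0 intN D' _ _.
- by rewrite u0 mulr0.
- by rewrite v0 mulr0.
- by rewrite h0 mulr0.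
have [f fE] := segment_poly R.
pose p := f (- c1) a1 * f d1 b1 + (f (- c1) a1 + f (- c2) a2) * f d2 b2.
have pE t : p.[t] = (- c1 + t * (a1 - - c1)) * (d1 + t * (b1 - d1)) +
    (- c1 + t * (a1 - - c1) + (- c2 + t * (a2 - - c2))) * (d2 + t * (b2 - d2)).
  by rewrite /p hornerD !hornerM hornerD !fE.
have [|t t01 pt] := @poly_interp R p (h T).
  have -> : p.[0] = - (c1 * d1 + (c1 + c2) * d2) by rewrite pE; ring.
  have -> : p.[1] = a1 * b1 + (a1 + a2) * b2 by rewrite pE; ring.
  by rewrite hab andbT lerNl -mulN1r.
have nc := norm_convex; rewrite pE in pt.
exists (- c1 + t * (a1 - - c1)), (d1 + t * (b1 - d1)), (- c2 + t * (a2 - - c2)),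
  (d2 + t * (b2 - d2)), (- c3 + t * (a3 - - c3)); split.
- have -> : u T = (1 - t) * u T + t * u T by ring.
  have {1}-> : u T = - c1 - c2 - c3 by lra.
  by rewrite -aE; ring.
- have -> : v T = (1 - t) * v T + t * v T by ring.
  have {1}-> : v T = d1 + d2 by lra.
  by rewrite -bE; ring.
- have := nc _ _ (- c1) a1 t01; have := nc _ _ d1 b1 t01; have := nc _ _ (- c2) a2 t01.
  have := nc _ _ d2 b2 t01; have := nc _ _ (- c3) a3 t01; rewrite !normrN.
  move: t01 abl cdl => /andP[t0 t1].
  move: `|c1| `|c2| `|c3| `|d1| `|d2| `|a1| `|a2| `|a3| `|b1| `|b2|.
  move=> C1 C2 C3 D1 D2 A1 A2 A3 B1 B2 abl cdl h1 h2 h3 h4 h5.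
  by nra.
- by rewrite -pt.
Qed.

End HeisenbergPlanar.

Section DrivenChange.
Variables (R : realType).

Lemma driven_linear (N : R -> \bar R) T x y z (a b c d : R) sys : driven N T x y z sys ->
  driven N T (fun t => a * x t + b * y t + 0 * z t) (fun t => c * x t + d * y t + 0 * z t) z
    (fun t du dv dz e => exists dx dy,
      [/\ du = a * dx + b * dy, dv = c * dx + d * dy & sys t dx dy dz e]).
Proof.
move=> [acx acy acz aeS]; split => //.
- by apply: acD; [apply: acD|]; exact: acZ.
- by apply: acD; [apply: acD|]; exact: acZ.
apply: (ae_impl aeS) => t S tT; have [dx [dy [dz [e [hx hy hz ? ?]]]]] := S tT.
exists (a * dx + b * dy + 0 * dz), (c * dx + d * dy + 0 * dz), dz, e.
split => //; try exact: is_derive_lin3.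
by exists dx, dy; rewrite !mul0r !addr0.
Qed.

(** Adding half of [u v] turns the antisymmetric form [(u dv - v du) / 2] of the Heisenberg group
    into [u dv]. *)
Lemma driven_shear (N : R -> \bar R) T u v z (a b : R) sys : 0 <= T -> driven N T u v z sys ->
  driven N T u v (fun t => a * z t + b * (u t * v t) + 0 * z t)
    (fun t du dv dh e => exists2 dz, dh = a * dz + b * (u t * dv + v t * du) & sys t du dv dz e).
Proof.
move=> T0 [acu acv acz aeS]; split => //.
  by apply: acD; [apply: acD|]; apply: acZ => //; exact: acM.
apply: (ae_impl aeS) => t S tT; have [du [dv [dz [e [hu hv hz ? ?]]]]] := S tT.
exists du, dv, (a * dz + b * (u t * dv + v t * du) + 0 * dz), e; split => //.
  by apply: is_derive_lin3 => //; exact: is_derive_mul.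
by exists dz; rewrite ?mul0r ?addr0.
Qed.

(** Up to scale, the rotation by 45 degrees carries the sup norm of the plane to the 1-norm, so that
    one extremal problem serves both norms. *)
Lemma max_half (a b : R) : `|2^-1 * a + 2^-1 * b| + `|- 2^-1 * a + 2^-1 * b| = Num.max `|a| `|b|.
Proof.
have n2 : `|2^-1| = 2^-1 :> R by rewrite ger0_norm.
rewrite mulNr addrC -mulrDr (addrC (- _)) -mulrBr !normrM n2 /Num.max; case: ltP => ab;
  case: (ger0P a) ab => ?; case: (ger0P b) => ?; case: (ger0P (a + b)) => ?;
  case: (ger0P (b - a)) => ?; lra.
Qed.

End DrivenChange.

Section Heisenberg.
Variables (R : realType).
Local Notation mu := (@lebesgue_measure R).
Local Notation X1 := (@heis_X1 R).
Local Notation X2 := (@heis_X2 R).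

(* Flow for unit time of a X1 + b X2, (a, b) = p, started at q. *)
Definition heis_step (q : 'rV[R]_3) (p : R * R) : 'rV[R]_3 :=
  vec3 (coord q 0 + p.1) (coord q 1 + p.2) (coord q 2 + (coord q 0 * p.2 - coord q 1 * p.1) / 2).

Lemma heis_stepE x y z a b :
  heis_step (vec3 x y z) (a, b) = vec3 (x + a) (y + b) (z + (x * b - y * a) / 2).
Proof. by rewrite /heis_step !coord_vec3. Qed.

Lemma heis_step0 q : heis_step q (0, 0) = q.
Proof. by rewrite [q]vec3_eta heis_stepE; congr vec3; ring. Qed.

Lemma heis_step_cubic x y z a b t : heis_step (vec3 x y z) (t * a, t * b) =
  vec3 (cubic x a 0 0 t) (cubic y b 0 0 t) (cubic z ((x * b - y * a) / 2) 0 0 t).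
Proof. by rewrite heis_stepE /cubic; congr vec3; ring. Qed.

Lemma heis_step_flow q (a b t : R) :
  is_derive t 1 (fun t => heis_step q (t * a, t * b))
    (a *: X1 (heis_step q (t * a, t * b)) + b *: X2 (heis_step q (t * a, t * b))).
Proof.
rewrite [q]vec3_eta; under eq_fun do rewrite heis_step_cubic.
rewrite heis_stepE /heis_X1 /heis_X2 !coord_vec3 //= !vec3Z vec3D.
apply: (is_derive_eq (is_derive_vec3 (is_derive_cubic _ _ _ _ _) (is_derive_cubic _ _ _ _ _)
  (is_derive_cubic _ _ _ _ _))).
by congr vec3; ring.
Qed.

Lemma heis_step_lip q (a b r : R) : exists L : R, forall s t : R, 0 <= s <= r -> 0 <= t <= r ->
  enorm (heis_step q (s * a, s * b) - heis_step q (t * a, t * b)) <= L * `|s - t|.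
Proof.
rewrite [q]vec3_eta; set x := coord q 0; set y := coord q 1; set z := coord q 2.
apply: (@enorm_cubic_lip _ _ _ (fun i => nth 0 [:: x; y; z] i)
  (fun i => nth 0 [:: a; b; (x * b - y * a) / 2] i) (fun=> 0) (fun=> 0)) => t.
by rewrite heis_step_cubic; apply: ord3P; rewrite mxE inordK.
Qed.

Variable nk : normkind.
Local Notation cost := (@piece_cost R nk).
Local Notation endp := (@piece_end R 2 heis_step).

Lemma heis_endp_dist s : (sf_dist X1 X2 nk 0 (endp s) <= (cost s)%:E)%E.
Proof.
apply: polygonal_dist.
by apply: (@polygonal_endp _ _ _ _ _ heis_step); [exact: heis_step0|exact: heis_step_flow|exact: heis_step_lip].
Qed.

(* Coordinates making the problem dh = u dv with speed |u'| + |v'|: (x, y) for the norm 1, and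
   ((x + y) / 2, (y - x) / 2) for the sup norm. *)
Lemma heis_steer T g (l : R) : horizontal X1 X2 T g -> g 0 = 0 ->
  (sf_length X1 X2 nk T g <= l%:E)%E ->
  exists s, [/\ size s = 5%N, endp s = g T & cost s <= l].
Proof.
move=> hg g0 gl; have T0 : 0 <= T by case: hg.
have D := @horizontal_driven3 R (fun q => - coord q 1 / 2) (fun q => coord q 0 / 2) nk T g hg.
set N := fun t => _ in D.
have N0 t : (0 <= N t)%E by exact: sf_norm_ge0.
have c0 k : coord (g 0) k = 0 by rewrite g0 /Defs.coord mxE.
case nkE: nk; last first.
  have D1 := driven_shear 1 2^-1 T0 D.
  have [| | | |m1 [n1 [m2 [n2 [m3 [uE vE le hE]]]]]] := @symplectic_steer _ N T l _ _ _ T0 N0 gl (driven_imp D1 _).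
  - move=> t dx dy dh e _ [dz -> [-> ->]]; split; first by field.
    by rewrite nkE.
  - by rewrite c0.
  - by rewrite c0.
  - by rewrite !c0 !mulr0 !addr0.
  exists [:: (m1, 0); (0, n1); (m2, 0); (0, n2); (m3, 0)]; split=> //.
    rewrite [g T]vec3_eta /piece_end /= -vec3_0 !heis_stepE.
    have -> : coord (g T) 2 = m1 * n1 + (m1 + m2) * n2 - (m1 + m2 + m3) * (n1 + n2) / 2.
      by rewrite -hE uE vE; field.
    by rewrite -uE -vE; congr vec3; field.
  rewrite !cost_cons /= cost_nil /= !normr0; lra.
have D1 := driven_linear (2^-1) (2^-1) (- 2^-1) (2^-1) D.
have D2 := driven_shear (2^-1) (2^-1) T0 D1.
have [| | | |m1 [n1 [m2 [n2 [m3 [uE vE le hE]]]]]] := @symplectic_steer _ N T l _ _ _ T0 N0 gl (driven_imp D2 _).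
- move=> t du dv dh e _ [dz -> [dx [dy [-> -> [-> ->]]]]]; split; first by field.
  rewrite nkE /=.
  have := max_half dx dy; lra.
- by rewrite !c0 !mulr0 !addr0.
- by rewrite !c0 !mulr0 !addr0.
- by rewrite !c0; ring.
(* In these coordinates [x = u - v] and [y = u + v]: a move [m] in [u] is the control [(m, m)] and a
   move [n] in [v] is [(- n, n)]. *)
exists [:: (m1, m1); (- n1, n1); (m2, m2); (- n2, n2); (m3, m3)]; split=> //.
  rewrite [g T]vec3_eta /piece_end /= -vec3_0 !heis_stepE.
  have -> : coord (g T) 2 = 2 * (m1 * n1 + (m1 + m2) * n2) - (m1 + m2 + m3) * (n1 + n2).
    by rewrite -hE uE vE; field.
  have -> : coord (g T) 0 = (m1 + m2 + m3) - (n1 + n2) by rewrite uE vE; field.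
  have -> : coord (g T) 1 = (m1 + m2 + m3) + (n1 + n2) by rewrite uE vE; field.
  by congr vec3; field.
rewrite !cost_cons /= cost_nil /= !normrN !maxxx; lra.
Qed.

(** Left invariance: concatenation of words multiplies their end points in the Heisenberg group. *)
Lemma heis_cat s2 x1 y1 z1 x2 y2 z2 : foldl heis_step 0 s2 = vec3 x2 y2 z2 ->
  foldl heis_step (vec3 x1 y1 z1) s2 = vec3 (x1 + x2) (y1 + y2) (z1 + z2 + (x1 * y2 - y1 * x2) / 2).
Proof.
elim/last_ind: s2 x2 y2 z2 => [|s [a b] IH] x2 y2 z2.
  by rewrite /= -vec3_0 => /vec3_inj[<- <- <-]; congr vec3; ring.
rewrite !foldl_rcons; have := vec3_eta (foldl heis_step 0 s).
move: (coord _ 0) (coord _ 1) (coord _ 2) => x y z E.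
rewrite E (IH _ _ _ E) !heis_stepE => /vec3_inj[<- <- <-].
by congr vec3; field.
Qed.

Lemma heis_reach q : exists s, endp s = q /\ (`|q| <= 1 -> cost s <= 7).
Proof.
rewrite [q]vec3_eta; set x := coord q 0; set y := coord q 1; set z := coord q 2.
(* What is missing from z after reaching [(x, y)]; a rectangle with sides [a] and 1 encloses this
   area. *)
pose a := z - x * y / 2.
exists [:: (x, 0); (0, y); (a, 0); (0, 1); (- a, 0); (0, -1)]; split.
  by rewrite /piece_end /= -vec3_0 !heis_stepE /a; congr vec3; field.
rewrite vec3_norm_le // => /and3P[x1 y1 z1].
rewrite !cost_cons /= cost_nil !combine_l0 !combine_0r !normrN normr1.
have : `|a| <= `|z| + `|x| * `|y| / 2.
  apply: le_trans (ler_normB _ _) _; rewrite lerD2l !normrM normfV (ger0_norm (_ : 0 <= 2)) //.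
have := normr_ge0 x; have := normr_ge0 y; nra.
Qed.

Definition heis_wt (i : 'I_3) : nat := if (i < 2)%N then 1 else 2.

Lemma heis_step_dil t q a b :
  heis_step (dil heis_wt t q) (t * a, t * b) = dil heis_wt t (heis_step q (a, b)).
Proof.
have E x y z : dil heis_wt t (vec3 x y z) = vec3 (t * x) (t * y) (t ^+ 2 * z).
  by apply/rowP; apply: ord3P; rewrite !mxE inordK // /heis_wt inordK.
by rewrite [q]vec3_eta E !heis_stepE E; congr vec3; field.
Qed.

Lemma heis_phi_step q a b :
  Num.max `|coord (heis_step q (a, b)) 0| `|coord (heis_step q (a, b)) 1| <=
  Num.max `|coord q 0| `|coord q 1| + combine nk a b.
Proof.
rewrite [q]vec3_eta heis_stepE !coord_vec3 //= ge_max.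
have := norm_combine_l nk a b; have := norm_combine_r nk a b.
have := ler_normD (coord q 0) a; have := ler_normD (coord q 1) b.
have : `|coord q 0| <= Num.max `|coord q 0| `|coord q 1| by rewrite le_max lexx.
have : `|coord q 1| <= Num.max `|coord q 0| `|coord q 1| by rewrite le_max lexx orbT.
by move=> *; apply/andP; split; lra.
Qed.

Lemma heis_ht_step c q a b : 0 <= c -> Num.max `|coord q 0| `|coord q 1| <= c ->
  Num.max `|coord (heis_step q (a, b)) 0| `|coord (heis_step q (a, b)) 1| <= c ->
  `|coord (heis_step q (a, b)) 2 - coord q 2| <= c ^+ 1 * combine nk a b.
Proof.
rewrite [q]vec3_eta heis_stepE !coord_vec3 //= !ge_max => c0 /andP[xc yc] _.
rewrite addrAC subrr add0r expr1 normrM normfV (ger0_norm (_ : 0 <= 2)) //.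
have : `|coord q 0 * b - coord q 1 * a| <= c * combine nk a b + c * combine nk a b.
  apply: le_trans (ler_normB _ _) _; rewrite !normrM.
  by apply: lerD; apply: ler_pM; rewrite ?norm_combine_l ?norm_combine_r.
lra.
Qed.

(** The pieces [(- h, - k)] at the start and [(h, k)] after [s1] cancel horizontally and add
    [k x - h y] to the last coordinate, where [(x, y)] is the position reached by [s1]. As [|x|] or
    [|y|] exceeds [c], one control of size at most [|w| / c] is enough. *)
Lemma heis_horizontal_insertion (c : R) s1 s2 (w : R) : 0 < c ->
  c < Num.max `|coord (endp s1) 0| `|coord (endp s1) 1| ->
  exists s, cost s <= cost (s1 ++ s2) + 2 * `|w| / c /\
    endp s = endp (s1 ++ s2) + vec3 0 0 w.
Proof.
move=> c0; have := vec3_eta (endp s1); have := vec3_eta (endp s2).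
move: (coord (endp s1)) (coord (endp s2)) => p1 p2 E2 E1 cp.
have C h k : cost ((- h, - k) :: s1 ++ (h, k) :: s2) = cost (s1 ++ s2) + 2 * combine nk h k.
  have -> : combine nk h k = combine nk (- h) (- k) by case: nk => /=; rewrite !normrN.
  rewrite !cost_cons !cost_cat cost_cons /=.
  have -> : combine nk h k = combine nk (- h) (- k) by case: nk => /=; rewrite !normrN.
  ring.
have P h k : endp ((- h, - k) :: s1 ++ (h, k) :: s2) = endp (s1 ++ s2) + vec3 0 0 (h * - p1 1 + k * p1 0).
  rewrite !endp_cat E1 (heis_cat _ _ _ E2) /piece_end /= foldl_cat.
  rewrite -{1}vec3_0 heis_stepE (heis_cat _ _ _ E1) /= heis_stepE (heis_cat _ _ _ E2) vec3D.
  by congr vec3; field.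
have W x : c < `|x| -> `|w / x| <= `|w| / c /\ w / x * x = w.
  move=> cx; have x0 : x != 0 by rewrite -normr_gt0 (lt_trans c0).
  split; last by rewrite divfK.
  rewrite normrM normfV ler_wpM2l // lef_pV2 ?posrE //; first exact: ltW.
  exact: lt_trans cx.
move: cp; rewrite lt_max => /orP[/W[w1 w2]|/W[w1 w2]].
  exists ((- 0, - (w / p1 0)) :: s1 ++ (0, w / p1 0) :: s2); split.
    by rewrite C combine_0r lerD2l -mulrA ler_wpM2l.
  by rewrite P; congr (_ + vec3 _ _ _); rewrite mul0r add0r.
exists ((- - (w / p1 1), - 0) :: s1 ++ (- (w / p1 1), 0) :: s2); split.
  by rewrite C combine_l0 normrN lerD2l -mulrA ler_wpM2l.
by rewrite P; congr (_ + vec3 _ _ _); rewrite mul0r addr0 mulrNN.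
Qed.

Lemma heis_lipset : lipset nk heis_step 7 [set q | `|q| = 1].
Proof.
(* A word of cost at most 8 that stays within [c] horizontally would end with height at most 8/18,
   hence off the cube boundary. The constant 74 is [2 * 2 * 18] for the correction [|w| <= 2 * d],
   plus 2 for the final moves. *)
pose c : R := 18^-1; have c0 : 0 < c by rewrite invr_gt0.
exists 74 => [//|s q' /= s1 q1 sK].
have [p0 ht0] : Num.max `|coord (0 : 'rV[R]_3) 0| `|coord (0 : 'rV[R]_3) 1| = 0 /\ coord (0 : 'rV[R]_3) 2 = 0.
  by rewrite /Defs.coord !mxE normr0 maxxx.
have [[sa [sb [sE ca]]]|[]] := large_prefix p0 ht0 heis_ht_step s (ltW c0); last first.
  rewrite expr1 ge_max => /andP[xc yc] zc; exfalso.
  move: s1; rewrite [endp s]vec3_eta => /vec3_norm1 H.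
  have : c * cost s <= 18^-1 * 8 by rewrite ler_wpM2l //; [exact: ltW|lra].
  by rewrite /c in xc yc; case: H => H; rewrite H in xc yc zc *; lra.
pose dx := coord q' 0 - coord (endp s) 0; pose dy := coord q' 1 - coord (endp s) 1.
(* The height defect that remains after the final moves [(dx, 0)] and [(0, dy)], which themselves
   change the last coordinate. *)
pose w := coord q' 2 - coord (endp s) 2 - (coord (endp s) 0 * dy - coord (endp s) 1 * dx) / 2
  - dx * dy / 2.
have [s' [s'c s'e]] := heis_horizontal_insertion sb w c0 ca.
exists (s' ++ [:: (dx, 0); (0, dy)]); split.
  rewrite endp_cat s'e -sE [endp s]vec3_eta [q']vec3_eta vec3D /= !heis_stepE /w /dx /dy.
  by congr vec3; field.
rewrite cost_cat !cost_cons /= combine_l0 combine_0r cost_nil.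
rewrite -sE in s'c; set d := `|endp s - q'|.
have cd k : `|coord (endp s) k - coord q' k| <= d.
  by have := coord_le_norm (endp s - q') (inord k); rewrite !mxE.
have c1 k : `|coord (endp s) k| <= 1 by rewrite -s1; exact: coord_le_norm.
have dxd : `|dx| <= d by rewrite distrC; exact: cd.
have dyd : `|dy| <= d by rewrite distrC; exact: cd.
have wd : `|w| <= 2 * d.
  have := cd 2; rewrite distrC; have := c1 0; have := c1 1; have q'1 : `|coord q' 0| <= 1.
    by rewrite -q1; exact: coord_le_norm.
  move=> hy hx hz.
  have -> : w = (coord q' 2 - coord (endp s) 2) + (coord (endp s) 1 * dx - coord q' 0 * dy) / 2.
    by rewrite /w /dx; field.
  apply: le_trans (ler_normD _ _) _.
  rewrite normrM normfV (ger0_norm (_ : 0 <= 2)) //.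
  have : `|coord (endp s) 1 * dx - coord q' 0 * dy| <= 1 * d + 1 * d.
    by apply: le_trans (ler_normB _ _) _; rewrite !normrM; apply: lerD; apply: ler_pM.
  lra.
move: s'c; rewrite /c invrK; lra.
Qed.

Lemma heis_cost_ge1 s : `|endp s| = 1 -> 1 <= cost s.
Proof.
have [p0 ht0] : Num.max `|coord (0 : 'rV[R]_3) 0| `|coord (0 : 'rV[R]_3) 1| = 0 /\ coord (0 : 'rV[R]_3) 2 = 0.
  by rewrite /Defs.coord !mxE normr0 maxxx.
have := phi_le_cost p0 heis_phi_step s; rewrite ge_max => /andP[xc yc].
have := ht_le_cost p0 heis_phi_step ht0 heis_ht_step s => zc.
rewrite [endp s]vec3_eta => /vec3_norm1[] H; [by rewrite -H|by rewrite -H|].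
by rewrite H in zc; have := cost_ge0 nk s; nra.
Qed.

Definition dec3 (f : nat -> R) : 'rV[R]_3 := vec3 (f 0%N) (f 1%N) (f 2%N).

Local Open Scope oterm_scope.

Definition heis_stepF (o : nat) : ord.formula R :=
  let v k := GRing.Var R (o + k) in
  ord.And (ord.Equal (v 0%N) (GRing.Add (v 6) (v 4)))
  (ord.And (ord.Equal (v 1%N) (GRing.Add (v 7) (v 5)))
   (ord.Equal (v 2) (GRing.Add (v 8) (GRing.Mul (GRing.Add (GRing.Mul (v 6) (v 5))
      (GRing.Opp (GRing.Mul (v 7) (v 4)))) (GRing.Const 2^-1))))).

Definition zero3F (o : nat) : ord.formula R :=
  let v k := GRing.Var R (o + k) in
  ord.And (ord.Equal (v 0%N) (GRing.NatConst R 0))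
  (ord.And (ord.Equal (v 1%N) (GRing.NatConst R 0)) (ord.Equal (v 2) (GRing.NatConst R 0))).

Local Close Scope oterm_scope.

Lemma heis_stepFP e o : ord.holds e (heis_stepF o) <->
  dec3 (window e o) = heis_step (dec3 (window e (o + 6))) (window e o 4, window e o 5).
Proof.
rewrite /dec3 heis_stepE /window /= -!addnA.
by split=> [[-> [-> ->]] //|/vec3_inj[-> -> ->]].
Qed.

Lemma zero3FP e o : ord.holds e (zero3F o) <-> dec3 (window e o) = 0.
Proof.
rewrite /dec3 -vec3_0 /window /=.
by split=> [[-> [-> ->]] //|/vec3_inj[-> -> ->]].
Qed.

Lemma dec3_ext f g : (forall k, (k < 3)%N -> f k = g k) -> dec3 f = dec3 g.
Proof. by move=> fg; rewrite /dec3 !fg. Qed.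

Lemma dec3_surj q : exists f, dec3 f = q.
Proof. by exists (Defs.coord q); rewrite /dec3 -vec3_eta. Qed.

Theorem heis_sphere r : 0 < r -> sphere_properties X1 X2 nk r.
Proof.
move=> r0; have reach q : exists s, endp s = q by have [s []] := heis_reach q; exists s.
rewrite /sphere_properties (sf_sphere_pdist heis_endp_dist heis_steer reach).
have cube (q : 'rV[R]_3) : `|q| <= 1 -> exists s, endp s = q /\ cost s <= 7.
  by move=> q1; have [s [sq /(_ q1)]] := heis_reach q; exists s.
have w0 i : (0 < heis_wt i)%N by rewrite /heis_wt; case: ifP.
have lip := heis_lipset; split.
- apply: (pdist_sphere_homeo reach w0 heis_step_dil heis_cost_ge1 cube _ r0).
  exact: lipset_cube_continuous.
- apply: (pdist_sphere_rectifiable reach w0 heis_step_dil heis_cost_ge1 cube _ _ r0) => //.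
  by move=> *; exact: lipset_box.
- exact: (pdist_semianalytic heis_endp_dist heis_steer reach dec3_ext dec3_surj (@dec3_env R)
    heis_stepFP zero3FP).
Qed.

End Heisenberg.

Section DrivenComposition.
Variables (R : realType).

(** A quadratic remainder identifies the derivative of functions such as [u * |u|], whose derivative
    has a corner. *)
Lemma is_derive_quadratic (F : R -> R) (x f C : R) :
  (forall y, `|F y - F x - f * (y - x)| <= C * (y - x) ^+ 2) -> is_derive x 1 F f.
Proof.
move=> H; apply/is_derive1P; apply/cvgrPdist_lt => e e0.
have C0 : 0 <= C by have := H (x + 1); rewrite (_ : x + 1 - x = 1) ?expr1n ?mulr1; [exact: le_trans|ring].
have C1 : 0 < C + 1 by lra.
near=> h.
have h0 : h != 0 by near: h; exact: nbhs_dnbhs_neq.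
have hd : `|h| < e / (C + 1) by near: h; apply: dnbhs0_lt; rewrite divr_gt0.
have -> : f - h^-1 *: (F (h *: 1 + x) - F x) = - (h^-1 * (F (h + x) - F x - f * (h + x - x))).
  by rewrite /GRing.scale /= mulr1; field.
rewrite normrN normrM normfV -ltr_pdivlMl ?invr_gt0 ?normr_gt0 // invrK.
apply: le_lt_trans (H _) _; rewrite addrK -(real_normK (num_real h)) expr2 mulrCA ltr_pM2l ?normr_gt0 //.
apply: (@le_lt_trans _ _ ((C + 1) * `|h|)); first by rewrite ler_wpM2r //; lra.
by rewrite mulrC -ltr_pdivlMr.
Unshelve. all: by end_near.
Qed.

Lemma is_derive_mul_norm (u : R) : is_derive u 1 (fun u => u * `|u|) (2 * `|u|).
Proof.
apply: (@is_derive_quadratic _ _ _ 1) => y; rewrite mul1r ler_norml.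
have := mulr_ge0 (normr_ge0 u) (normr_ge0 y); have := sqr_ge0 u; have := sqr_ge0 y.
have := sqr_ge0 (y - u).
by case: (ger0P u); case: (ger0P y) => *; apply/andP; split; nra.
Qed.

Lemma ac_norm T (f : R -> R) : ac T f -> ac T (fun t => `|f t|).
Proof.
by move=> acf; apply: (ac_dom ler01 acf) => s t _ _; rewrite mul1r ler_dist_dist.
Qed.

Lemma argmax_norm T (y : R -> R) : 0 <= T -> ac T y -> exists t0 sg : R, [/\ 0 <= t0 <= T, `|sg| = 1,
  sg * y t0 = `|y t0| & forall t, 0 <= t <= T -> `|y t| <= `|y t0|].
Proof.
move=> T0 acy; have [t0 t0T H] := ac_max T0 (ac_norm acy).
have [y0|y0] := leP 0 (y t0).
  by exists t0, 1; split; rewrite ?normr1 ?mul1r ?(ger0_norm y0) // -(ger0_norm y0).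
by exists t0, (-1); split; rewrite ?normrN ?normr1 ?mulN1r ?(ltr0_norm y0) // -(ltr0_norm y0).
Qed.

Lemma driven_comp (N : R -> \bar R) T u v h sys (F f : R -> R) : driven N T u v h sys ->
  ac T (fun t => F (u t)) -> (forall y : R, is_derive y 1 F (f y)) ->
  driven N T (fun t => F (u t)) v h
    (fun t du dv dh e => exists2 du', du = f (u t) * du' & sys t du' dv dh e).
Proof.
move=> [acu acv ach aeS] acF hF; split => //.
apply: (ae_impl aeS) => t S tT; have [du [dv [dh [e [hu hv hh ? ?]]]]] := S tT.
exists (f (u t) * du), dv, dh, e; split => //; last by exists du.
exact: (is_derive1_comp (hF (u t)) hu).
Qed.

End DrivenComposition.

(** * The Grushin plane *)

Section Grushin.
Variables (R : realType).
Local Notation mu := (@lebesgue_measure R).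
Local Notation X1 := (@grushin_X1 R).
Local Notation X2 := (@grushin_X2 R).

Definition grushin_sys nk (x : R -> R) (t dx dv dz e : R) :=
  exists2 w, dz = x t * w & e = combine nk dx w.

Section GrushinBounds.
Variables (N : R -> \bar R) (T l : R) (x v z : R -> R).
Hypotheses (T0 : 0 <= T) (N0 : forall t, (0 <= N t)%E).
Hypothesis intN : (\int[mu]_(t in [set t | (0 <= t <= T)%R]) N t <= l%:E)%E.
Hypotheses (x0 : x 0 = 0) (z0 : z 0 = 0).

Lemma grushin_final_norm nk : driven N T x v z (grushin_sys nk x) -> `|x T| <= l.
Proof.
move=> D; have C k : `|k| = 1 -> k * x T <= l.
  move=> k1; have := calib1 T0 N0 intN (@ler01 _) (@calib_lin _ _ _ _ _ _ _ 1 k 0 0 0 T D _ _ _ _).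
  rewrite /= x0 !mul0r !addr0 !mulr0 subr0 mul1r; apply => // t dx dv dz e _ [w _ ->].
  rewrite !mul0r !addr0 mul1r; apply: le_trans (norm_combine_l nk dx w).
  by apply: le_trans (ler_norm _) _; rewrite normrM k1 mul1r.
rewrite ler_norml; have := C 1; have := C (-1); rewrite normrN normr1 => /(_ erefl) h1 /(_ erefl) h2.
by apply/andP; split; lra.
Qed.

(** With [M] the maximum of [|x|], vertical motion yields at most [M] per unit of length. The
    comparison curve goes in x to the extremum [m], spends all remaining length vertically there and
    returns to [x T]; the potentials [z] and [- z], combined with [M x] of sign switching at the
    extremum, show that nothing is better. *)
Lemma grushin_upper1 : driven N T x v z (grushin_sys Norm1 x) ->
  exists m, [/\ `|m| + `|x T - m| <= l & `|z T| <= `|m| * (l - `|m| - `|x T - m|)].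
Proof.
move=> D; have [acx _ _ _] := D; have [t0 [sg [t0TT sg1 sgx Ht0]]] := argmax_norm T0 acx.
have /andP[t00 t0T] := t0TT.
have TTT : 0 <= T <= T by rewrite lexx T0.
have xTt0 := Ht0 T TTT; set M := `|x t0| in Ht0 sgx xTt0.
have M0 : 0 <= M by exact: normr_ge0.
have C c k3 : (forall t, 0 <= t <= T -> `|k3 * x t| <= c) -> 0 <= c ->
    k3 * z T + sg * c * (2 * x t0 - x T) <= c * l.
  move=> kc c0.
  have K sg' a b : `|sg'| = 1 -> 0 <= a -> b <= T ->
      calib N T c a b (fun t => (sg' * c) * x t + 0 * v t + k3 * z t).
    move=> sg'1 a0 bT; apply: (calib_lin D) => // t dx dv _ _ /andP[at_ tb] [w -> ->].
    rewrite mul0r addr0 mulrA; apply: norm1_dual; first by rewrite normrM sg'1 mul1r ger0_norm.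
    by apply: kc; rewrite (le_trans a0 at_) (le_trans tb bT).
  have := calib2 T0 N0 intN c0 t0TT (K sg _ _ sg1 _ _) (K (- sg) _ _ _ _ _).
  rewrite normrN sg1 !lexx t00 t0T x0 z0 /= => /(_ isT isT erefl isT isT); lra.
have xm : `|x T - sg * M| = M - sg * x T.
  have -> : x T - sg * M = - sg * (M - sg * x T).
    rewrite mulrBr mulNr mulrA mulNr -expr2 -(real_normK (num_real sg)) sg1 expr1n; ring.
  rewrite normrM normrN sg1 mul1r ger0_norm // subr_ge0.
  by apply: le_trans (ler_norm _) _; rewrite normrM sg1 mul1r.
exists (sg * M); rewrite normrM sg1 mul1r (ger0_norm M0) xm.
have S : sg * x t0 = M by [].
split.
  have Z t : 0 <= t <= T -> `|0 * x t| <= 1 by rewrite mul0r normr0.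
  by have := C 1 0 Z ler01; rewrite mul0r mulr1 add0r mul1r mulrBr mulrCA S; lra.
have A : sg * M * (2 * x t0 - x T) = 2 * M * (sg * x t0) - M * (sg * x T) by ring.
have P1 t : 0 <= t <= T -> `|1 * x t| <= M by rewrite mul1r; exact: Ht0.
have P2 t : 0 <= t <= T -> `|-1 * x t| <= M by rewrite mulN1r normrN; exact: Ht0.
have := C M 1 P1 M0; have := C M (-1) P2 M0.
by rewrite A S ler_norml => h1 h2; apply/andP; split; lra.
Qed.

(** The calibrations are [z] and [- z] plus [psi x] with [psi' = M - |x|], of sign switching at the
    extremum: the rate [(M - |x|) |dx| + |x| |w|] is at most [M] times the sup norm of the controls.
    The extremal value [M] is then eliminated by optimizing over it. *)
Lemma grushin_upperInf : driven N T x v z (grushin_sys NormInf x) ->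
  `|z T| <= ((l + `|x T|) / 2) ^+ 2 - x T ^+ 2 / 2.
Proof.
move=> D; have [acx _ _ _] := D; have [t0 [sg [t0TT sg1 sgx Ht0]]] := argmax_norm T0 acx.
have /andP[t00 t0T] := t0TT.
have TTT : 0 <= T <= T by rewrite lexx T0.
have xTt0 := Ht0 T TTT; set M := `|x t0| in Ht0 sgx xTt0.
have M0 : 0 <= M by exact: normr_ge0.
pose psi u : R := M * u - u * `|u| / 2.
have dpsi (u : R) : is_derive u 1 psi (M - `|u|).
  apply: (@near_eq_is_derive _ _ _ (fun u => M * u + (- 2^-1) * (u * `|u|) + 0 * u)).
    by near=> s; rewrite /psi; field.
  have := is_derive_lin3 M (- 2^-1) 0 (is_derive_id u 1) (is_derive_mul_norm u) (is_derive_id u 1).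
  by move=> H; apply: (is_derive_eq H); field.
have D1 : driven N T (fun t => psi (x t)) v z (fun t du dv dz e =>
    exists2 dx, du = (M - `|x t|) * dx & grushin_sys NormInf x t dx dv dz e).
  apply: driven_comp D _ dpsi; rewrite /psi.
  have -> : (fun t => M * x t - x t * `|x t| / 2) = (fun t => M * x t + - 2^-1 * (x t * `|x t|)).
    by apply/funext => t; field.
  by apply: acD; apply: acZ => //; apply: acM => //; exact: ac_norm.
have C k3 : `|k3| = 1 -> k3 * z T + sg * (2 * psi (x t0) - psi (x T)) <= M * l.
  move=> k31.
  have K sg' a b : `|sg'| = 1 -> 0 <= a -> b <= T ->
      calib N T M a b (fun t => sg' * psi (x t) + 0 * v t + k3 * z t).
    move=> sg'1 a0 bT; apply: (calib_lin D1) => // t du dv dz e /andP[at_ tb] [dx -> [w -> ->]].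
    have xM : `|x t| <= M by apply: Ht0; rewrite (le_trans a0 at_) (le_trans tb bT).
    rewrite mul0r addr0 /=; set m := Num.max _ _.
    have dxm : `|dx| <= m by rewrite /m le_max lexx.
    have wm : `|w| <= m by rewrite /m le_max lexx orbT.
    apply: (@le_trans _ _ ((M - `|x t|) * m + `|x t| * m)); last by rewrite -mulrDl subrK.
    apply: lerD; apply: le_trans (ler_norm _) _; rewrite !normrM ?sg'1 ?k31 !mul1r.
      by rewrite ger0_norm ?subr_ge0 // ler_wpM2l // subr_ge0.
    by rewrite ler_wpM2l.
  have := calib2 T0 N0 intN M0 t0TT (K sg _ _ sg1 _ _) (K (- sg) _ _ _ _ _).
  have psi0 : psi 0 = 0 by rewrite /psi; ring.
  rewrite normrN sg1 !lexx t00 t0T x0 z0 /= psi0 => /(_ isT isT erefl isT isT); lra.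
have psiN u : sg * psi u = psi (sg * u).
  by rewrite /psi normrM sg1; ring.
have sgT : `|sg * x T| = `|x T| by rewrite normrM sg1 mul1r.
have := C 1 (normr1 _); have := C (-1) (etrans (normrN _) (normr1 _)).
rewrite mul1r mulN1r mulrBr mulrCA !psiN sgx /psi sgT (ger0_norm M0) -(real_normK (num_real (x T))).
have u1 : sg * x T <= `|x T| by rewrite -sgT ler_norm.
have uM : `|x T| <= M by [].
have u0 := normr_ge0 (x T).
rewrite ler_norml; move: (sg * x T) `|x T| u1 uM u0 (z T) => u X u1 uM u0 Z h1 h2.
have hh : M * u - u * X / 2 <= M * X - X * X / 2.
  have : 0 <= (X - u) * (M - X / 2) by apply: mulr_ge0; lra.
  lra.
(* Completing the square in [M]: the bound [M l - M ^+ 2 + M X] is largest at [M = (l + X) / 2]. *)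
have h3 := sqr_ge0 ((l + X) / 2 - M).
by apply/andP; split; nra.
Unshelve. all: by end_near.
Qed.

End GrushinBounds.

Definition grushin_step (q : 'rV[R]_2) (p : R * R) : 'rV[R]_2 :=
  vec2 (coord q 0 + p.1) (coord q 1 + p.2 * (coord q 0 + p.1 / 2)).

Lemma grushin_stepE x z a b :
  grushin_step (vec2 x z) (a, b) = vec2 (x + a) (z + b * (x + a / 2)).
Proof. by rewrite /grushin_step !coord_vec2. Qed.

Lemma grushin_step0 q : grushin_step q (0, 0) = q.
Proof. by rewrite [q]vec2_eta grushin_stepE; congr vec2; ring. Qed.

Lemma grushin_step_cubic x z a b t : grushin_step (vec2 x z) (t * a, t * b) =
  vec2 (cubic x a 0 0 t) (cubic z (b * x) (b * a / 2) 0 t).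
Proof. by rewrite grushin_stepE /cubic; congr vec2; field. Qed.

Lemma grushin_step_flow q (a b t : R) :
  is_derive t 1 (fun t => grushin_step q (t * a, t * b))
    (a *: X1 (grushin_step q (t * a, t * b)) + b *: X2 (grushin_step q (t * a, t * b))).
Proof.
rewrite [q]vec2_eta; under eq_fun do rewrite grushin_step_cubic.
rewrite grushin_stepE /grushin_X1 /grushin_X2 !coord_vec2 //= !vec2Z vec2D.
apply: (is_derive_eq (is_derive_vec2 (is_derive_cubic _ _ _ _ _) (is_derive_cubic _ _ _ _ _))).
by congr vec2; field.
Qed.

Lemma grushin_step_lip q (a b r : R) : exists L : R, forall s t : R, 0 <= s <= r -> 0 <= t <= r ->
  enorm (grushin_step q (s * a, s * b) - grushin_step q (t * a, t * b)) <= L * `|s - t|.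
Proof.
rewrite [q]vec2_eta; set x := coord q 0; set z := coord q 1.
apply: (@enorm_cubic_lip _ _ _ (fun i => nth 0 [:: x; z] i)
  (fun i => nth 0 [:: a; b * x] i) (fun i => nth 0 [:: 0; b * a / 2] i) (fun=> 0)) => t.
by rewrite grushin_step_cubic; apply: ord2P; rewrite mxE inordK.
Qed.

Variable nk : normkind.
Local Notation cost := (@piece_cost R nk).
Local Notation endp := (@piece_end R 1 grushin_step).

Lemma grushin_endp_dist s : (sf_dist X1 X2 nk 0 (endp s) <= (cost s)%:E)%E.
Proof.
apply: polygonal_dist.
by apply: (@polygonal_endp _ _ _ _ _ grushin_step);
  [exact: grushin_step0|exact: grushin_step_flow|exact: grushin_step_lip].
Qed.

Lemma grushin_steer T g (l : R) : horizontal X1 X2 T g -> g 0 = 0 ->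
  (sf_length X1 X2 nk T g <= l%:E)%E ->
  exists s, [/\ size s = 5%N, endp s = g T & cost s <= l].
Proof.
move=> hg g0 gl; have T0 : 0 <= T by case: hg.
have D := @horizontal_driven2 R (fun q => coord q 0) nk T g hg.
set N := fun t => _ in D.
have N0 t : (0 <= N t)%E by exact: sf_norm_ge0.
have x0 : coord (g 0) 0 = 0 by rewrite g0 /Defs.coord mxE.
have z0 : coord (g 0) 1 = 0 by rewrite g0 /Defs.coord mxE.
have xl := grushin_final_norm T0 N0 gl x0 D.
case nkE: nk D; last first.
  move=> D; have [m [ml zm]] := grushin_upper1 T0 N0 gl x0 z0 D.
  (* For [m = 0] the estimate [zm] forces the last coordinate to vanish, in agreement with the
     convention that a quotient by 0 is 0. *)
  have zE : coord (g T) 1 = coord (g T) 1 / m * m.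
    have [m0|m0] := eqVneq m 0; last by rewrite divfK.
    by move: zm; rewrite m0 normr0 mul0r mulr0 normr_le0 => /eqP.
  exists [:: (m, 0); (0, coord (g T) 1 / m); (coord (g T) 0 - m, 0); (0, 0); (0, 0)]; split => //.
    rewrite [RHS]vec2_eta /piece_end /= -vec2_0 !grushin_stepE [in RHS]zE.
    by move: (coord (g T) 1 / m) => y; congr vec2; field.
  rewrite !cost_cons cost_nil !combine_l0 combine_0r /= normr0.
  have : `|coord (g T) 1 / m| <= l - `|m| - `|coord (g T) 0 - m|.
    have [m0|m0] := eqVneq m 0; first by move: ml; rewrite m0 invr0 mulr0 normr0; lra.
    by rewrite normrM normfV ler_pdivrMr ?normr_gt0 // mulrC.
  lra.
move=> D; have := grushin_upperInf T0 N0 gl x0 z0 D.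
set x := coord (g T) 0; set z := coord (g T) 1; set M := (l + `|x|) / 2.
set d := _ - _ => zd; have X0 := normr_ge0 x.
have [sg sg1 sgx] : exists2 sg : R, `|sg| = 1 & sg * `|x| = x.
  case: (ger0P x) => _; first by exists 1; rewrite ?normr1 ?mul1r.
  by exists (-1); rewrite ?normrN ?normr1 ?mulrNN ?mul1r.
have sg2 : sg * sg = 1 by rewrite -expr2 -(real_normK (num_real sg)) sg1 expr1n.
have XM : `|x| <= M by rewrite /M; lra.
have d0 : 0 <= d.
  by rewrite /d -(real_normK (num_real x)); nra.
have zE : z = z / d * d.
  have [d00|d00] := eqVneq d 0; last by rewrite divfK.
  by move: zd; rewrite d00 mulr0 normr_le0 => /eqP.
have tau1 : `|z / d| <= 1.
  have [d00|d00] := eqVneq d 0; first by rewrite d00 invr0 mulr0 normr0.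
  by rewrite normrM normfV (ger0_norm d0) ler_pdivrMr ?mul1r // lt_def d00.
(* At full slope [tau = 1] or [-1] the two pieces reach height [d] or [- d]; the height is linear in
   [tau], so scaling the second control reaches [z] at no larger cost. *)
set tau := z / d in zE tau1.
exists [:: (sg * M, tau * (sg * M)); (x - sg * M, - tau * (x - sg * M)); (0, 0); (0, 0); (0, 0)].
have xm : `|x - sg * M| = M - `|x|.
  by rewrite -{1}sgx -mulrBr normrM sg1 mul1r distrC ger0_norm // subr_ge0.
have M0 : 0 <= M by apply: le_trans XM.
split => //.
  rewrite [RHS]vec2_eta -/x -/z zE /d /piece_end /= -vec2_0 !grushin_stepE.
  have -> : (M : R) ^+ 2 = (sg * M) ^+ 2 by rewrite [RHS]exprMn [in RHS](expr2 sg) sg2 mul1r.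
  by congr vec2; field.
have sM : `|sg * M| = M by rewrite (normrM sg M) sg1 mul1r ger0_norm.
rewrite !cost_cons cost_nil /= mulNr normrN !(normrM tau) sM xm normr0 maxxx.
have m1 : `|tau| * M <= M by rewrite ler_piMl.
have m2 : `|tau| * (M - `|x|) <= M - `|x| by rewrite ler_piMl // subr_ge0.
by rewrite !max_l // /M; lra.
Qed.

(** Translations in z preserve the Grushin fields, while translations in x do not; the starting
    abscissa is therefore kept. *)
Lemma grushin_cat s2 x1 z1 x2 z2 : foldl grushin_step (vec2 x1 0) s2 = vec2 x2 z2 ->
  foldl grushin_step (vec2 x1 z1) s2 = vec2 x2 (z1 + z2).
Proof.
elim/last_ind: s2 x2 z2 => [|s [a b] IH] x2 z2.
  by rewrite /= => /vec2_inj[<- <-]; congr vec2; ring.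
rewrite !foldl_rcons; have := vec2_eta (foldl grushin_step (vec2 x1 0) s).
move: (coord _ 0) (coord _ 1) => x z E.
rewrite E (IH _ _ E) !grushin_stepE => /vec2_inj[<- <-].
by congr vec2; field.
Qed.

Lemma grushin_reach q : exists s, endp s = q /\ (`|q| <= 1 -> cost s <= 4).
Proof.
rewrite [q]vec2_eta; set x := coord q 0; set z := coord q 1.
exists [:: (1, 0); (0, z); (x - 1, 0)]; split.
  by rewrite /piece_end /= -vec2_0 !grushin_stepE; congr vec2; field.
rewrite vec2_norm_le // => /andP[x1 z1].
rewrite !cost_cons /= cost_nil !combine_l0 !combine_0r normr1.
by have := ler_normB x 1; rewrite normr1; lra.
Qed.

Definition grushin_wt (i : 'I_2) : nat := i.+1.

Lemma grushin_step_dil t q a b :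
  grushin_step (dil grushin_wt t q) (t * a, t * b) = dil grushin_wt t (grushin_step q (a, b)).
Proof.
have E x z : dil grushin_wt t (vec2 x z) = vec2 (t * x) (t ^+ 2 * z).
  by apply/rowP; apply: ord2P; rewrite !mxE inordK // /grushin_wt inordK.
by rewrite [q]vec2_eta E !grushin_stepE E; congr vec2; field.
Qed.

Lemma grushin_phi_step q a b :
  `|coord (grushin_step q (a, b)) 0| <= `|coord q 0| + combine nk a b.
Proof.
rewrite [q]vec2_eta grushin_stepE !coord_vec2 //=.
by apply: le_trans (ler_normD _ _) _; rewrite lerD2l norm_combine_l.
Qed.

Lemma grushin_ht_step c q a b : 0 <= c -> `|coord q 0| <= c ->
  `|coord (grushin_step q (a, b)) 0| <= c ->
  `|coord (grushin_step q (a, b)) 1 - coord q 1| <= c ^+ 1 * combine nk a b.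
Proof.
rewrite [q]vec2_eta grushin_stepE !coord_vec2 //= => c0 xc xac.
rewrite addrAC subrr add0r expr1 normrM mulrC.
apply: ler_pM => //; last exact: norm_combine_r.
have -> : coord q 0 + a / 2 = (coord q 0 + (coord q 0 + a)) / 2 by field.
rewrite normrM normfV (ger0_norm (_ : 0 <= 2)) //.
by have := ler_normD (coord q 0) (coord q 0 + a); lra.
Qed.

Lemma grushin_phi0 : `|coord (0 : 'rV[R]_2) 0| = 0.
Proof. by rewrite /Defs.coord !mxE normr0. Qed.

Lemma grushin_ht0 : coord (0 : 'rV[R]_2) 1 = 0.
Proof. by rewrite /Defs.coord !mxE. Qed.

Lemma grushin_lipset : lipset nk grushin_step 4 [set q | `|q| = 1].
Proof.
(* With cost at most 5, staying within [|x| <= c] would leave the height below 5/12. A vertical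
   piece at [|x| > c] corrects a defect [d] at cost [12 * d], and the final move in x adds [d]:
   hence the constant 13. *)
pose c : R := 12^-1; have c0 : 0 < c by rewrite invr_gt0.
exists 13 => [//|s q' /= s1 q1 sK].
have [[sa [sb [sE ca]]]|[xc]] :=
    large_prefix grushin_phi0 grushin_ht0 grushin_ht_step s (ltW c0); last first.
  rewrite expr1 => zc; exfalso.
  move: s1; rewrite [endp s]vec2_eta => /vec2_norm1 H.
  have : c * cost s <= 12^-1 * 5 by rewrite ler_wpM2l //; [exact: ltW|lra].
  by rewrite /c in xc; case: H => H; rewrite H in xc zc *; lra.
have := vec2_eta (endp sa); move: (coord (endp sa)) ca => p ca Ea.
have := vec2_eta (foldl grushin_step (vec2 (p 0%N) 0) sb).
move: (coord (foldl _ _ _)) => p' Eb.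
have p0 : p 0%N != 0 by rewrite -normr_gt0 (lt_trans c0).
pose dx := coord q' 0 - coord (endp s) 0; pose w := coord q' 1 - coord (endp s) 1.
exists (sa ++ (0, w / p 0%N) :: sb ++ [:: (dx, 0)]); split.
  have := vec2_eta (endp s); rewrite {1}sE endp_cat Ea (grushin_cat _ Eb) => /vec2_inj[e1 e2].
  rewrite endp_cat Ea /= foldl_cat grushin_stepE mul0r !addr0 (grushin_cat _ Eb) /= grushin_stepE.
  rewrite [q']vec2_eta /w /dx -e1 -e2.
  by congr vec2; field.
have -> : cost s = cost sa + cost sb by rewrite sE cost_cat.
rewrite cost_cat cost_cons cost_cat cost_cons cost_nil /= combine_l0 combine_0r.
set d := `|endp s - q'|.
have cd k : `|coord (endp s) k - coord q' k| <= d.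
  by have := coord_le_norm (endp s - q') (inord k); rewrite !mxE.
have dxd : `|dx| <= d by rewrite distrC; exact: cd.
have : `|w / p 0%N| <= 12 * d.
  have wd : `|w| <= d by rewrite distrC; exact: cd.
  rewrite normrM normfV mulrC; apply: ler_pM => //.
  rewrite -[12]invrK lef_pV2 ?posrE //; first exact: ltW.
  exact: lt_trans ca.
lra.
Qed.

Lemma grushin_cost_ge1 s : `|endp s| = 1 -> 1 <= cost s.
Proof.
have xc := phi_le_cost grushin_phi0 grushin_phi_step s.
have := ht_le_cost grushin_phi0 grushin_phi_step grushin_ht0 grushin_ht_step s => zc.
rewrite [endp s]vec2_eta => /vec2_norm1[] H; first by rewrite -H.
by rewrite H in zc; have := cost_ge0 nk s; nra.
Qed.

Definition dec2 (f : nat -> R) : 'rV[R]_2 := vec2 (f 0%N) (f 1%N).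

Local Open Scope oterm_scope.

Definition grushin_stepF (o : nat) : ord.formula R :=
  let v k := GRing.Var R (o + k) in
  ord.And (ord.Equal (v 0%N) (GRing.Add (v 6) (v 4)))
   (ord.Equal (v 1%N) (GRing.Add (v 7) (GRing.Mul (v 5)
      (GRing.Add (v 6) (GRing.Mul (v 4) (GRing.Const 2^-1)))))).

Definition zero2F (o : nat) : ord.formula R :=
  let v k := GRing.Var R (o + k) in
  ord.And (ord.Equal (v 0%N) (GRing.NatConst R 0)) (ord.Equal (v 1%N) (GRing.NatConst R 0)).

Local Close Scope oterm_scope.

Lemma grushin_stepFP e o : ord.holds e (grushin_stepF o) <->
  dec2 (window e o) = grushin_step (dec2 (window e (o + 6))) (window e o 4, window e o 5).
Proof.
rewrite /dec2 grushin_stepE /window /= -!addnA.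
by split=> [[-> ->] //|/vec2_inj[-> ->]].
Qed.

Lemma zero2FP e o : ord.holds e (zero2F o) <-> dec2 (window e o) = 0.
Proof.
rewrite /dec2 -vec2_0 /window /=.
by split=> [[-> ->] //|/vec2_inj[-> ->]].
Qed.

Lemma dec2_ext f g : (forall k, (k < 3)%N -> f k = g k) -> dec2 f = dec2 g.
Proof. by move=> fg; rewrite /dec2 !fg. Qed.

Lemma dec2_surj q : exists f, dec2 f = q.
Proof. by exists (Defs.coord q); rewrite /dec2 -vec2_eta. Qed.

Theorem grushin_sphere r : 0 < r -> sphere_properties X1 X2 nk r.
Proof.
move=> r0; have reach q : exists s, endp s = q by have [s []] := grushin_reach q; exists s.
rewrite /sphere_properties (sf_sphere_pdist grushin_endp_dist grushin_steer reach).
have cube (q : 'rV[R]_2) : `|q| <= 1 -> exists s, endp s = q /\ cost s <= 4.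
  by move=> q1; have [s [sq /(_ q1)]] := grushin_reach q; exists s.
have w0 i : (0 < grushin_wt i)%N by [].
have lip := grushin_lipset; split.
- apply: (pdist_sphere_homeo reach w0 grushin_step_dil grushin_cost_ge1 cube _ r0).
  exact: lipset_cube_continuous.
- apply: (pdist_sphere_rectifiable reach w0 grushin_step_dil grushin_cost_ge1 cube _ _ r0) => //.
  by move=> *; exact: lipset_box.
- exact: (pdist_semianalytic grushin_endp_dist grushin_steer reach dec2_ext dec2_surj (@dec2_env R)
    grushin_stepFP zero2FP).
Qed.

End Grushin.

(** * The Martinet structure *)

Section MartinetPrimitive.
Variables (R : realType).

(* [sqr_pos z] is max(z, 0)^2, and for v >= 0 [primitive v u] is the integral of |s^2 - v^2| for s
   from 0 to u. *)
Definition sqr_pos (z : R) := (z * z + z * `|z|) / 2.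
Definition cub_pos (v z : R) := sqr_pos z * (z / 3 + v).
Definition primitive (v u : R) :=
  v ^+ 2 * u - u * u * u / 3 + 2 * cub_pos v (u - v) - 2 * cub_pos v (- u - v).

Lemma is_derive_sqr_pos (z : R) : is_derive z 1 sqr_pos (z + `|z|).
Proof.
have H := is_derive_lin3 2^-1 2^-1 0 (is_derive_mul (is_derive_id z 1) (is_derive_id z 1))
  (is_derive_mul_norm z) (is_derive_id z 1).
have -> : sqr_pos = (fun s => 2^-1 * (s * s) + 2^-1 * (s * `|s|) + 0 * s).
  by apply/funext => s; rewrite /sqr_pos; field.
by apply: (is_derive_eq H); field.
Qed.

Lemma is_derive_cub_pos (v z : R) :
  is_derive z 1 (cub_pos v) (sqr_pos z / 3 + (z + `|z|) * (z / 3 + v)).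
Proof.
have A : is_derive z 1 (fun s : R => 3^-1 * s + v * 1 + 0 * s) (3^-1 * 1 + v * 0 + 0 * 1).
  by apply: is_derive_lin3.
have H := is_derive_mul (is_derive_sqr_pos z) A.
have -> : cub_pos v = (fun s => sqr_pos s * (3^-1 * s + v * 1 + 0 * s)).
  by apply/funext => s; rewrite /cub_pos; field.
by apply: (is_derive_eq H); field.
Qed.

Lemma is_derive_primitive (v u : R) : 0 <= v -> is_derive u 1 (primitive v) `|u ^+ 2 - v ^+ 2|.
Proof.
move=> v0.
have A (k : R) : is_derive u 1 (fun s : R => k * s + - v * 1 + 0 * s) (k * 1 + - v * 0 + 0 * 1).
  by apply: is_derive_lin3.
have P k := @is_derive1_comp R (cub_pos v) (fun s => k * s + - v * 1 + 0 * s) u _ _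
  (is_derive_cub_pos v (k * u + - v * 1 + 0 * u)) (A k).
rewrite /= in P.
have U := is_derive_id u 1.
have L := is_derive_lin3 (v ^+ 2) (- 3^-1) 0 U (is_derive_mul (is_derive_mul U U) U) U.
have H := is_derive_lin3 1 2 (-2) L (P 1) (P (-1)).
have -> : primitive v = (fun s => 1 * (v ^+ 2 * s + - 3^-1 * (s * s * s) + 0 * s) +
    2 * cub_pos v (1 * s + - v * 1 + 0 * s) + -2 * cub_pos v (-1 * s + - v * 1 + 0 * s)).
  apply/funext => s; rewrite /primitive !mul1r mulN1r !mul0r !addr0 !mulr1.
  by field.
apply: (is_derive_eq H); rewrite /= /sqr_pos.
rewrite !mul0r !mulr0 !addr0 !mulr1 !mul1r mulN1r.
have -> : u ^+ 2 - v ^+ 2 = (u - v) * (u + v) by ring.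
have -> : u + v = - (- u - v) by ring.
rewrite normrM normrN.
case: (ger0P (u - v)) => h1; case: (ger0P (- u - v)) => h2; [|by field|by field|by field].
(* Both truncations [u - v] and [- u - v] are nonnegative only when [u] and [v] vanish, because
   [v >= 0]. *)
have [-> ->] : u = 0 /\ v = 0 by split; lra.
by field.
Qed.

Lemma primitive_inner (v u : R) : 0 <= u -> u <= v -> primitive v u = v ^+ 2 * u - u ^+ 3 / 3.
Proof.
move=> u0 uv; rewrite /primitive /cub_pos /sqr_pos (ler0_norm (_ : u - v <= 0)) ?subr_le0 //.
rewrite (ler0_norm (_ : - u - v <= 0)); last by lra.
by field.
Qed.

Lemma primitive_outer (v u : R) : 0 <= v -> v <= u ->
  primitive v u = u ^+ 3 / 3 - v ^+ 2 * u + 4 * v ^+ 3 / 3.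
Proof.
move=> u0 uv; rewrite /primitive /cub_pos /sqr_pos (ger0_norm (_ : 0 <= u - v)) ?subr_ge0 //.
rewrite (ler0_norm (_ : - u - v <= 0)); last by lra.
by field.
Qed.

Lemma primitiveN (v u : R) : primitive v (- u) = - primitive v u.
Proof. by rewrite /primitive opprK; ring. Qed.

(** The integrand [|s ^+ 2 - v ^+ 2|] is at most [c] on [[0, M]]; the proof works with the closed
    forms of the integral on either side of [v]. *)
Lemma primitive_le (v c M u : R) : 0 <= v -> v ^+ 2 <= c -> M ^+ 2 - v ^+ 2 <= c -> 0 <= u -> u <= M ->
  primitive v u <= c * u.
Proof.
move=> v0 vc Mc u0 uM; have [uv|/ltW vu] := leP u v.
  rewrite primitive_inner //; have : 0 <= u ^+ 3 by rewrite exprn_ge0.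
  have : v ^+ 2 * u <= c * u by rewrite ler_wpM2r.
  lra.
rewrite primitive_outer //.
have uc : u ^+ 2 - v ^+ 2 <= c by nra.
have [h|h] := leP (2 * v ^+ 2) (u ^+ 2).
  have : 0 <= (c - (u ^+ 2 - v ^+ 2)) * u by apply: mulr_ge0; lra.
  have : 0 <= (u ^+ 2 - 2 * v ^+ 2) * u by apply: mulr_ge0; lra.
  have : 0 <= (u - v) * v ^+ 2 by apply: mulr_ge0; [lra|exact: sqr_ge0].
  by nra.
have : 0 <= (c - v ^+ 2) * u by apply: mulr_ge0; lra.
have : 0 <= (2 * v ^+ 2 - u ^+ 2) * u by apply: mulr_ge0; lra.
have : 0 <= (u - v) * v ^+ 2 by apply: mulr_ge0; [lra|exact: sqr_ge0].
by nra.
Qed.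

Lemma ac_primitive T v (f : R -> R) : 0 <= T -> ac T f -> ac T (fun t => primitive v (f t)).
Proof.
move=> T0 acf.
have sq g : ac T g -> ac T (fun t => sqr_pos (g t)).
  move=> acg; rewrite /sqr_pos.
  under eq_fun do rewrite mulrC.
  apply: (@acZ _ T 2^-1 (fun t => g t * g t + g t * `|g t|)).
  by apply: acD; apply: acM => //; exact: ac_norm.
have cst (k : R) : ac T (fun=> k).
  by move=> e e0; exists 1 => // n a b _ _; rewrite big1 // => i _; rewrite subrr normr0.
have cu g : ac T g -> ac T (fun t => cub_pos v (g t)).
  move=> acg; rewrite /cub_pos; apply: acM => //; first exact: sq.
  apply: (@acD _ T (fun t => g t / 3)) => //; under eq_fun do rewrite mulrC.
  exact: (@acZ _ T 3^-1 g).
rewrite /primitive; apply: acD; [apply: acD; [apply: acD|]|].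
- exact: acZ.
- apply: acN; under eq_fun do rewrite mulrC.
  by apply: (@acZ _ T 3^-1 (fun t => f t * f t * f t)); apply: acM => //; exact: acM.
- by apply: acZ; apply: cu; apply: acD.
- by apply: acN; apply: acZ; apply: cu; apply: acD => //; exact: acN.
Qed.

End MartinetPrimitive.

(** * Optimal parameters for the Martinet structure with the sup norm *)

Section MartinetOptimum.
Variables (R : realType).

(** The map from [v] to [v + max v eta] is increasing and piecewise linear, with a break at [eta];
    it is inverted on each side of the break. *)
Lemma solve_add_max (eta k lo hi : R) : lo + Num.max lo eta <= k -> k <= hi + Num.max hi eta ->
  exists v, [/\ lo <= v, v <= hi & v + Num.max v eta = k].
Proof.
move=> lok khi; have m1 : lo <= Num.max lo eta by rewrite le_max lexx.
have m2 : eta <= Num.max lo eta by rewrite le_max lexx orbT.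
have [h|h] := leP (2 * eta) k; [exists (k / 2)|exists (k - eta)].
  rewrite max_l; last by lra.
  by move: khi; have [ehi|ehi] := leP eta hi => khi; split; lra.
rewrite max_r; last by lra.
by move: khi; have [ehi|ehi] := leP eta hi => khi; split; lra.
Qed.

(* The optimal curve spends a0 = -(r - 2 M + eta) at y = 0, then moves monotonically in y from 0 to
   M and back to eta at full speed, x decreasing while |y| < v and increasing while |y| > v; it
   attains the calibration bound for the parameter v.  As x increases, first v decreases from M0 to
   M0 / sqrt 2 with M = M0, then M increases to its largest value (r + eta) / 2, and finally v
   decreases to 0. *)
Lemma martinet_optimum (r M0 eta x z : R) : 0 <= eta -> eta <= M0 -> - r <= x -> x <= r ->
  2 * M0 - eta <= r ->
  (forall v c, 0 <= v -> v <= M0 -> v ^+ 2 <= c -> M0 ^+ 2 - v ^+ 2 <= c ->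
     z <= v ^+ 2 * x + c * (r - 2 * M0 + eta) + 2 * primitive v M0 - primitive v eta) ->
  exists v M, [/\ 0 <= v, v <= M, eta <= M, 2 * M - eta <= r &
    4 * M - 2 * (v + Num.max v eta) - r = x /\
    z <= (2 * M ^+ 3 - 2 * v ^+ 3 - 2 * Num.max v eta ^+ 3 + eta ^+ 3) / 3].
Proof.
move=> eta0 etaM xr1 xr2 Mr H; have M00 : 0 <= M0 by lra.
(* Compares the calibration at the given maximum [M0] with the curve that rises to some [M >= M0];
   the tangent inequality [cube] at [M0] accounts for the difference, and [cc] is the part that
   depends on the regime. *)
have value v M c : 0 <= v -> v <= M0 -> M0 <= M -> v ^+ 2 <= c -> M0 ^+ 2 - v ^+ 2 <= c ->
    4 * M - 2 * (v + Num.max v eta) - r = x ->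
    c * (r - 2 * M0 + eta) <= v ^+ 2 * (r - 2 * M + eta) + 2 * (M - M0) * (M0 ^+ 2 - v ^+ 2) ->
    z <= (2 * M ^+ 3 - 2 * v ^+ 3 - 2 * Num.max v eta ^+ 3 + eta ^+ 3) / 3.
  move=> v0 vM0 M0M vc Mc xE cc; apply: le_trans (H v c v0 vM0 vc Mc) _.
  have cube : 3 * M0 ^+ 2 * (M - M0) <= M ^+ 3 - M0 ^+ 3.
    have : 0 <= (M - M0) ^+ 2 * (M + 2 * M0) by apply: mulr_ge0; [exact: sqr_ge0|lra].
    lra.
  rewrite (primitive_outer v0 vM0) -xE; have [ev|/ltW ve] := leP eta v.
    rewrite primitive_inner //; lra.
  rewrite primitive_outer //; lra.
(* At [v = vs] the two lower bounds [v ^+ 2] and [M0 ^+ 2 - v ^+ 2] for [c] coincide. *)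
pose vs := Num.sqrt (M0 ^+ 2 / 2).
have vs2 : vs ^+ 2 = M0 ^+ 2 / 2 by rewrite sqr_sqrtr // divr_ge0 // sqr_ge0.
have vs0 : 0 <= vs by exact: sqrtr_ge0.
have vsM : vs <= M0 by nra.
(* The largest height from which a word of length [r] can still return to [eta]. *)
pose Mm := (r + eta) / 2; pose ms := Num.max vs eta.
have M0m : M0 <= Mm by rewrite /Mm; lra.
have msM : ms <= M0 by rewrite /ms ge_max vsM.
(* First regime: [M = M0], with [v >= vs] and [c = v ^+ 2]. *)
have [xI|xI] := leP x (4 * M0 - 2 * (vs + ms) - r).
  have [||v [v1 v2 vE]] := @solve_add_max eta ((4 * M0 - r - x) / 2) vs M0.
  - by rewrite -/ms; lra.
  - by rewrite max_l //; lra.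
  have v0 : 0 <= v by lra.
  exists v, M0; rewrite vE; split => //; split; first by field.
  apply: (value v M0 (v ^+ 2)) => //; first by nra.
  - by rewrite vE; field.
  - by rewrite subrr mulr0 mul0r addr0.
(* Second regime: [v = vs], and [M] is solved from the linear relation for [x]. *)
have [xII|xII] := leP x (4 * Mm - 2 * (vs + ms) - r).
  pose M := (x + r + 2 * (vs + ms)) / 4.
  have M0M : M0 <= M by rewrite /M; lra.
  have xE : 4 * M - 2 * (vs + Num.max vs eta) - r = x by rewrite -/ms /M; field.
  have MMm : M <= Mm by rewrite /M; lra.
  exists vs, M; split => //; [lra|lra|by rewrite /Mm in MMm; lra|split => //].
  apply: (value vs M (vs ^+ 2)) => //; first by lra.
  by rewrite vs2; lra.
(* Third regime: [M = Mm], with [v <= vs] and [c = M0 ^+ 2 - v ^+ 2]. *)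
have [||v [v1 v2 vE]] := @solve_add_max eta ((4 * Mm - r - x) / 2) 0 vs.
- by rewrite max_r // /Mm; lra.
- by rewrite -/ms; lra.
exists v, Mm; rewrite vE; split => //; [lra|lra|by rewrite /Mm; lra|split; first by field].
have v22 : v ^+ 2 <= vs ^+ 2 by nra.
apply: (value v Mm (M0 ^+ 2 - v ^+ 2)) => //; [lra|lra|by rewrite vE; field|].
have -> : r = 2 * Mm - eta by rewrite /Mm; field.
lra.
Qed.

End MartinetOptimum.

Section MartinetSteering.
Variables (R : realType).
Local Notation mu := (@lebesgue_measure R).
Local Notation X1 := (@martinet_X1 R).
Local Notation X2 := (@martinet_X2 R).

Definition martinet_sys nk (y : R -> R) (t dx dy dz e : R) :=
  dz = dx * y t ^+ 2 /\ e = combine nk dx dy.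

(* The z-coordinate reached from the origin by five pieces (a_i, b_i). *)
Definition martinet_value (a1 b1 a2 b2 a3 b3 a4 b4 a5 b5 : R) :=
  a1 * (b1 ^+ 2 / 3) + a2 * (b1 ^+ 2 + b1 * b2 + b2 ^+ 2 / 3) +
  a3 * ((b1 + b2) ^+ 2 + (b1 + b2) * b3 + b3 ^+ 2 / 3) +
  a4 * ((b1 + b2 + b3) ^+ 2 + (b1 + b2 + b3) * b4 + b4 ^+ 2 / 3) +
  a5 * ((b1 + b2 + b3 + b4) ^+ 2 + (b1 + b2 + b3 + b4) * b5 + b5 ^+ 2 / 3).

Section MartinetBounds.
Variables (N : R -> \bar R) (T l : R).
Hypotheses (T0 : 0 <= T) (N0 : forall t, (0 <= N t)%E).
Hypothesis intN : (\int[mu]_(t in [set t | (0 <= t <= T)%R]) N t <= l%:E)%E.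

(** Motion in x has no effect on z at height 0 and the largest effect [M ^+ 2] at the extreme
    height. After paying for y, the budget [a] is best split into a backward move [(a - x T) / 2] at
    height 0 and a forward move [(a + x T) / 2] at the extremum. Subtracting [M ^+ 2 / 2] centres
    [y ^+ 2], which gives the calibration constant [M ^+ 2 / 2]. *)
Lemma martinet_upper1 x y z : driven N T x y z (martinet_sys Norm1 y) ->
  x 0 = 0 -> y 0 = 0 -> z 0 = 0 -> exists a1 b1 a2 b2 a3 b3 a4 b4 a5 b5 : R,
  [/\ a1 + a2 + a3 + a4 + a5 = x T, b1 + b2 + b3 + b4 + b5 = y T,
    combine Norm1 a1 b1 + combine Norm1 a2 b2 + combine Norm1 a3 b3 + combine Norm1 a4 b4 +
      combine Norm1 a5 b5 <= l &
    z T <= martinet_value a1 b1 a2 b2 a3 b3 a4 b4 a5 b5].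
Proof.
move=> D x0 y0 z0; have [_ acy _ _] := D; have [t0 [sg [t0TT sg1 sgy Ht0]]] := argmax_norm T0 acy.
have /andP[t00 t0T] := t0TT.
have TTT : 0 <= T <= T by rewrite lexx T0.
have yTt0 := Ht0 T TTT; set M := `|y t0| in Ht0 sgy yTt0.
have M0 : 0 <= M by exact: normr_ge0.
have C c k1 k3 : (forall t, 0 <= t <= T -> `|k1 + k3 * y t ^+ 2| <= c) -> 0 <= c ->
    k1 * x T + k3 * z T + c * (2 * M - sg * y T) <= c * l.
  move=> kc c0.
  have K sg' a b : `|sg'| = 1 -> 0 <= a -> b <= T ->
      calib N T c a b (fun t => k1 * x t + (sg' * c) * y t + k3 * z t).
    move=> sg'1 a0 bT; apply: (calib_lin D) => // t dx dy _ _ /andP[at_ tb] [-> ->].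
    have -> : k1 * dx + sg' * c * dy + k3 * (dx * y t ^+ 2) =
      (k1 + k3 * y t ^+ 2) * dx + sg' * c * dy by ring.
    apply: norm1_dual; last by rewrite normrM sg'1 mul1r ger0_norm.
    by apply: kc; rewrite (le_trans a0 at_) (le_trans tb bT).
  have := calib2 T0 N0 intN c0 t0TT (K sg _ _ sg1 _ _) (K (- sg) _ _ _ _ _).
  rewrite normrN sg1 !lexx t00 t0T x0 y0 z0 /= -sgy => /(_ isT isT erefl isT isT); lra.
have sgT : sg * y T <= M by apply: le_trans (ler_norm _) _; rewrite normrM sg1 mul1r.
have sg2 : sg * sg = 1 by rewrite -expr2 -(real_normK (num_real sg)) sg1 expr1n.
have ym : `|y T - sg * M| = M - sg * y T.
  have -> : y T - sg * M = - sg * (M - sg * y T).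
    by rewrite mulrBr mulNr mulrA mulNr sg2; ring.
  by rewrite (normrM (- sg)) normrN sg1 mul1r ger0_norm // subr_ge0.
pose a := l - 2 * M + sg * y T.
have Z k t : `|k| = 1 -> 0 <= t <= T -> `|k + 0 * y t ^+ 2| <= 1 by rewrite mul0r addr0 => ->.
have h1 := C 1 1 0 (fun t => Z 1 t (normr1 _)) ler01.
have h2 := C 1 (-1) 0 (fun t => Z (-1) t (etrans (normrN _) (normr1 _))) ler01.
have hz : z T <= M ^+ 2 * ((a + x T) / 2).
  have P t : 0 <= t <= T -> `|- (M ^+ 2 / 2) + 1 * y t ^+ 2| <= M ^+ 2 / 2.
    move=> tT; have : y t ^+ 2 <= M ^+ 2.
      by rewrite -(real_normK (num_real (y t))) ler_pXn2r // ?nnegrE //; exact: Ht0.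
    by have := sqr_ge0 (y t); rewrite ler_norml => *; apply/andP; split; lra.
  have := C _ _ _ P (divr_ge0 (sqr_ge0 M) (ler0n _ 2)); rewrite /a; lra.
exists (- ((a - x T) / 2)), 0, 0, (sg * M), ((a + x T) / 2), 0, 0, (y T - sg * M), 0, 0; split.
- by field.
- by ring.
- rewrite /= !normr0 normrN ym (normrM sg) sg1 mul1r (ger0_norm M0) !ger0_norm /a; lra.
apply: le_trans hz _; rewrite /martinet_value le_eqVlt; apply/orP; left; apply/eqP.
have -> : M ^+ 2 = (sg * M) ^+ 2 by rewrite [RHS]exprMn [in RHS](expr2 sg) sg2 mul1r.
by field.
Qed.

Lemma martinet_final_norm x y z : driven N T x y z (martinet_sys NormInf y) ->
  x 0 = 0 -> `|x T| <= l.
Proof.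
move=> D x0; have C k : `|k| = 1 -> k * x T <= l.
  move=> k1; have := calib1 T0 N0 intN (@ler01 _) (@calib_lin _ _ _ _ _ _ _ 1 k 0 0 0 T D _ _ _ _).
  rewrite /= x0 !mul0r !addr0 !mulr0 subr0 mul1r; apply => // t dx dy dz e _ [_ ->].
  rewrite !mul0r !addr0 mul1r; apply: le_trans (norm_combine_l NormInf dx dy).
  by apply: le_trans (ler_norm _) _; rewrite normrM k1 mul1r.
rewrite ler_norml; have := C 1; have := C (-1); rewrite normrN normr1 => /(_ erefl) h1 /(_ erefl) h2.
by apply/andP; split; lra.
Qed.

(** The function [z - v ^+ 2 x] changes at rate [(y ^+ 2 - v ^+ 2) dx]. Adding or subtracting
    [psi y], where [psi' = c - |y ^+ 2 - v ^+ 2| >= 0], keeps the total rate below [c] times the sup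
    norm; the sign switches when [|y|] is largest. *)
Lemma martinet_calibrated x y z t0 (sg v c : R) : driven N T x y z (martinet_sys NormInf y) ->
  x 0 = 0 -> y 0 = 0 -> z 0 = 0 -> 0 <= t0 <= T -> `|sg| = 1 -> sg * y t0 = `|y t0| ->
  (forall t, 0 <= t <= T -> `|y t| <= `|y t0|) -> 0 <= v -> v ^+ 2 <= c -> `|y t0| ^+ 2 - v ^+ 2 <= c ->
  z T <= v ^+ 2 * x T + c * (l - 2 * `|y t0| + `|y T|) + 2 * primitive v `|y t0| - primitive v `|y T|.
Proof.
move=> D x0 y0 z0 t0TT sg1 sgy Ht0 v0 vc Mc; have /andP[t00 t0T] := t0TT.
have [_ acy _ _] := D.
have TTT : 0 <= T <= T by rewrite lexx T0.
have yTt0 := Ht0 T TTT; set M := `|y t0| in Ht0 sgy yTt0 Mc *.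
have c0 : 0 <= c by apply: le_trans vc; exact: sqr_ge0.
pose psi u : R := c * u - primitive v u.
have dpsi (u : R) : is_derive u 1 psi (c - `|u ^+ 2 - v ^+ 2|).
  have H := is_derive_lin3 c (-1) 0 (is_derive_id u 1) (is_derive_primitive u v0) (is_derive_id u 1).
  have -> : psi = (fun s => c * s + -1 * primitive v s + 0 * s).
    by apply/funext => s; rewrite /psi; ring.
  by apply: (is_derive_eq H); ring.
have D0 : driven N T y x z (fun t dy dx dz e => martinet_sys NormInf y t dx dy dz e).
  have [acx _ acz aeS] := D; split => //; apply: (ae_impl aeS) => t S tT.
  by have [dx [dy [dz [e [? ? ? ? ?]]]]] := S tT; exists dy, dx, dz, e.
have D1 := driven_comp D0 (F := psi) _ dpsi.
have C : z T - v ^+ 2 * x T + sg * (2 * psi (y t0) - psi (y T)) <= c * l.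
  have K sg' a b : `|sg'| = 1 -> 0 <= a -> b <= T ->
      calib N T c a b (fun t => sg' * psi (y t) + - v ^+ 2 * x t + 1 * z t).
    move=> sg'1 a0 bT; apply: (calib_lin (D1 _)) => //.
      rewrite /psi; apply: acD; first exact: acZ.
      by apply: acN; exact: ac_primitive.
    move=> t du dx dz e /andP[at_ tb] [dy -> [-> ->]].
    have yM : `|y t| <= M by apply: Ht0; rewrite (le_trans a0 at_) (le_trans tb bT).
    rewrite /=; set m := Num.max _ _.
    have dxm : `|dx| <= m by rewrite /m le_max lexx.
    have dym : `|dy| <= m by rewrite /m le_max lexx orbT.
    have kc : `|y t ^+ 2 - v ^+ 2| <= c.
      have : y t ^+ 2 <= M ^+ 2.
        by rewrite -(real_normK (num_real (y t))) ler_pXn2r // nnegrE // (le_trans _ yM).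
      by have := sqr_ge0 (y t); rewrite ler_norml => *; apply/andP; split; lra.
    have -> : sg' * ((c - `|y t ^+ 2 - v ^+ 2|) * dy) + - v ^+ 2 * dx + 1 * (dx * y t ^+ 2) =
      sg' * ((c - `|y t ^+ 2 - v ^+ 2|) * dy) + (y t ^+ 2 - v ^+ 2) * dx by ring.
    apply: (@le_trans _ _ ((c - `|y t ^+ 2 - v ^+ 2|) * m + `|y t ^+ 2 - v ^+ 2| * m)); last first.
      by rewrite -mulrDl subrK.
    apply: lerD; apply: le_trans (ler_norm _) _; rewrite normrM ?sg'1 ?mul1r.
      by rewrite normrM ger0_norm ?subr_ge0 // ler_wpM2l // subr_ge0.
    by rewrite ler_wpM2l.
  have := calib2 T0 N0 intN c0 t0TT (K sg _ _ sg1 _ _) (K (- sg) _ _ _ _ _).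
  have psi0 : psi 0 = 0.
    by have := primitiveN v 0; rewrite /psi oppr0 mulr0; lra.
  rewrite normrN sg1 !lexx t00 t0T x0 y0 z0 /= psi0 => /(_ isT isT erefl isT isT); lra.
have psiN u : psi (- u) = - psi u by rewrite /psi primitiveN; ring.
have M0 : 0 <= M by exact: normr_ge0.
(* Since [psi] is odd, nonnegativity at [|y T|] allows the unknown sign of [sg * y T] to be replaced
   by the worst one. *)
have psiT0 : 0 <= psi `|y T|.
  by rewrite subr_ge0; apply: (@primitive_le _ v c M) => //; exact: normr_ge0.
have sgpsi u : sg * psi u = psi (sg * u).
  have [->|->] : sg = 1 \/ sg = -1.
    by move: sg1; case: (ger0P sg) => _ => [|/eqP]; [left|rewrite eqr_oppLR => /eqP; right].
    by rewrite !mul1r.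
  by rewrite !mulN1r psiN.
have le_psi : sg * psi (y T) <= psi `|y T|.
  rewrite sgpsi; have /orP[/eqP <-|/eqP ->] : (`|y T| == sg * y T) || (sg * y T == - `|y T|).
  - have : `|sg * y T| = `|y T| by rewrite normrM sg1 mul1r.
    by case: (ger0P (sg * y T)) => _ <-; rewrite ?eqxx ?opprK ?eqxx ?orbT.
  - exact: lexx.
  by rewrite psiN; lra.
move: C le_psi; rewrite mulrBr mulrCA !sgpsi sgy /psi; lra.
Qed.

Lemma martinet_upperInf x y z : driven N T x y z (martinet_sys NormInf y) ->
  x 0 = 0 -> y 0 = 0 -> z 0 = 0 -> exists a1 b1 a2 b2 a3 b3 a4 b4 a5 b5 : R,
  [/\ a1 + a2 + a3 + a4 + a5 = x T, b1 + b2 + b3 + b4 + b5 = y T,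
    combine NormInf a1 b1 + combine NormInf a2 b2 + combine NormInf a3 b3 + combine NormInf a4 b4 +
      combine NormInf a5 b5 <= l &
    z T <= martinet_value a1 b1 a2 b2 a3 b3 a4 b4 a5 b5].
Proof.
move=> D x0 y0 z0; have [_ acy _ _] := D; have [t0 [sg [t0TT sg1 sgy Ht0]]] := argmax_norm T0 acy.
have /andP[t00 t0T] := t0TT.
have TTT : 0 <= T <= T by rewrite lexx T0.
have yTt0 := Ht0 T TTT.
have := martinet_final_norm D x0; rewrite ler_norml => /andP[xl1 xl2].
have Ml : 2 * `|y t0| - `|y T| <= l.
  have K sg' a b : `|sg'| = 1 -> 0 <= a -> b <= T ->
      calib N T 1 a b (fun t => 0 * x t + sg' * y t + 0 * z t).
    move=> sg'1 a0 bT; apply: (calib_lin D) => // t dx dy dz e _ [_ ->].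
    rewrite !mul0r add0r addr0 mul1r; apply: le_trans (norm_combine_r NormInf dx dy).
    by apply: le_trans (ler_norm _) _; rewrite normrM sg'1 mul1r.
  have := calib2 T0 N0 intN ler01 t0TT (K sg _ _ sg1 _ _) (K (- sg) _ _ _ _ _).
  rewrite normrN sg1 !lexx t00 t0T y0 /= => /(_ isT isT erefl isT isT).
  have : sg * y T <= `|y T| by apply: le_trans (ler_norm _) _; rewrite normrM sg1 mul1r.
  by rewrite -sgy; lra.
have [|v [M [v0 vM eM Mr [xE zle]]]] :=
    @martinet_optimum R l `|y t0| `|y T| (x T) (z T) (normr_ge0 _) yTt0 xl1 xl2 Ml.
  by move=> v c v0 _ vc Mc; exact: (martinet_calibrated D x0 y0 z0 t0TT sg1 sgy Ht0).
have [e e1 yE] : exists2 e : R, e * e = 1 & y T = e * `|y T|.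
  case: (ger0P (y T)) => _; first by exists 1; rewrite !mul1r.
  by exists (-1); rewrite mulrNN ?mul1r // mulrNN.
have en : `|e| = 1.
  by have := congr1 Num.norm e1; rewrite normrM normr1 => /eqP; rewrite -expr2 sqrp_eq1 // => /eqP.
set eta := `|y T| in xE zle yE eM Mr *; set m := Num.max v eta in xE zle.
have eta0 : 0 <= eta by exact: normr_ge0.
have mM : m <= M by rewrite /m ge_max vM eM.
have vm : v <= m by rewrite /m le_max lexx.
have em : eta <= m by rewrite /m le_max lexx orbT.
(* Backward at height 0, then y from 0 to [v] with x decreasing, [v] to [M] and back to [m] with x
   increasing, and [m] to [eta] with x decreasing. Since [m] is the maximum of [v] and [eta], the
   last piece is trivial when [eta >= v]. The costs add up to [l]. *)
exists (- (l - 2 * M + eta)), 0, (- v), (e * v), (M - v), (e * (M - v)), (M - m), (- (e * (M - m))),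
  (- (m - eta)), (- (e * (m - eta))); split.
- by rewrite -xE; ring.
- by rewrite yE; ring.
- rewrite /= !normrN !(normrM e) en !mul1r normr0 (max_l (normr_ge0 _)) !maxxx.
  by rewrite !ger0_norm; lra.
apply: le_trans zle _; rewrite /martinet_value le_eqVlt; apply/orP; left; apply/eqP.
have e2 : e ^+ 2 = 1 by [].
have -> : 2 * M ^+ 3 - 2 * v ^+ 3 - 2 * m ^+ 3 + eta ^+ 3 =
  e ^+ 2 * (2 * M ^+ 3 - 2 * v ^+ 3 - 2 * m ^+ 3 + eta ^+ 3) by rewrite e2 mul1r.
by field.
Qed.

End MartinetBounds.
End MartinetSteering.

Section MartinetSphere.
Variables (R : realType).
Local Notation mu := (@lebesgue_measure R).
Local Notation X1 := (@martinet_X1 R).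
Local Notation X2 := (@martinet_X2 R).

(** The reflection [(x, y, z)] to [(- x, y, - z)] supplies the opposite bound on z, and the segment
    between the two words supplies a word with the exact end point. *)
Lemma martinet_scalar_steer (N : R -> \bar R) T l nk x y z :
  0 <= T -> (forall t, 0 <= N t)%E -> (\int[mu]_(t in [set t | (0 <= t <= T)%R]) N t <= l%:E)%E ->
  driven N T x y z (martinet_sys nk y) -> x 0 = 0 -> y 0 = 0 -> z 0 = 0 ->
  exists a1 b1 a2 b2 a3 b3 a4 b4 a5 b5 : R,
  [/\ a1 + a2 + a3 + a4 + a5 = x T, b1 + b2 + b3 + b4 + b5 = y T,
    combine nk a1 b1 + combine nk a2 b2 + combine nk a3 b3 + combine nk a4 b4 +
      combine nk a5 b5 <= l &
    z T = martinet_value a1 b1 a2 b2 a3 b3 a4 b4 a5 b5].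
Proof.
move=> T0 N0 intN D x0 y0 z0.
have upper x' z' : driven N T x' y z' (martinet_sys nk y) -> x' 0 = 0 -> z' 0 = 0 ->
    exists a1 b1 a2 b2 a3 b3 a4 b4 a5 b5 : R,
    [/\ a1 + a2 + a3 + a4 + a5 = x' T, b1 + b2 + b3 + b4 + b5 = y T,
      combine nk a1 b1 + combine nk a2 b2 + combine nk a3 b3 + combine nk a4 b4 +
        combine nk a5 b5 <= l &
      z' T <= martinet_value a1 b1 a2 b2 a3 b3 a4 b4 a5 b5].
  by case: nk {D} => D ? ?; [exact: martinet_upperInf|exact: martinet_upper1].
have [a1 [b1 [a2 [b2 [a3 [b3 [a4 [b4 [a5 [b5 [aE bE cl zle]]]]]]]]]]] := upper x z D x0 z0.
have D' : driven N T (fun t => -1 * x t) y (fun t => -1 * z t) (martinet_sys nk y).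
  have [_ acy _ _] := D; have [ac1 _ ac3 aeS] := driven_lin (-1) 1 (-1) D; split => //.
  have [_ _ _ aeD] := D; apply: (ae_impl (ae_and aeD aeS)) => t [SD _] tT.
  have [dx [dy [dz [e [hx hy hz [dzE eE] eN]]]]] := SD tT.
  exists (-1 * dx), dy, (-1 * dz), e; split => //; try exact: is_deriveZ.
  by split; [rewrite dzE; ring|rewrite eE mulN1r; case: (nk) => /=; rewrite normrN].
have [||c1 [d1 [c2 [d2 [c3 [d3 [c4 [d4 [c5 [d5 [cE dE dl zge]]]]]]]]]]] := upper _ _ D'.
- by rewrite x0 mulr0.
- by rewrite z0 mulr0.
have [f fE] := segment_poly R.
pose q := (3^-1)%:P : {poly R}.
pose A1 := f (- c1) a1; pose A2 := f (- c2) a2; pose A3 := f (- c3) a3; pose A4 := f (- c4) a4.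
pose A5 := f (- c5) a5.
pose B1 := f d1 b1; pose B2 := f d2 b2; pose B3 := f d3 b3; pose B4 := f d4 b4; pose B5 := f d5 b5.
pose p : {poly R} := A1 * (B1 ^+ 2 * q) + A2 * (B1 ^+ 2 + B1 * B2 + B2 ^+ 2 * q) +
  A3 * ((B1 + B2) ^+ 2 + (B1 + B2) * B3 + B3 ^+ 2 * q) +
  A4 * ((B1 + B2 + B3) ^+ 2 + (B1 + B2 + B3) * B4 + B4 ^+ 2 * q) +
  A5 * ((B1 + B2 + B3 + B4) ^+ 2 + (B1 + B2 + B3 + B4) * B5 + B5 ^+ 2 * q).
have pE t : p.[t] = martinet_value A1.[t] B1.[t] A2.[t] B2.[t] A3.[t] B3.[t] A4.[t] B4.[t] A5.[t] B5.[t].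
  by rewrite /p /q !(hornerD, hornerM, horner_exp, hornerC).
have p0 : p.[0] = - martinet_value c1 d1 c2 d2 c3 d3 c4 d4 c5 d5.
  by rewrite pE /A1 /A2 /A3 /A4 /A5 /B1 /B2 /B3 /B4 /B5 !fE !mul0r !addr0 /martinet_value; ring.
have p1 : p.[1] = martinet_value a1 b1 a2 b2 a3 b3 a4 b4 a5 b5.
  by rewrite pE /A1 /A2 /A3 /A4 /A5 /B1 /B2 /B3 /B4 /B5 !fE !mul1r ![_ + (_ - _)]addrC !subrK.
have [|t t01 pt] := @poly_interp R p (z T).
  by rewrite p0 p1 zle andbT lerNl -mulN1r.
exists A1.[t], B1.[t], A2.[t], B2.[t], A3.[t], B3.[t], A4.[t], B4.[t], A5.[t], B5.[t].
rewrite -pE pt; have cN a b : combine nk (- a) b = combine nk a b :> R.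
  by case: (nk) => /=; rewrite normrN.
rewrite /A1 /A2 /A3 /A4 /A5 /B1 /B2 /B3 /B4 /B5 !fE; split => //.
- have -> : x T = (1 - t) * x T + t * x T by ring.
  have {1}-> : x T = - c1 - c2 - c3 - c4 - c5 by lra.
  by rewrite -aE; ring.
- have -> : y T = (1 - t) * y T + t * y T by ring.
  by rewrite -{1}dE -bE; ring.
- have := combine_convex nk (- c1) d1 a1 b1 t01; have := combine_convex nk (- c2) d2 a2 b2 t01.
  have := combine_convex nk (- c3) d3 a3 b3 t01; have := combine_convex nk (- c4) d4 a4 b4 t01.
  have := combine_convex nk (- c5) d5 a5 b5 t01; rewrite !cN.
  move: t01 cl dl => /andP[t0 t1].
  move: (combine nk c1 d1) (combine nk c2 d2) (combine nk c3 d3) (combine nk c4 d4) (combine nk c5 d5).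
  move: (combine nk a1 b1) (combine nk a2 b2) (combine nk a3 b3) (combine nk a4 b4) (combine nk a5 b5).
  move=> C1 C2 C3 C4 C5 E1 E2 E3 E4 E5 Cl El *.
  have : 0 <= t * (l - (C1 + C2 + C3 + C4 + C5)) by apply: mulr_ge0; lra.
  have : 0 <= (1 - t) * (l - (E1 + E2 + E3 + E4 + E5)) by apply: mulr_ge0; lra.
  lra.
Qed.

Definition martinet_step (q : 'rV[R]_3) (p : R * R) : 'rV[R]_3 :=
  vec3 (coord q 0 + p.1) (coord q 1 + p.2)
    (coord q 2 + p.1 * (coord q 1 ^+ 2 + coord q 1 * p.2 + p.2 ^+ 2 / 3)).

Lemma martinet_stepE x y z a b : martinet_step (vec3 x y z) (a, b) =
  vec3 (x + a) (y + b) (z + a * (y ^+ 2 + y * b + b ^+ 2 / 3)).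
Proof. by rewrite /martinet_step !coord_vec3. Qed.

Lemma martinet_step0 q : martinet_step q (0, 0) = q.
Proof. by rewrite [q]vec3_eta martinet_stepE; congr vec3; ring. Qed.

Lemma martinet_step_cubic x y z a b t : martinet_step (vec3 x y z) (t * a, t * b) =
  vec3 (cubic x a 0 0 t) (cubic y b 0 0 t) (cubic z (a * y ^+ 2) (a * y * b) (a * b ^+ 2 / 3) t).
Proof. by rewrite martinet_stepE /cubic; congr vec3; field. Qed.

Lemma martinet_step_flow q (a b t : R) :
  is_derive t 1 (fun t => martinet_step q (t * a, t * b))
    (a *: X1 (martinet_step q (t * a, t * b)) + b *: X2 (martinet_step q (t * a, t * b))).
Proof.
rewrite [q]vec3_eta; under eq_fun do rewrite martinet_step_cubic.
rewrite martinet_stepE /martinet_X1 /martinet_X2 !coord_vec3 //= !vec3Z vec3D.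
apply: (is_derive_eq (is_derive_vec3 (is_derive_cubic _ _ _ _ _) (is_derive_cubic _ _ _ _ _)
  (is_derive_cubic _ _ _ _ _))).
by congr vec3; field.
Qed.

Lemma martinet_step_lip q (a b r : R) : exists L : R, forall s t : R, 0 <= s <= r -> 0 <= t <= r ->
  enorm (martinet_step q (s * a, s * b) - martinet_step q (t * a, t * b)) <= L * `|s - t|.
Proof.
rewrite [q]vec3_eta; set x := coord q 0; set y := coord q 1; set z := coord q 2.
apply: (@enorm_cubic_lip _ _ _ (fun i => nth 0 [:: x; y; z] i)
  (fun i => nth 0 [:: a; b; a * y ^+ 2] i) (fun i => nth 0 [:: 0; 0; a * y * b] i)
  (fun i => nth 0 [:: 0; 0; a * b ^+ 2 / 3] i)) => t.
by rewrite martinet_step_cubic; apply: ord3P; rewrite mxE inordK.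
Qed.

Variable nk : normkind.
Local Notation cost := (@piece_cost R nk).
Local Notation endp := (@piece_end R 2 martinet_step).

Lemma martinet_endp_dist s : (sf_dist X1 X2 nk 0 (endp s) <= (cost s)%:E)%E.
Proof.
apply: polygonal_dist.
by apply: (@polygonal_endp _ _ _ _ _ martinet_step);
  [exact: martinet_step0|exact: martinet_step_flow|exact: martinet_step_lip].
Qed.

Lemma martinet_steer T g (l : R) : horizontal X1 X2 T g -> g 0 = 0 ->
  (sf_length X1 X2 nk T g <= l%:E)%E ->
  exists s, [/\ size s = 5%N, endp s = g T & cost s <= l].
Proof.
move=> hg g0 gl; have T0 : 0 <= T by case: hg.
have D := @horizontal_driven3 R (fun q => coord q 1 ^+ 2) (fun=> 0) nk T g hg.
set N := fun t => _ in D.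
have N0 t : (0 <= N t)%E by exact: sf_norm_ge0.
have c0 k : coord (g 0) k = 0 by rewrite g0 /Defs.coord mxE.
have D1 : driven N T (fun t => coord (g t) 0) (fun t => coord (g t) 1) (fun t => coord (g t) 2)
    (martinet_sys nk (fun t => coord (g t) 1)).
  by apply: (driven_imp D) => t dx dy dz e _ [-> ->]; split; rewrite ?mulr0 ?addr0.
have [a1 [b1 [a2 [b2 [a3 [b3 [a4 [b4 [a5 [b5 [aE bE cl zE]]]]]]]]]]] :=
  martinet_scalar_steer T0 N0 gl D1 (c0 0%N) (c0 1%N) (c0 2%N).
exists [:: (a1, b1); (a2, b2); (a3, b3); (a4, b4); (a5, b5)]; split => //.
  rewrite [g T]vec3_eta -aE -bE zE /martinet_value /piece_end /= -vec3_0 !martinet_stepE.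
  by congr vec3; ring.
by rewrite !cost_cons cost_nil /=; lra.
Qed.

(** Translations in x and z preserve the Martinet fields; only the starting height [y0] has to be
    kept. *)
Lemma martinet_cat s x0 y0 z0 X Y Z : foldl martinet_step (vec3 0 y0 0) s = vec3 X Y Z ->
  foldl martinet_step (vec3 x0 y0 z0) s = vec3 (x0 + X) Y (z0 + Z).
Proof.
elim/last_ind: s X Y Z => [|s [a b] IH] X Y Z.
  by rewrite /= => /vec3_inj[<- <- <-]; congr vec3; ring.
rewrite !foldl_rcons; have := vec3_eta (foldl martinet_step (vec3 0 y0 0) s).
move: (coord _ 0) (coord _ 1) (coord _ 2) => x y z E.
rewrite E (IH _ _ _ E) !martinet_stepE => /vec3_inj[<- <- <-].
by congr vec3; ring.
Qed.

Lemma martinet_reach q : exists s, endp s = q /\ (`|q| <= 1 -> cost s <= 6).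
Proof.
rewrite [q]vec3_eta; set x := coord q 0; set y := coord q 1; set z := coord q 2.
(* At height 1 a move in x changes z by the same amount. *)
exists [:: (0, 1); (z, 0); (0, -1); (x - z, 0); (0, y)]; split.
  by rewrite /piece_end /= -vec3_0 !martinet_stepE; congr vec3; field.
rewrite vec3_norm_le // => /and3P[x1 y1 z1].
rewrite !cost_cons /= cost_nil !combine_l0 !combine_0r !normrN normr1.
by have := ler_normB x z; lra.
Qed.

Definition martinet_wt (i : 'I_3) : nat := if (i < 2)%N then 1 else 3.

Lemma martinet_step_dil t q a b :
  martinet_step (dil martinet_wt t q) (t * a, t * b) = dil martinet_wt t (martinet_step q (a, b)).
Proof.
have E x y z : dil martinet_wt t (vec3 x y z) = vec3 (t * x) (t * y) (t ^+ 3 * z).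
  by apply/rowP; apply: ord3P; rewrite !mxE inordK // /martinet_wt inordK.
by rewrite [q]vec3_eta E !martinet_stepE E; congr vec3; field.
Qed.

Lemma martinet_phi_step k q a b : (k < 2)%N ->
  `|coord (martinet_step q (a, b)) k| <= `|coord q k| + combine nk a b.
Proof.
rewrite [q]vec3_eta martinet_stepE; case: k => [|[|//]] _; rewrite !coord_vec3 //=.
  by apply: le_trans (ler_normD _ _) _; rewrite lerD2l norm_combine_l.
by apply: le_trans (ler_normD _ _) _; rewrite lerD2l norm_combine_r.
Qed.

(** The factor [y ^+ 2 + y * b + b ^+ 2 / 3] is the mean of the squared height along the piece,
    hence at most [c ^+ 2]. *)
Lemma martinet_ht_step c q a b : 0 <= c -> `|coord q 1| <= c ->
  `|coord (martinet_step q (a, b)) 1| <= c ->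
  `|coord (martinet_step q (a, b)) 2 - coord q 2| <= c ^+ 2 * combine nk a b.
Proof.
rewrite [q]vec3_eta martinet_stepE !coord_vec3 //= => c0; set y := coord q 1 => yc ybc.
rewrite addrAC subrr add0r normrM mulrC.
apply: ler_pM => //; last exact: norm_combine_l.
have sq u : `|u| <= c -> u ^+ 2 <= c ^+ 2.
  by move=> uc; rewrite -(real_normK (num_real u)) ler_pXn2r // nnegrE.
have h1 := sq _ yc; have h2 := sq _ ybc; have h3 := sqr_ge0 (y + (y + b)).
have h4 := sqr_ge0 (y - (y + b)); have h5 := sqr_ge0 y; have h6 := sqr_ge0 (y + b).
rewrite ger0_norm; lra.
Qed.

Lemma martinet_phi0 k : `|coord (0 : 'rV[R]_3) k| = 0.
Proof. by rewrite /Defs.coord !mxE normr0. Qed.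

Lemma martinet_ht0 : coord (0 : 'rV[R]_3) 2 = 0.
Proof. by rewrite /Defs.coord !mxE. Qed.

Lemma martinet_cost_ge1 s : `|endp s| = 1 -> 1 <= cost s.
Proof.
have kc k : (k < 2)%N -> `|coord (endp s) k| <= cost s.
  move=> k2; exact: (@phi_le_cost _ _ _ _ (fun q => `|coord q k|) (martinet_phi0 k)
    (fun q a b => martinet_phi_step q a b k2)).
have := ht_le_cost (martinet_phi0 1) (fun q a b => martinet_phi_step q a b (isT : 1 < 2)%N)
  martinet_ht0 martinet_ht_step s => zc.
rewrite [endp s]vec3_eta => /vec3_norm1[] H; [by rewrite -H kc|by rewrite -H kc|].
rewrite H in zc; have c0 := cost_ge0 nk s; rewrite leNgt; apply/negP => c1.
by have := exprn_ilt1 3 c0 c1; move: zc; rewrite ltNge => ->.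
Qed.

(** The piece [(- a, 0)] at the start runs at height 0 and leaves z unchanged, whereas [(a, 0)]
    after [s1] gains [a] times the squared height, which exceeds [c ^+ 2]. *)
Lemma martinet_insertion (c : R) s1 s2 (w : R) : 0 < c -> c < `|coord (endp s1) 1| ->
  exists s, cost s <= cost (s1 ++ s2) + 2 * `|w| / c ^+ 2 /\
    endp s = endp (s1 ++ s2) + vec3 0 0 w.
Proof.
move=> c0; have := vec3_eta (endp s1); move: (coord (endp s1)) => p E1 cp.
have := vec3_eta (foldl martinet_step (vec3 0 (p 1%N) 0) s2).
move: (coord (foldl _ _ _)) => p' E2.
have p0 : p 1%N != 0 by rewrite -normr_gt0 (lt_trans c0).
pose a := w / p 1%N ^+ 2; exists ((- a, 0) :: s1 ++ (a, 0) :: s2); split.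
  rewrite !cost_cons !cost_cat cost_cons /= !combine_l0 normrN.
  have : `|a| <= `|w| / c ^+ 2.
    rewrite /a normrM normfV ler_wpM2l // lef_pV2 ?posrE ?exprn_gt0 // ?normr_gt0 ?sqrf_eq0 //.
    by rewrite normrX ler_pXn2r ?nnegrE ?(ltW c0) ?(ltW cp).
  lra.
rewrite endp_cat E1 (martinet_cat _ _ E2) vec3D.
have E1' := E1; rewrite /piece_end -vec3_0 in E1'.
rewrite /piece_end /= foldl_cat -{1}vec3_0 martinet_stepE addr0 (martinet_cat _ _ E1') /=.
rewrite martinet_stepE addr0 (martinet_cat _ _ E2) /a.
by congr vec3; field.
Qed.

(** Reduces both the Lipschitz estimate and continuity to a purely vertical correction: the
    remaining displacement is made by two final pieces, whose effect on z is included in [w]. *)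
Lemma martinet_append s q' (e : R) : `|endp s| = 1 -> `|q'| = 1 ->
  (forall w, `|w| <= 2 * `|endp s - q'| -> exists s', cost s' <= cost s + e /\
      endp s' = endp s + vec3 0 0 w) ->
  exists s', endp s' = q' /\ cost s' <= cost s + e + 2 * `|endp s - q'|.
Proof.
move=> s1 q1 H; set d := `|endp s - q'| in H *.
pose dx := coord q' 0 - coord (endp s) 0; pose dy := coord q' 1 - coord (endp s) 1.
have cd k : `|coord (endp s) k - coord q' k| <= d.
  by have := coord_le_norm (endp s - q') (inord k); rewrite !mxE.
have c1 : `|coord (endp s) 1| <= 1 by rewrite -s1; exact: coord_le_norm.
have dxd : `|dx| <= d by rewrite distrC; exact: cd.
have dyd : `|dy| <= d by rewrite distrC; exact: cd.
have [|s' [s'c s'e]] := H (coord q' 2 - coord (endp s) 2 - dx * coord (endp s) 1 ^+ 2).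
  apply: le_trans (ler_normB _ _) _; rewrite distrC.
  have := cd 2; have : `|dx * coord (endp s) 1 ^+ 2| <= d * 1.
    rewrite normrM normrX; apply: ler_pM => //; by rewrite expr_le1.
  lra.
exists (s' ++ [:: (dx, 0); (0, dy)]); split.
  rewrite endp_cat s'e [endp s]vec3_eta [q']vec3_eta vec3D /= !martinet_stepE /dx /dy !coord_vec3 //=.
  by congr vec3; field.
rewrite cost_cat !cost_cons /= combine_l0 combine_0r cost_nil; lra.
Qed.

Lemma martinet_lipset (c : R) : 0 < c -> c <= 1 -> lipset nk martinet_step 6
  [set q | `|q| = 1 /\ (c <= `|coord q 1| \/ c <= `|coord q 2|)].
Proof.
(* With cost at most 7, a word staying within [|y| <= k] would end with [|y| <= c / 8] and
   [|z| <= 7 c ^+ 2 / 64], both below [c]. *)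
move=> c0 c1; pose k : R := c / 8; have k0 : 0 < k by rewrite divr_gt0.
exists (4 / k ^+ 2 + 2) => [|s q' [s1 sc] [q1 _] sK].
  by rewrite addr_ge0 // divr_ge0 // sqr_ge0.
have [[sa [sb [sE ca]]]|[yk zk]] :=
    large_prefix (martinet_phi0 1) martinet_ht0 martinet_ht_step s (ltW k0); last first.
  exfalso; have : k ^+ 2 * cost s <= k ^+ 2 * 7.
    by rewrite ler_wpM2l ?sqr_ge0 //; lra.
  by rewrite /k in yk zk *; case: sc => h; nra.
have [w Hw|s' [s'q s'c]] := @martinet_append s q' (4 / k ^+ 2 * `|endp s - q'|) s1 q1.
  have [s' [s'c s'e]] := martinet_insertion sb w k0 ca; exists s'; rewrite -sE in s'c s'e *.
  split => //; apply: le_trans s'c _; rewrite lerD2l.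
  have -> : 4 / k ^+ 2 * `|endp s - q'| = (4 * `|endp s - q'|) / k ^+ 2 by ring.
  by rewrite ler_wpM2r ?invr_ge0 ?sqr_ge0 //; lra.
by exists s'; split => //; lra.
Qed.

(** Here no prefix needs to leave the line [y = 0]: a loop appended at the end, of side [k] in y and
    [a] in x, changes z by [a k (2 y + k)]. Its height [e / 8] is fixed by the tolerance, so the
    estimate is uniform without being Lipschitz. *)
Lemma martinet_cube_continuous (e : R) : 0 < e -> exists2 d : R, 0 < d &
  forall s q', `|endp s| = 1 -> `|q'| = 1 -> cost s <= 6 + 1 -> `|endp s - q'| < d ->
  exists s', endp s' = q' /\ cost s' <= cost s + e.
Proof.
move=> e0; pose h := e / 8; have h0 : 0 < h by rewrite divr_gt0.
have h20 : 0 < h ^+ 2 by rewrite exprn_gt0.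
exists (Num.min (e / 8) (h ^+ 2 * (e / 16))) => [|s q' s1 q1 _].
  by rewrite lt_min !divr_gt0 //= mulr_gt0 // divr_gt0.
rewrite lt_min => /andP[d1 d2]; set d := `|endp s - q'| in d1 d2.
have d0 : 0 <= d by exact: normr_ge0.
have [w Hw|s' [s'q s'c]] := @martinet_append s q' (e / 2) s1 q1; last first.
  by exists s'; split => //; rewrite -/d in s'c; lra.
set y := coord (endp s) 1.
(* The side [k] takes the sign of [y], so that the two terms of [k (2 y + k)] do not cancel. *)
have [k kh ky] : exists2 k : R, `|k| = h & h ^+ 2 <= k * (2 * y + k).
  have [y0|y0] := leP 0 y; [exists h|exists (- h)]; rewrite ?normrN ?(gtr0_norm h0) //; nra.
pose a := w / (k * (2 * y + k)).
have k0 : 0 < k * (2 * y + k) by apply: lt_le_trans ky.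
have ab : `|a| <= e / 8.
  rewrite /a normrM normfV (gtr0_norm k0) ler_pdivrMr //.
  have : e / 8 * h ^+ 2 <= e / 8 * (k * (2 * y + k)) by rewrite ler_wpM2l // divr_ge0 // ltW.
  by rewrite -/d in Hw; lra.
exists (s ++ [:: (0, k); (a, 0); (0, - k); (- a, 0)]); split.
  rewrite cost_cat !cost_cons cost_nil /= !combine_l0 !combine_0r !normrN kh /h; lra.
rewrite endp_cat [endp s]vec3_eta -/y /= !martinet_stepE vec3D.
have -> : w = a * (k * (2 * y + k)) by rewrite /a divfK // gt_eqF.
by congr vec3; field.
Qed.

Lemma lipset1 (q : 'rV[R]_3) : lipset nk martinet_step 6 [set q].
Proof.
exists 0 => // s q' /= sq -> _; exists s; split => //.
by rewrite mul0r addr0.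
Qed.

Lemma rat_between0 (x : R) : 0 < x -> exists q : rat, 0 < (ratr q : R) < x.
Proof. by move=> x0; have [q] := rat_in_itvoo x0; rewrite in_itv => qx; exists q. Qed.

Lemma face_val (i : 'I_3) b (v : 'rV[R]_2) k : face i b v ord0 (lift i k) = v ord0 k.
Proof. by rewrite mxE liftK. Qed.

(* On the faces x = 1 and x = -1 the centre gets a degenerate box. *)
Lemma martinet_box_lip (i : 'I_3) b (v : 'rV[R]_2) : (forall k, `|v ord0 k| <= 1) ->
  exists lo hi, [/\ box lo hi v, (forall v' : 'rV[R]_2, box lo hi v' -> forall k, `|v' ord0 k| <= 1) &
    lipset nk martinet_step 6 (face i b @` box lo hi)].
Proof.
move=> v1.
have e1 : ratr 1 = 1 :> R by exact: rmorph1.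
have e2 : ratr (-1) = -1 :> R by exact: rmorphN1.
(* On the faces with [|y| = 1] or [|z| = 1] the Lipschitz estimate with [c = 1] covers the whole
   face. *)
have big : i = inord 1 \/ i = inord 2 -> exists lo hi, [/\ box lo hi v,
    (forall v' : 'rV[R]_2, box lo hi v' -> forall k, `|v' ord0 k| <= 1) &
    lipset nk martinet_step 6 (face i b @` box lo hi)].
  move=> iE; exists (const_mx (-1)), (const_mx 1); split; [exact/unit_boxP|by move=> v' /unit_boxP|].
  apply: lipset_sub (martinet_lipset ltr01 (lexx 1)) => _ [v' /unit_boxP v'1 <-].
  split; first exact: norm_face.
  by case: iE => ->; [left|right]; rewrite /Defs.coord mxE unlift_none normrX normrN1 expr1n.
move: i big; apply: ord3P => big; [|by apply: big; left|by apply: big; right].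
have [v0|v0] := eqVneq v 0.
  exists 0, 0; have B0 (v' : 'rV[R]_2) : box 0 0 v' -> v' = 0.
    move=> H; apply/rowP => k; have := H k; rewrite !mxE raddf0 => /andP[h1 h2].
    by apply/eqP; rewrite eq_le h1 h2.
  split.
  - by move=> k; rewrite v0 !mxE raddf0 lexx.
  - by move=> v' /B0-> k; rewrite mxE normr0.
  by apply: lipset_sub (lipset1 (face (inord 0) b 0)) => _ [v' /B0-> <-].
have [k vk] : exists k, v ord0 k != 0.
  apply/existsP; rewrite -negb_forall; apply: contra v0 => /forallP H.
  by apply/eqP/rowP => k; rewrite (eqP (H k)) mxE.
have [c /andP[c0 cv]] : exists c : rat, 0 < (ratr c : R) < `|v ord0 k| by apply: rat_between0; rewrite normr_gt0.
have c1 : ratr c <= 1 :> R by apply: le_trans (ltW cv) (v1 k).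
have eN (x : rat) : ratr (- x) = - ratr x :> R by exact: rmorphN.
(* The part of the face where coordinate [k] has the sign of [v ord0 k] and absolute value at least
   [c]; it stays away from the centre. *)
pose lo : 'rV[rat]_2 := \row_j if (j == k) && (0 < v ord0 k) then c else -1.
pose hi : 'rV[rat]_2 := \row_j if (j == k) && (v ord0 k <= 0) then - c else 1.
have bE (v' : 'rV[R]_2) : box lo hi v' <-> (forall j, `|v' ord0 j| <= 1) /\
    (if 0 < v ord0 k then ratr c <= v' ord0 k else v' ord0 k <= - ratr c).
  rewrite /box /lo /hi /=; split => [H|[H1 H2] j].
    split => [j|]; last first.
      by have := H k; rewrite !mxE eqxx /=; case: ltP => _ /andP[]; rewrite ?eN.
    have := H j; rewrite !mxE ler_norml; case: eqP => _ /=; rewrite ?e1 ?e2 //.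
    by case: ltP => _ /andP[]; rewrite ?e1 ?e2 ?eN => h1 h2; apply/andP; split; lra.
  have := H1 j; rewrite !mxE ler_norml => /andP[h1 h2].
  case: eqP => [jk|_] /=; last by rewrite e1 e2 h1.
  by move: H2; rewrite jk in h1 h2 *; case: ltP => _ H2; rewrite ?e1 ?e2 ?eN ?h1 ?h2 ?H2.
exists lo, hi; split.
- apply/bE; split => //; move: cv; case: (ltP 0 (v ord0 k)) => h; first by rewrite gtr0_norm // => /ltW.
  by rewrite ler0_norm // ltrNr => /ltW.
- by move=> v' /bE[].
apply: lipset_sub (martinet_lipset c0 c1) => _ [v' /bE[v'1 v'c] <-].
split; first exact: norm_face.
have cv' : ratr c <= `|v' ord0 k|.
  move: v'c; case: ltP => _ h; first exact: le_trans (ler_norm _).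
  by rewrite -normrN; apply: le_trans (ler_norm _); rewrite lerNr.
move: cv'; rewrite -(face_val (inord 0) b v' k) /Defs.coord.
have : k = ord0 \/ k = lift ord0 ord0.
  by case: k {vk cv lo hi bE v'c} => -[|[|//]] k2; [left|right]; apply: val_inj.
have -> : inord 1 = lift (inord 0) ord0 :> 'I_3 by apply: val_inj; rewrite /= /bump !inordK.
have -> : inord 2 = lift (inord 0) (lift ord0 ord0) :> 'I_3.
  by apply: val_inj; rewrite /= /bump !inordK.
by case=> -> h; [left|right].
Qed.

Definition martinet_stepF (o : nat) : ord.formula R :=
  let v k := GRing.Var R (o + k) in
  ord.And (ord.Equal (v 0%N) (GRing.Add (v 6) (v 4)))
  (ord.And (ord.Equal (v 1%N) (GRing.Add (v 7) (v 5)))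
   (ord.Equal (v 2) (GRing.Add (v 8) (GRing.Mul (v 4)
     (GRing.Add (GRing.Add (GRing.Mul (v 7) (v 7)) (GRing.Mul (v 7) (v 5)))
        (GRing.Mul (GRing.Mul (v 5) (v 5)) (GRing.Const 3^-1))))))).

Lemma martinet_stepFP e o : ord.holds e (martinet_stepF o) <->
  dec3 (window e o) = martinet_step (dec3 (window e (o + 6))) (window e o 4, window e o 5).
Proof.
rewrite /dec3 martinet_stepE /window /= -!addnA !expr2.
by split=> [[-> [-> ->]] //|/vec3_inj[-> -> ->]].
Qed.

Theorem martinet_sphere r : 0 < r -> sphere_properties X1 X2 nk r.
Proof.
move=> r0; have reach q : exists s, endp s = q by have [s []] := martinet_reach q; exists s.
rewrite /sphere_properties (sf_sphere_pdist martinet_endp_dist martinet_steer reach).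
have cube (q : 'rV[R]_3) : `|q| <= 1 -> exists s, endp s = q /\ cost s <= 6.
  by move=> q1; have [s [sq /(_ q1)]] := martinet_reach q; exists s.
have w0 i : (0 < martinet_wt i)%N by rewrite /martinet_wt; case: ifP.
split.
- apply: (pdist_sphere_homeo reach w0 martinet_step_dil martinet_cost_ge1 cube _ r0).
  exact: martinet_cube_continuous.
- apply: (pdist_sphere_rectifiable reach w0 martinet_step_dil martinet_cost_ge1 cube _ _ r0) => //.
  exact: martinet_box_lip.
- exact: (pdist_semianalytic martinet_endp_dist martinet_steer reach (@dec3_ext R) (@dec3_surj R) (@dec3_env R)
    martinet_stepFP (@zero3FP R)).
Qed.

End MartinetSphere.

Theorem mainTheorem1 (R : realType) (b : normkind) (r : R) :
  0 < r ->
  [/\ sphere_properties (@heis_X1 R) (@heis_X2 R) b r,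
      sphere_properties (@grushin_X1 R) (@grushin_X2 R) b r &
      sphere_properties (@martinet_X1 R) (@martinet_X2 R) b r].
Proof.
by move=> r0; split; [exact: heis_sphere|exact: grushin_sphere|exact: martinet_sphere].
Qed.
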